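(* Let $\Omega$ be a Polish space, $c\in L^\infty(\Omega\times\Omega)$, and $P,Q$ Borel probability measures on $\Omega$. For $t\in\mathbb R$ let $\operatorname{RCol}_c(P,Q,t)=\pi_{P,Q}(\{(x,y):c(x,y)\le t\})$. For any finite collection $\{t_1,\dots,t_l\}\subseteq\mathbb R$, as $n,m\to\infty$ with $\frac{m}{n+m}\to\lambda\in(0,1)$, $$\sqrt{\frac{nm}{n+m}}\Big(\operatorname{RCol}_c(P_n,Q_m,t_i)-\operatorname{RCol}_c(P,Q,t_i)\Big)_{i=1,\dots,l}\to\mathcal N\big(0,\Sigma_\lambda(t_1,\dots,t_l)\big)\quad\text{in distribution},$$ with covariance $\Sigma_\lambda(t_1,\dots,t_l)_{ij}=\operatorname{Cov}(Z_i,Z_j)$, where $$Z_i=\sqrt\lambda\,(I_{L^2_0(P)}-A_QA_P)^{-1}(\eta_{i,\mathrm x}-A_Q\eta_{i,\mathrm y})(X)+\sqrt{1-\lambda}\,(I_{L^2_0(Q)}-A_PA_Q)^{-1}(\eta_{i,\mathrm y}-A_P\eta_{i,\mathrm x})(Y)$$ with independent $X\sim P$, $Y\sim Q$, and $\eta_i(x,y)=\mathbf 1(c(x,y)\le t_i)$.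
   Context: $L^\infty$ denotes bounded Borel-measurable functions. Put $C(x,y)=\exp(-c(x,y))$. For Borel probability measures $P,Q$ on $\Omega$, the entropic optimal transport plan $\pi_{P,Q}$ is the unique minimizer of $\int c\,d\pi+\mathrm{KL}(\pi\mid P\otimes Q)$ over couplings $\pi\in\Pi(P,Q)$. The potentials are the unique bounded measurable $f_{P,Q},g_{P,Q}:\Omega\to\mathbb R$ with, everywhere on $\Omega$, $f_{P,Q}=-\log\int C(\cdot,y)e^{g_{P,Q}(y)}dQ(y)$, $g_{P,Q}=-\log\int C(x,\cdot)e^{f_{P,Q}(x)}dP(x)$, and $\int g_{P,Q}\,dQ=0$. With $\xi_{P,Q}(x,y)=C(x,y)e^{f_{P,Q}(x)+g_{P,Q}(y)}$, $d\pi_{P,Q}=\xi_{P,Q}\,d(P\otimes Q)$. Samples: $X_1,\dots,X_n$ i.i.d. $\sim P$ and $Y_1,\dots,Y_m$ i.i.d. $\sim Q$ are mutually independent, $P_n=\frac1n\sum_i\delta_{X_i}$, $Q_m=\frac1m\sum_j\delta_{Y_j}$. Operators: $(A_Pf)(y)=\int\xi_{P,Q}(x,y)f(x)dP(x)$, $(A_Qg)(x)=\int\xi_{P,Q}(x,y)g(y)dQ(y)$. $L^2_0(\mu)$ denotes the mean-zero functions in $L^2(\mu)$; $I_{L^2_0(P)}-A_QA_P$ and $I_{L^2_0(Q)}-A_PA_Q$ have bounded inverses on $L_0^2(P)$ and $L_0^2(Q)$. Functions: $\eta_{i,\mathrm x}(x)=\int\eta_i(x,y)\xi_{P,Q}(x,y)dQ(y)$,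 $\eta_{i,\mathrm y}(y)=\int\eta_i(x,y)\xi_{P,Q}(x,y)dP(x)$. *)

(* Defs.v *)
From HB Require Import structures.
From mathcomp Require Import all_boot all_order all_algebra.
From mathcomp Require Import all_classical all_reals all_analysis.

Set Implicit Arguments.
Unset Strict Implicit.
Unset Printing Implicit Defensive.

Import Order.TTheory GRing.Theory Num.Theory.
Import numFieldNormedType.Exports.

Local Open Scope classical_set_scope.
Local Open Scope ring_scope.

Notation borel T := (g_sigma_algebraType (@open T)).

Definition polish (R : realType) (T : topologicalType) : Prop :=
  (exists2 D : set T, countable D & dense D) /\
  exists dist : T -> T -> R,
    [/\ (forall x y, 0 <= dist x y) /\ (forall x y, dist x y = 0 <-> x = y),
        (forall x y, dist x y = dist y x) /\
          (forall x y z, dist x z <= dist x y + dist y z),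
        (forall A : set T, open A <->
          forall x, A x ->
            exists2 e : R, 0 < e & [set y | dist x y < e] `<=` A) &
        (forall u : nat -> T,
          (forall e : R, 0 < e -> exists N, forall i j,
            (N <= i)%N -> (N <= j)%N -> dist (u i) (u j) < e) ->
          exists x, forall e : R, 0 < e ->
            exists N, forall i, (N <= i)%N -> dist x (u i) < e)].

Definition bounded_by_some (R : realType) (U : Type) (f : U -> R) : Prop :=
  exists M, forall x, `|f x| <= M.

Section eot.
Context {R : realType} {T : ptopologicalType}.
Implicit Types (P Q : probability (borel T) R) (c : T * T -> R) (t : R).

Definition coupling P Q
    (pi : probability (borel T * borel T)%type R) : Prop :=
  (forall A : set (borel T), measurable A -> pi (A `*` setT) = P A) /\
  (forall B : set (borel T), measurable B -> pi (setT `*` B) = Q B).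

Definition KL d (U : measurableType d) (mu nu : probability U R) : \bar R :=
  if pselect (mu `<< nu) then
    (\int[mu]_z
       (ln (fine (Radon_Nikodym (charge_of_finite_measure mu) nu z)))%:E)%E
  else +oo%E.

Definition eot_cost c P Q (pi : probability (borel T * borel T)%type R)
    : \bar R :=
  (\int[pi]_z (c z)%:E + KL pi (P \x Q))%E.

Definition is_eot_plan c P Q (pi : probability (borel T * borel T)%type R)
    : Prop :=
  coupling P Q pi /\
  forall pi', coupling P Q pi' -> (eot_cost c P Q pi <= eot_cost c P Q pi')%E.

(* The minimizer exists and is unique for c bounded measurable and T Polish,
   so the default value of [get] plays no role; likewise for [potentials] and
   [inv_L20] below (the latter up to null sets). *)
Definition eot_plan c P Q : probability (borel T * borel T)%type R :=
  get [set pi | is_eot_plan c P Q pi].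

Definition RCol c P Q t : R := fine (eot_plan c P Q [set z | c z <= t]).

Definition is_potentials c P Q (fg : (T -> R) * (T -> R)) : Prop :=
  [/\ measurable_fun [set: borel T] fg.1 /\ bounded_by_some fg.1,
      measurable_fun [set: borel T] fg.2 /\ bounded_by_some fg.2,
      (forall x,
        fg.1 x = - ln (\int[Q]_y (expR (- c (x, y)) * expR (fg.2 y)))),
      (forall y,
        fg.2 y = - ln (\int[P]_x (expR (- c (x, y)) * expR (fg.1 x)))) &
      \int[Q]_y fg.2 y = 0].

Definition potentials c P Q : (T -> R) * (T -> R) :=
  get [set fg | is_potentials c P Q fg].

Definition xi c P Q (z : T * T) : R :=
  expR (- c z) * expR ((potentials c P Q).1 z.1 + (potentials c P Q).2 z.2).

Definition opP c P Q (f : T -> R) (y : T) : R :=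
  \int[P]_x (xi c P Q (x, y) * f x).

Definition opQ c P Q (g : T -> R) (x : T) : R :=
  \int[Q]_y (xi c P Q (x, y) * g y).

Definition L20 (mu : probability (borel T) R) (f : T -> R) : Prop :=
  f \in Lfun mu 2%:E /\ \int[mu]_x f x = 0.

(* A representative of (I - A)^-1 r, the inverse being taken in L^2_0(mu). *)
Definition inv_L20 (mu : probability (borel T) R)
    (A : (T -> R) -> (T -> R)) (r : T -> R) : T -> R :=
  get [set h | L20 mu h /\ {ae mu, forall x, h x - A h x = r x}].

Definition eta c t : T * T -> R := \1_[set z | c z <= t].

Definition eta_x c P Q t (x : T) : R :=
  \int[Q]_y (eta c t (x, y) * xi c P Q (x, y)).

Definition eta_y c P Q t (y : T) : R :=
  \int[P]_x (eta c t (x, y) * xi c P Q (x, y)).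

(* A function on T * T, seen as a random variable under P \x Q: the two
   coordinates are the independent X ~ P and Y ~ Q. *)
Definition Zlim c P Q (lambda : R) t (z : T * T) : R :=
  Num.sqrt lambda *
    inv_L20 P (opQ c P Q \o opP c P Q)
      (eta_x c P Q t \- opQ c P Q (eta_y c P Q t)) z.1 +
  Num.sqrt (1 - lambda) *
    inv_L20 Q (opP c P Q \o opQ c P Q)
      (eta_y c P Q t \- opP c P Q (eta_x c P Q t)) z.2.

Definition Sigma c P Q (lambda : R) (l : nat) (t : 'I_l -> R) : 'M[R]_l :=
  \matrix_(i, j)
    fine (covariance (P \x Q)%E
            (Zlim c P Q lambda (t i)) (Zlim c P Q lambda (t j))).

(* Normalizing the sum of the Dirac masses at x_0, ..., x_{n-1} gives
   n^-1 * \sum_(i < n) \d_(x i); the second argument of [mnormalize] is only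
   used when n = 0. *)
Definition empirical (n : nat) (x : nat -> T) : probability (borel T) R :=
  mnormalize (msum (fun i => \d_(x i : borel T)) n) \d_(point : borel T).

End eot.

Section random_elements.
Context {R : realType} {d : measure_display} {S : measurableType d}.
Variable Pr : probability S R.

Definition has_law (T : ptopologicalType) (X : S -> T)
    (P : probability (borel T) R) : Prop :=
  measurable_fun setT (X : S -> borel T) /\
  forall A : set (borel T), measurable A -> Pr (X @^-1` A) = P A.

Definition mutually_independent (T : ptopologicalType) (I : eqType)
    (X : I -> S -> T) : Prop :=
  forall (s : seq I) (A : I -> set (borel T)), uniq s ->
    (forall i, measurable (A i)) ->
    Pr (\bigcap_(i in [set` s]) X i @^-1` A i) =
    (\big[*%E/1]_(i <- s) Pr (X i @^-1` A i))%E.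

Definition cvg_in_law (V : ptopologicalType) (W : nat -> S -> V)
    (N : probability (borel V) R) : Prop :=
  (forall k, measurable_fun setT (W k : S -> borel V)) /\
  forall phi : V -> R, continuous phi -> bounded_by_some phi ->
    (fun k => \int[Pr]_w phi (W k w)) @ \oo --> (\int[N]_v phi v : R).

End random_elements.

(* [normal_prob 0 0] is not a point mass, hence the case distinction. *)
Definition centered_normal1 (R : realType) (v : R) (B : set R) : \bar R :=
  if v == 0 then \d_(0 : R) B else normal_prob 0 (Num.sqrt v) B.

(* N(0, V) on R^l, V possibly singular: every linear form u has law
   N(0, u V u^T). *)
Definition is_centered_normal (R : realType) (l : nat) (V : 'M[R]_l)
    (N : probability (borel 'rV[R]_l) R) : Prop :=
  forall (u : 'rV[R]_l) (B : set R), measurable B ->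
    N [set v | B (\sum_i u 0 i * v 0 i)] =
    centered_normal1 ((u *m V *m u^T) 0 0) B.

(* Main.v *)
Require Import Defs.
From HB Require Import structures.
From mathcomp Require Import all_boot all_order all_algebra.
From mathcomp Require Import all_classical all_reals all_analysis.
From mathcomp Require Import measurable_realfun ring lra.

Set Implicit Arguments.
Unset Strict Implicit.
Unset Printing Implicit Defensive.

Import Order.TTheory GRing.Theory Num.Theory.
Import numFieldNormedType.Exports.

Local Open Scope classical_set_scope.
Local Open Scope ring_scope.

(** For any pair of probability measures the entropic plan is a scaling
  [u x * v y] of the Gibbs kernel exp(-c): the scaling is the limit of Sinkhorn's
  iteration, and Gibbs' inequality identifies it with the minimizer.  Hence the
  plan of the empirical pair (P_n, Q_m) is e^(a + b) xi d(P_n x Q_m), and the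
  strong monotonicity of the exponential bounds |a|^2 + |b|^2 by the squared
  fluctuations of the empirical marginals of xi, of order 1/n + 1/m.

  Let [p, q] be bounded solutions of p + A_Q q = eta_x and q + A_P p = eta_y;
  they exist because xi is bounded below, which makes A_P and A_Q contract the
  bounded mean-zero functions.  As the marginals of the empirical plan are exact,
  RCol(P_n, Q_m, t) minus the empirical means of [p] and [q] is the integral of
  h e^(a + b), where h = (eta - p - q) xi is completely degenerate; so it is a
  degenerate U-statistic plus terms quadratic in the fluctuations, and it is
  negligible.  The statistic is thus asymptotically linear.

  The linear part converges by Lindeberg's replacement, written with commuting
  convolution operators.  Products of cubic B-splines are smooth test functions
  forming a partition of unity, which is enough for convergence in law. *)

(** * Bounded measurable functions *)

(** Population and empirical potentials must be compared at the sample points, so almost everywhere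
    statements are avoided: functions are defined everywhere and bounded, and the lemmas on plans
    and scalings hold for arbitrary pairs of measures. [L20] enters only when the representative
    chosen by [inv_L20] is identified, up to null sets, with a bounded solution. Two obstacles shape
    the proof. The plan is selected by [get], so its measurability in the sample is invisible; this
    is why the scalings come from an explicit iteration converging pointwise. And for a merely
    measurable cost no uniform law of large numbers over the potentials is at hand, so only second
    moments are used and no operator is inverted at the sample level: the tilt [a + b] is bounded a
    priori in terms of the kernel alone, then in mean square by testing its two marginal equations
    against [a] and [b]. All errors are of order 1/n + 1/m in mean, while the rate is at most the
    square root of min(n, m), so they vanish in the limit. *)

Definition bmf (R : realType) d (U : measurableType d) (f : U -> R) : Prop :=
  measurable_fun setT f /\ bounded_by_some f.

Section bmf_closure.
Context {R : realType} d {U : measurableType d}.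
Implicit Types f g : U -> R.

Lemma bmf_meas f : bmf f -> measurable_fun setT f. Proof. by case. Qed.

Lemma bmf_bnd f : bmf f -> exists2 M, 0 <= M & forall x, `|f x| <= M.
Proof.
case=> _ [M fM]; exists `|M| => // x.
exact: le_trans (fM x) (ler_norm _).
Qed.

Lemma bmf_cst (r : R) : bmf (fun _ : U => r).
Proof. by split; [exact: measurable_cst | exists `|r|]. Qed.

Lemma bmfD f g : bmf f -> bmf g -> bmf (fun x => f x + g x).
Proof.
move=> [mf [M fM]] [mg [N gN]]; split; first exact: measurable_funD.
by exists (M + N) => x; apply: le_trans (ler_normD _ _) _; exact: lerD.
Qed.

Lemma bmfN f : bmf f -> bmf (fun x => - f x).
Proof.
move=> [mf [M fM]]; split; first exact: measurable_funN.
by exists M => x; rewrite normrN.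
Qed.

Lemma bmfB f g : bmf f -> bmf g -> bmf (fun x => f x - g x).
Proof. by move=> bf bg; apply: bmfD => //; exact: bmfN. Qed.

Lemma bmfM f g : bmf f -> bmf g -> bmf (fun x => f x * g x).
Proof.
move=> [mf [M fM]] [mg [N gN]]; split; first exact: measurable_funM.
by exists (M * N) => x; rewrite normrM ler_pM.
Qed.

Lemma bmfX f n : bmf f -> bmf (fun x => f x ^+ n).
Proof.
move=> bf; elim: n => [|n IH]; first exact: bmf_cst.
by under eq_fun do rewrite exprS; exact: bmfM.
Qed.

Lemma bmf_norm f : bmf f -> bmf (fun x => `|f x|).
Proof.
move=> [mf [M fM]]; split; first exact: measurableT_comp.
by exists M => x; rewrite normr_id.
Qed.

Lemma bmf_expR f : bmf f -> bmf (fun x => expR (f x)).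
Proof.
move=> [mf [M fM]]; split; first exact: measurableT_comp.
exists (expR M) => x; rewrite ger0_norm ?expR_ge0// ler_expR.
by apply: le_trans (fM x); exact: ler_norm.
Qed.

Lemma bmf_sum (I : Type) (s : seq I) (F : I -> U -> R) :
  (forall i, bmf (F i)) -> bmf (fun x => \sum_(i <- s) F i x).
Proof.
move=> bF; elim: s => [|i s IH].
  by under eq_fun do rewrite big_nil; exact: bmf_cst.
by under eq_fun do rewrite big_cons; exact: bmfD.
Qed.

Lemma bmf_prod (I : Type) (s : seq I) (F : I -> U -> R) :
  (forall i, bmf (F i)) -> bmf (fun x => \prod_(i <- s) F i x).
Proof.
move=> bF; elim: s => [|i s IH].
  by under eq_fun do rewrite big_nil; exact: bmf_cst.
by under eq_fun do rewrite big_cons; exact: bmfM.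
Qed.

Lemma measurable_funV f : measurable_fun setT f -> (forall x, 0 < f x) ->
  measurable_fun setT (fun x => (f x)^-1).
Proof.
move=> mf f0.
have -> : (fun x => (f x)^-1) = (fun x => expR (- ln (f x))).
  by apply/funext => x; rewrite expRN lnK// posrE.
apply: measurableT_comp; first exact: measurable_expR.
by apply: measurable_funN; apply: measurableT_comp => //; exact: measurable_ln.
Qed.

Lemma bmf_inv f (e : R) : bmf f -> 0 < e -> (forall x, e <= f x) ->
  bmf (fun x => (f x)^-1).
Proof.
move=> [mf _] e0 ef; have f0 x : 0 < f x by exact: lt_le_trans (ef x).
split; first exact: measurable_funV.
exists e^-1 => x; rewrite gtr0_norm ?invr_gt0// lef_pV2 ?posrE//.
Qed.

Lemma bmf_ln f (e : R) : bmf f -> 0 < e -> (forall x, e <= f x) ->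
  bmf (fun x => ln (f x)).
Proof.
move=> bf e0 ef; have [M M0 fM] := bmf_bnd bf.
have f0 x : 0 < f x by exact: lt_le_trans (ef x).
split; first by apply: measurableT_comp; [exact: measurable_ln | case: bf].
exists (`|ln e| + `|ln M|) => x; rewrite ler_norml; apply/andP; split.
  apply: (@le_trans _ _ (ln e)); last by rewrite ler_ln// posrE.
  by rewrite lerNl; apply: le_trans (ler_norm _) _; rewrite normrN lerDl.
have fxM : f x <= M by apply: le_trans (fM x); exact: ler_norm.
apply: (@le_trans _ _ (ln M)); last by apply: le_trans (ler_norm _) _; rewrite lerDr.
by rewrite ler_ln// posrE//; exact: lt_le_trans fxM.
Qed.

Lemma bmf_indic (A : set U) : measurable A -> bmf (\1_A : U -> R).
Proof.
move=> mA; split; first exact: measurable_indic.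
by exists 1 => x; rewrite indicE; case: (_ \in _); rewrite ?normr1// normr0.
Qed.

Lemma bmf_comp d' (V : measurableType d') (h : V -> U) f :
  measurable_fun setT h -> bmf f -> bmf (fun v => f (h v)).
Proof.
move=> mh [mf [M fM]]; split; first exact: measurableT_comp.
by exists M.
Qed.

End bmf_closure.

(** * Integration of bounded functions against probability measures *)

Section bmf_integral.
Context {R : realType} d {U : measurableType d}.
Variable mu : probability U R.
Implicit Types f g : U -> R.

Lemma bmf_int f : bmf f -> mu.-integrable setT (EFin \o f).
Proof.
move=> [mf [M fM]]; apply: measurable_bounded_integrable => //.
  by rewrite (le_lt_trans (probability_le1 mu measurableT))// ltry.
exists M; split; first exact: num_real.
by move=> N MN x _ /=; exact: le_trans (fM x) (ltW MN).
Qed.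

Lemma EFin_Rint f : mu.-integrable setT (EFin \o f) ->
  (\int[mu]_x f x)%:E = (\int[mu]_x (f x)%:E)%E.
Proof. by move=> h; rewrite /Rintegral fineK//; exact: integrable_fin_num. Qed.

Lemma Rint_cst (r : R) : \int[mu]_x r = r.
Proof. by rewrite Rintegral_cst//= (_ : mu setT = 1%E) ?mulr1//; exact: probability_setT. Qed.

Lemma RintD f g : bmf f -> bmf g ->
  \int[mu]_x (f x + g x) = \int[mu]_x f x + \int[mu]_x g x.
Proof. by move=> bf bg; rewrite RintegralD//; exact: bmf_int. Qed.

Lemma RintB f g : bmf f -> bmf g ->
  \int[mu]_x (f x - g x) = \int[mu]_x f x - \int[mu]_x g x.
Proof. by move=> bf bg; rewrite RintegralB//; exact: bmf_int. Qed.

Lemma RintZl (r : R) f : bmf f ->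
  \int[mu]_x (r * f x) = r * \int[mu]_x f x.
Proof. by move=> bf; rewrite RintegralZl//; exact: bmf_int. Qed.

Lemma RintZr (r : R) f : bmf f ->
  \int[mu]_x (f x * r) = (\int[mu]_x f x) * r.
Proof. by move=> bf; rewrite RintegralZr//; exact: bmf_int. Qed.

Lemma Rint_sum (I : Type) (s : seq I) (F : I -> U -> R) :
  (forall i, bmf (F i)) ->
  \int[mu]_x (\sum_(i <- s) F i x) = \sum_(i <- s) \int[mu]_x F i x.
Proof.
move=> bF; elim: s => [|i s IH].
  by under eq_Rintegral do rewrite big_nil; rewrite big_nil Rint_cst.
under eq_Rintegral do rewrite big_cons.
by rewrite big_cons RintD// ?IH//; exact: bmf_sum.
Qed.

Lemma le_Rint f g : bmf f -> bmf g -> (forall x, f x <= g x) ->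
  \int[mu]_x f x <= \int[mu]_x g x.
Proof. by move=> bf bg fg; apply: le_Rintegral => //; exact: bmf_int. Qed.

Lemma Rint_ge0 f : (forall x, 0 <= f x) -> 0 <= \int[mu]_x f x.
Proof. by move=> f0; apply: Rintegral_ge0. Qed.

Lemma Rint_ge f (e : R) : bmf f -> (forall x, e <= f x) -> e <= \int[mu]_x f x.
Proof. by move=> bf ef; rewrite -[e]Rint_cst; apply: le_Rint => //; exact: bmf_cst. Qed.

Lemma Rint_le f (e : R) : bmf f -> (forall x, f x <= e) -> \int[mu]_x f x <= e.
Proof. by move=> bf ef; rewrite -[e]Rint_cst; apply: le_Rint => //; exact: bmf_cst. Qed.

Lemma norm_Rint f : bmf f -> `|\int[mu]_x f x| <= \int[mu]_x `|f x|.
Proof. by move=> bf; apply: le_normr_Rintegral => //; exact: bmf_int. Qed.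

Lemma norm_Rint_le f (M : R) : bmf f -> (forall x, `|f x| <= M) ->
  `|\int[mu]_x f x| <= M.
Proof.
move=> bf fM; apply: le_trans (norm_Rint bf) _.
by apply: Rint_le => //; exact: bmf_norm.
Qed.

(* The variance of [f] is nonnegative. *)
Lemma sqr_Rint f : bmf f -> (\int[mu]_x f x) ^+ 2 <= \int[mu]_x (f x ^+ 2).
Proof.
move=> bf; set m := \int[mu]_x f x.
have : 0 <= \int[mu]_x ((f x - m) ^+ 2) by apply: Rint_ge0 => x; exact: sqr_ge0.
have -> : \int[mu]_x ((f x - m) ^+ 2) = \int[mu]_x (f x ^+ 2 + ((-2 * m) * f x + m ^+ 2)).
  by apply: eq_Rintegral => x _; ring.
rewrite RintD; [|exact: bmfX|]; last first.
  by apply: bmfD; [apply: bmfM => //|]; exact: bmf_cst.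
rewrite RintD; [|apply: bmfM => //|]; [|exact: bmf_cst|exact: bmf_cst].
rewrite RintZl// Rint_cst -/m; lra.
Qed.

End bmf_integral.

Lemma norm_Rint1_le (R : realType) d (U : measurableType d) (mu : probability U R)
  (f : U -> R) : bmf f -> `|\int[mu]_x f x| ^+ 2 <= \int[mu]_x (f x ^+ 2).
Proof. by move=> bf; rewrite real_normK ?num_real//; exact: sqr_Rint. Qed.

(** The ascription makes the product a [probability], so that the lemmas on bounded integrands apply
    to it directly. *)
Definition prodP (R : realType) d1 d2 (U : measurableType d1)
    (V : measurableType d2) (mu : probability U R) (nu : probability V R) :
  probability (U * V)%type R := (mu \x nu)%E.

(** * Fubini's theorem for bounded functions *)

Section bmf_fubini.
Context {R : realType} d1 d2 {U : measurableType d1} {V : measurableType d2}.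
Variables (mu : probability U R) (nu : probability V R).
Implicit Types f : U * V -> R.

Lemma bmf_pair1 f x : bmf f -> bmf (fun y => f (x, y)).
Proof. by move=> bf; apply: (bmf_comp (h := fun y => (x, y))) bf; exact: pair1_measurable. Qed.

Lemma bmf_pair2 f y : bmf f -> bmf (fun x => f (x, y)).
Proof. by move=> bf; apply: (bmf_comp (h := fun x => (x, y))) bf; exact: pair2_measurable. Qed.

(** Tonelli's measurability statement asks for a nonnegative integrand, so [f] is raised by its
    bound [M]; under a probability the shift comes out of the integral as [M] again. *)
Lemma bmf_Rint2 f : bmf f -> bmf (fun x => \int[nu]_y f (x, y)).
Proof.
move=> bf; have [M M0 fM] := bmf_bnd bf; split; last first.
  by exists M => x; apply: norm_Rint_le => //; exact: bmf_pair1.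
have mp : measurable_fun setT (fun z => (f z + M)%:E).
  by apply/measurable_EFinP; apply: measurable_funD => //; exact: bmf_meas bf.
have p0 z : (0 <= (f z + M)%:E)%E by rewrite lee_fin -lerBlDr sub0r; have := fM z; rewrite ler_norml => /andP[].
have := @measurable_fun_fubini_tonelli_F _ _ U V R nu (fun z : U * V => (f z + M)%:E) mp p0.
move=> mF.
have -> : (fun x => \int[nu]_y f (x, y)) =
    (fun x => fine (\int[nu]_y (f (x, y) + M)%:E)%E - M).
  apply/funext => x.
  have -> : fine (\int[nu]_y (f (x, y) + M)%:E)%E = \int[nu]_y (f (x, y) + M) by [].
  rewrite RintD ?Rint_cst ?addrK//; [exact: bmf_pair1 | exact: bmf_cst].
apply: measurable_funB => //.
by apply: measurableT_comp mF; exact: fine_measurable.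
Qed.

Lemma bmf_Rint1 f : bmf f -> bmf (fun y => \int[mu]_x f (x, y)).
Proof.
move=> bf; have [M M0 fM] := bmf_bnd bf; split; last first.
  by exists M => x; apply: norm_Rint_le => //; exact: bmf_pair2.
have mp : measurable_fun setT (fun z => (f z + M)%:E).
  by apply/measurable_EFinP; apply: measurable_funD => //; exact: bmf_meas bf.
have p0 z : (0 <= (f z + M)%:E)%E by rewrite lee_fin -lerBlDr sub0r; have := fM z; rewrite ler_norml => /andP[].
have := @measurable_fun_fubini_tonelli_G _ _ U V R mu (fun z : U * V => (f z + M)%:E) mp p0.
move=> mF.
have -> : (fun y => \int[mu]_x f (x, y)) =
    (fun y => fine (\int[mu]_x (f (x, y) + M)%:E)%E - M).
  apply/funext => y.
  have -> : fine (\int[mu]_x (f (x, y) + M)%:E)%E = \int[mu]_x (f (x, y) + M) by [].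
  rewrite RintD ?Rint_cst ?addrK//; [exact: bmf_pair2 | exact: bmf_cst].
apply: measurable_funB => //.
by apply: measurableT_comp mF; exact: fine_measurable.
Qed.

Lemma Rint_prod12 f : bmf f ->
  \int[prodP mu nu]_z f z = \int[mu]_x \int[nu]_y f (x, y).
Proof.
move=> bf; rewrite {1}/Rintegral /prodP -integral12_prod_meas1; last exact: (bmf_int (prodP mu nu)).
congr fine; apply: eq_integral => x _.
by rewrite EFin_Rint//; apply: bmf_int; exact: bmf_pair1.
Qed.

Lemma Rint_prod21 f : bmf f ->
  \int[prodP mu nu]_z f z = \int[nu]_y \int[mu]_x f (x, y).
Proof.
move=> bf; rewrite {1}/Rintegral /prodP -integral21_prod_meas1; last exact: (bmf_int (prodP mu nu)).
congr fine; apply: eq_integral => x _.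
by rewrite EFin_Rint//; apply: bmf_int; exact: bmf_pair2.
Qed.

Lemma Rint_swap f : bmf f ->
  \int[mu]_x \int[nu]_y f (x, y) = \int[nu]_y \int[mu]_x f (x, y).
Proof. by move=> bf; rewrite -Rint_prod12// Rint_prod21. Qed.

End bmf_fubini.

Lemma Rint_prod_fst (R : realType) d1 d2 (U : measurableType d1)
    (V : measurableType d2) (mu : probability U R) (nu : probability V R)
    (f : U -> R) : bmf f -> \int[prodP mu nu]_z f z.1 = \int[mu]_x f x.
Proof.
move=> bf; rewrite Rint_prod12; last exact: (bmf_comp (@measurable_fst _ _ U V)).
by apply: eq_Rintegral => x _ /=; rewrite Rint_cst.
Qed.

Lemma Rint_prod_snd (R : realType) d1 d2 (U : measurableType d1)
    (V : measurableType d2) (mu : probability U R) (nu : probability V R)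
    (f : V -> R) : bmf f -> \int[prodP mu nu]_z f z.2 = \int[nu]_y f y.
Proof.
move=> bf; rewrite Rint_prod12; last exact: (bmf_comp (@measurable_snd _ _ U V)).
by rewrite /= Rint_cst.
Qed.

Lemma Rint_pushforward (R : realType) d1 d2 (U : measurableType d1)
    (V : measurableType d2) (mu : probability U R) (nu : probability V R)
    (h : U -> V) (f : V -> R) : measurable_fun setT h ->
  (forall A, measurable A -> mu (h @^-1` A) = nu A) -> bmf f ->
  \int[nu]_y f y = \int[mu]_x f (h x).
Proof.
move=> mh hE bf; rewrite /Rintegral; congr fine.
have -> : (\int[nu]_y (f y)%:E = \int[pushforward mu h]_y (f y)%:E)%E.
  by apply: eq_measure_integral => //= A mA _; rewrite -hE.
rewrite integral_pushforward//; last exact: bmf_int (bmf_comp mh bf).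
by apply/measurable_EFinP; exact: bmf_meas bf.
Qed.

Lemma ge0_integral_EFinD (R : realType) d (U : measurableType d)
    (mu : probability U R) (f g : U -> R) :
  measurable_fun setT f -> measurable_fun setT g ->
  (forall x, 0 <= f x) -> (forall x, 0 <= g x) ->
  (\int[mu]_x (f x + g x)%:E = \int[mu]_x (f x)%:E + \int[mu]_x (g x)%:E)%E.
Proof.
move=> mf mg f0 g0; under eq_integral do rewrite EFinD.
apply: ge0_integralD => //.
- by move=> x _; rewrite lee_fin.
- exact/measurable_EFinP.
- by move=> x _; rewrite lee_fin.
- exact/measurable_EFinP.
Qed.

Lemma ge0_integral_EFinZl (R : realType) d (U : measurableType d)
    (mu : {measure set U -> \bar R}) (k : R) (f : U -> R) :
  measurable_fun setT f -> (forall x, 0 <= f x) -> 0 <= k ->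
  (\int[mu]_x (k * f x)%:E = k%:E * \int[mu]_x (f x)%:E)%E.
Proof.
move=> mf f0 k0; under eq_integral do rewrite EFinM.
apply: ge0_integralZl => //.
- exact/measurable_EFinP.
- by move=> x _; rewrite lee_fin.
Qed.

(** * Convergence of Sinkhorn's iteration *)

(** Geometric increments form a Cauchy sequence. The tail bound depends on [K] and [th] only, which
    turns pointwise convergence of a family of functions into uniform convergence. *)
Lemma geometric_step_cvg (R : realType) (a : nat -> R) (K th : R) :
  0 <= th -> th < 1 -> (forall n, `|a n.+1 - a n| <= K * th ^+ n) ->
  exists2 l, a @ \oo --> l & forall n, `|a n - l| <= K * th ^+ n / (1 - th).
Proof.
move=> th0 th1 aE.
have th1' : 0 < 1 - th by rewrite subr_gt0.
have K0 : 0 <= K by have := aE 0%N; rewrite expr0 mulr1; apply: le_trans.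
have step n p : `|a (n + p)%N - a n| <= K * th ^+ n * (1 - th ^+ p) / (1 - th).
  elim: p => [|p IH].
    by rewrite addn0 !subrr normr0 mulr0 mul0r.
  rewrite addnS (_ : a (n + p).+1 - a n = (a (n + p).+1 - a (n + p)%N) + (a (n + p)%N - a n)); last by ring.
  apply: le_trans (ler_normD _ _) _.
  apply: le_trans (lerD (aE _) IH) _.
  rewrite le_eqVlt; apply/orP; left; apply/eqP.
  by rewrite exprS exprD; field; rewrite gt_eqF.
have bnd n p : `|a (n + p)%N - a n| <= K * th ^+ n / (1 - th).
  apply: le_trans (step n p) _; rewrite ler_pM2r ?invr_gt0//.
  by apply: ler_piMr; [apply: mulr_ge0 => //; exact: exprn_ge0 | rewrite lerBlDr lerDl exprn_ge0].
have geo0 : (fun n => K * th ^+ n / (1 - th)) @ \oo --> (0 : R).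
  rewrite -[X in _ --> X](_ : K * 0 / (1 - th) = 0); last by rewrite mulr0 mul0r.
  apply: cvgM; last exact: cvg_cst.
  by apply: cvgM; [exact: cvg_cst | apply: cvg_expr; rewrite ger0_norm].
have ca : cvgn a.
  apply/cauchy_cvgP/cauchy_exP => e e0.
  have /cvgrPdist_lt/(_ e e0)[N _ HN] := geo0.
  exists (a N); exists N => // n /= Nn.
  rewrite -(subnKC Nn) /ball /= distrC; apply: le_lt_trans (bnd N _) _.
  have := HN N (leqnn N); rewrite /= sub0r normrN; apply: le_lt_trans.
  exact: ler_norm.
exists (limn a) => // n; rewrite distrC.
have cn : (fun p => `|a (n + p)%N - a n|) @ \oo --> `|limn a - a n|.
  apply: cvg_norm; apply: cvgB; last exact: cvg_cst.
  have -> : (fun p => a (n + p)%N) = [sequence a (p + n)%N]_p by apply/funext => p /=; rewrite addnC.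
  by rewrite cvg_shiftn.
by apply: (cvgr_to_le cn); near=> p; exact: bnd.
Unshelve. all: by end_near.
Qed.

(* Up to a multiplicative constant, [u] and [u'] agree within a factor [r]. *)
Definition ratio_le (R : realType) (U : Type) (r : R) (u u' : U -> R) :=
  forall x x', u x * u' x' <= r * (u x' * u' x).

(** * Contraction of positive kernels up to scaling *)

Section kernel_ratio.
Context {R : realType} d1 d2 {U : measurableType d1} {V : measurableType d2}.
Variables (mu : probability U R) (C : U * V -> R) (k0 k1 : R).
Hypotheses (bC : bmf C) (k0_gt0 : 0 < k0) (Ck0 : forall z, k0 <= C z)
  (Ck1 : forall z, C z <= k1).

Lemma bmf_kernel_mul (u : U -> R) y : bmf u -> bmf (fun x => C (x, y) * u x).
Proof. by move=> bu; apply: bmfM => //; exact: bmf_pair2. Qed.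

Let C_gt0 z : 0 < C z. Proof. exact: lt_le_trans (Ck0 z). Qed.

(** Any two kernel values have quotient at least [k0 / k1]; a cross-ratio involves two such
    quotients, hence the square. *)
Lemma doeblin x x' y y' :
  (k0 / k1) ^+ 2 * (C (x', y) * C (x, y')) <= C (x, y) * C (x', y').
Proof.
have k1_gt0 : 0 < k1 by apply: lt_le_trans (Ck1 (x, y)).
have le a b : k0 / k1 * C a <= C b.
  apply: le_trans (Ck0 b); rewrite mulrAC ler_pdivrMr// ler_wpM2l// ltW//.
have k_ge0 : 0 <= k0 / k1 by rewrite divr_ge0 ?ltW.
rewrite expr2 mulrACA mulrC.
by rewrite [leRHS]mulrC; apply: ler_pM => //; apply: mulr_ge0 => //; exact: ltW.
Qed.

(** A form of Birkhoff's contraction for Hilbert's projective metric. Both products are double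
    integrals over [mu] twice, and their difference is the integral of [(k - kT) * Dp], where [Dp]
    is the positive part of [a - aT]. The hypothesis bounds [Dp] by [(r - 1) * aT], and [doeblin]
    bounds [k - kT] by a fraction of [k]. *)
Lemma kernel_ratio (r : R) (u u' : U -> R) : bmf u -> bmf u' ->
  (forall x, 0 < u x) -> (forall x, 0 < u' x) -> 1 <= r -> ratio_le r u u' ->
  ratio_le (1 + (1 - (k0 / k1) ^+ 2) * (r - 1))
    (fun y => \int[mu]_x (C (x, y) * u x)) (fun y => \int[mu]_x (C (x, y) * u' x)).
Proof.
move=> bu bu' u0 u'0 r1 ur y y'.
set dl := (k0 / k1) ^+ 2.
have bmf1 (f : U -> R) : bmf f -> bmf (fun z : U * U => f z.1).
  by move=> bf; apply: (bmf_comp (h := fst)) => //; exact: measurable_fst.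
have bmf2 (f : U -> R) : bmf f -> bmf (fun z : U * U => f z.2).
  by move=> bf; apply: (bmf_comp (h := snd)) => //; exact: measurable_snd.
pose k (z : U * U) := C (z.1, y) * C (z.2, y').
pose kT (z : U * U) := C (z.2, y) * C (z.1, y').
pose a (z : U * U) := u z.1 * u' z.2.
pose aT (z : U * U) := u z.2 * u' z.1.
have bk : bmf k by apply: bmfM; [apply: bmf1 (bmf_pair2 y bC) | apply: bmf2 (bmf_pair2 y' bC)].
have bkT : bmf kT by apply: bmfM; [apply: bmf2 (bmf_pair2 y bC) | apply: bmf1 (bmf_pair2 y' bC)].
have ba : bmf a by apply: bmfM; [exact: bmf1|exact: bmf2].
have baT : bmf aT by apply: bmfM; [exact: bmf2|exact: bmf1].
(* [Dp] and [Dm] are the positive and negative parts of the antisymmetric function [a - aT], so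
   exchanging the two variables turns one into the other. *)
pose Dp z := 2^-1 * (a z - aT z + `|a z - aT z|).
pose Dm z := 2^-1 * (aT z - a z + `|aT z - a z|).
have bDp : bmf Dp.
  apply: bmfM; [exact: bmf_cst|apply: bmfD; [exact: bmfB|apply: bmf_norm; exact: bmfB]].
have bDm : bmf Dm.
  apply: bmfM; [exact: bmf_cst|apply: bmfD; [exact: bmfB|apply: bmf_norm; exact: bmfB]].
have prodE (f g : U -> R) : bmf f -> bmf g ->
   \int[mu]_x f x * \int[mu]_x g x = \int[prodP mu mu]_z (f z.1 * g z.2).
  move=> bf bg; rewrite Rint_prod12; last by apply: bmfM; [exact: bmf1|exact: bmf2].
  rewrite -RintZr//; apply: eq_Rintegral => x _ /=.
  by rewrite RintZl.
have swapE (f : U * U -> R) : bmf f ->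
   \int[prodP mu mu]_z f (z.2, z.1) = \int[prodP mu mu]_z f z.
  move=> bf; rewrite Rint_prod12; last first.
    by apply: (bmf_comp (h := fun z : U * U => (z.2, z.1))) bf; apply: measurable_fun_pair.
  by rewrite Rint_prod21.
rewrite !prodE; try exact: bmf_kernel_mul.
have -> : \int[prodP mu mu]_z (C (z.1, y) * u z.1 * (C (z.2, y') * u' z.2)) =
  \int[prodP mu mu]_z (k z * aT z + k z * Dp z - k z * Dm z).
  by apply: eq_Rintegral => z _; rewrite /k /Dp /Dm [in `|aT z - _|]distrC /a /aT; field.
rewrite RintB; [| by apply: bmfD; exact: bmfM | exact: bmfM].
rewrite RintD; [| exact: bmfM | exact: bmfM].
have -> : \int[prodP mu mu]_z (k z * Dm z) = \int[prodP mu mu]_z (kT z * Dp z).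
  by rewrite -swapE//; exact: bmfM.
have -> : \int[prodP mu mu]_z (C (z.1, y') * u z.1 * (C (z.2, y) * u' z.2)) =
   \int[prodP mu mu]_z (k z * aT z).
  rewrite -[RHS]swapE; last exact: bmfM.
  by apply: eq_Rintegral => z _; rewrite /k /aT /=; ring.
rewrite -addrA -RintB; [|exact: bmfM|exact: bmfM].
rewrite mulrDl mul1r lerD2l -RintZl; last exact: bmfM.
apply: le_Rint; [by apply: bmfB; exact: bmfM | by apply: bmfM; [exact: bmf_cst|exact: bmfM] |].
move=> z.
have Dp0 : 0 <= Dp z by rewrite mulr_ge0 ?invr_ge0//; have := ler_norm (- (a z - aT z)); rewrite normrN; lra.
have aT0 : 0 < aT z by rewrite mulr_gt0.
have DpE : Dp z <= (r - 1) * aT z.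
  rewrite /Dp; have := ur z.1 z.2; rewrite -/(a z) -/(aT z) => ar.
  have : 0 <= (r - 1) * aT z by rewrite mulr_ge0 ?subr_ge0// ltW.
  case: (ger0P (a z - aT z)) => h; lra.
have k_gt0 : 0 < k z by rewrite mulr_gt0.
have kkT : dl * k z <= kT z.
  by have := doeblin z.2 z.1 y y'; rewrite /k /kT -/dl.
have dl1 : dl <= 1.
  have k1_gt0 : 0 < k1 by apply: lt_le_trans (Ck1 (z.1, y)).
  apply: exprn_ile1; first by rewrite divr_ge0 ?ltW.
  rewrite ler_pdivrMr// mul1r.
  exact: le_trans (Ck0 (z.1, y)) (Ck1 (z.1, y)).
apply: (@le_trans _ _ ((1 - dl) * k z * Dp z)).
  by rewrite -mulrBl; apply: ler_wpM2r => //; rewrite mulrBl mul1r lerD2l lerN2.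
rewrite [leRHS](_ : _ = (1 - dl) * k z * ((r - 1) * aT z)); last by ring.
by apply: ler_wpM2l => //; rewrite mulr_ge0 ?subr_ge0// ltW.
Qed.

End kernel_ratio.

Definition bmf_pos (R : realType) d (U : measurableType d) (f : U -> R) : Prop :=
  bmf f /\ exists2 e, 0 < e & forall x, e <= f x.

Definition swap_kernel (A U V : Type) (C : U * V -> A) (z : V * U) := C (z.2, z.1).

(** The scaling of the second variable that makes its marginal exact, given [u]; on logarithms it is
    the soft c-transform. *)
Definition sink_half (R : realType) d1 d2 (U : measurableType d1)
    (V : measurableType d2) (mu : probability U R) (C : U * V -> R)
    (u : U -> R) (y : V) : R := (\int[mu]_x (C (x, y) * u x))^-1.

(* The normalization [u x0 = 1] makes the iterates converge pointwise. *)
Definition sink_step (R : realType) d1 d2 (U : measurableType d1)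
    (V : measurableType d2) (mu : probability U R) (nu : probability V R)
    (C : U * V -> R) (x0 : U) (u : U -> R) (x : U) : R :=
  let w := sink_half nu (swap_kernel C) (sink_half mu C u) in w x / w x0.

Definition sink_iter (R : realType) d1 d2 (U : measurableType d1)
    (V : measurableType d2) (mu : probability U R) (nu : probability V R)
    (C : U * V -> R) (x0 : U) (n : nat) : U -> R :=
  iter n (sink_step mu nu C x0) (fun=> 1).

Section sink_half_theory.
Context {R : realType} d1 d2 {U : measurableType d1} {V : measurableType d2}.
Variables (mu : probability U R) (C : U * V -> R) (k0 k1 : R).
Hypotheses (bC : bmf C) (k0_gt0 : 0 < k0) (k01 : k0 <= k1) (Ck0 : forall z, k0 <= C z)
  (Ck1 : forall z, C z <= k1).

Let E (u : U -> R) := \int[mu]_x u x.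

Lemma bmf_pos_Rint (u : U -> R) : bmf_pos u -> 0 < E u.
Proof. by case=> bu [e e0 eu]; apply: (lt_le_trans e0); exact: Rint_ge. Qed.

Lemma bmf_pos_gt0 d (W : measurableType d) (u : W -> R) x : bmf_pos u -> 0 < u x.
Proof. by case=> _ [e e0 eu]; exact: lt_le_trans (eu x). Qed.

Let lo (u : U -> R) y : bmf_pos u -> k0 * E u <= \int[mu]_x (C (x, y) * u x).
Proof.
move=> pu; rewrite -RintZl; last by case: pu.
apply: le_Rint; [by apply: bmfM; [exact: bmf_cst|case: pu] | by apply: bmf_kernel_mul => //; case: pu|].
by move=> x; rewrite ler_wpM2r// ltW// bmf_pos_gt0.
Qed.

Let hi (u : U -> R) y : bmf_pos u -> \int[mu]_x (C (x, y) * u x) <= k1 * E u.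
Proof.
move=> pu; rewrite -RintZl; last by case: pu.
apply: le_Rint; [by apply: bmf_kernel_mul => //; case: pu|by apply: bmfM; [exact: bmf_cst|case: pu]|].
by move=> x; rewrite ler_wpM2r// ltW// bmf_pos_gt0.
Qed.

Lemma kernel_Rint_gt0 (u : U -> R) y : bmf_pos u -> 0 < \int[mu]_x (C (x, y) * u x).
Proof. by move=> pu; apply: lt_le_trans (lo y pu); rewrite mulr_gt0// bmf_pos_Rint. Qed.

Lemma bmf_kernel_Rint (u : U -> R) : bmf u -> bmf (fun y => \int[mu]_x (C (x, y) * u x)).
Proof.
move=> bu; apply: (bmf_Rint1 mu (f := fun z : U * V => C z * u z.1)).
by apply: bmfM => //; apply: (bmf_comp (h := fst)) => //; exact: measurable_fst.
Qed.

Lemma sink_half_pos (u : U -> R) : bmf_pos u -> bmf_pos (sink_half mu C u).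
Proof.
move=> pu; have Eu := bmf_pos_Rint pu; have bu : bmf u by case: pu.
split; first by apply: (bmf_inv (e := k0 * E u)); [exact: bmf_kernel_Rint|exact: mulr_gt0|move=> y; exact: lo].
exists (k1 * E u)^-1.
  rewrite invr_gt0 mulr_gt0//.
  exact: lt_le_trans k01.
by move=> y; rewrite /sink_half lef_pV2 ?posrE ?kernel_Rint_gt0 ?hi//; apply: lt_le_trans (hi y pu); exact: kernel_Rint_gt0.
Qed.

(** The integral of [u] against the kernel lies between [k0] and [k1] times the integral of [u]; the
    latter cancels in the quotient, so the constant does not depend on [u]. *)
Lemma sink_half_harnack (u : U -> R) y y' : bmf_pos u ->
  sink_half mu C u y <= k1 / k0 * sink_half mu C u y'.
Proof.
move=> pu; have Eu := bmf_pos_Rint pu.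
rewrite /sink_half ler_pdivlMr ?kernel_Rint_gt0// mulrC ler_pdivrMr ?kernel_Rint_gt0//.
apply: le_trans (hi _ pu) _; rewrite mulrAC ler_pdivlMr// -mulrA.
apply: ler_wpM2l; first exact: ltW (lt_le_trans k0_gt0 k01).
by rewrite mulrC; exact: lo.
Qed.

(** Taking inverses exchanges the two points in [ratio_le], hence the appeal to [kernel_ratio] with
    [y] and [y'] reversed. *)
Lemma sink_half_ratio (r : R) (u u' : U -> R) : bmf_pos u -> bmf_pos u' ->
  1 <= r -> ratio_le r u u' ->
  ratio_le (1 + (1 - (k0 / k1) ^+ 2) * (r - 1)) (sink_half mu C u) (sink_half mu C u').
Proof.
move=> pu pu' r1 ur y y'.
have := kernel_ratio mu bC k0_gt0 Ck0 Ck1 pu.1 pu'.1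
  (fun x => bmf_pos_gt0 x pu) (fun x => bmf_pos_gt0 x pu') r1 ur y' y.
rewrite /sink_half -!invfM => h.
have g (f : U -> R) z : bmf_pos f -> 0 < \int[mu]_x (C (x, z) * f x) by exact: kernel_Rint_gt0.
rewrite ler_pdivlMr ?mulr_gt0 ?g// mulrC ler_pdivrMr ?mulr_gt0 ?g//.
Qed.

End sink_half_theory.

(** * Pointwise limit of the normalized iteration *)

Section sinkhorn_convergence.
Context {R : realType} d1 d2 {U : measurableType d1} {V : measurableType d2}.
Variables (mu : probability U R) (nu : probability V R) (C : U * V -> R).
Variables (k0 k1 : R) (x0 : U).
Hypotheses (bC : bmf C) (k0_gt0 : 0 < k0) (k01 : k0 <= k1)
  (Ck0 : forall z, k0 <= C z) (Ck1 : forall z, C z <= k1).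

Let L := k1 / k0.
Let th := 1 - (k0 / k1) ^+ 2.
Let step := sink_step mu nu C x0.
Let un := sink_iter mu nu C x0.

Let k1_gt0 : 0 < k1. Proof. exact: lt_le_trans k01. Qed.

Let L1 : 1 <= L. Proof. by rewrite ler_pdivlMr// mul1r. Qed.

Let L_gt0 : 0 < L. Proof. exact: lt_le_trans L1. Qed.

Let th_ge0 : 0 <= th.
Proof.
rewrite subr_ge0; apply: exprn_ile1; first by rewrite divr_ge0 ?ltW.
by rewrite ler_pdivrMr// mul1r.
Qed.

Let th_lt1 : th < 1.
Proof. by rewrite gtrBl exprn_gt0// divr_gt0. Qed.

Lemma bmf_swap_kernel : bmf (swap_kernel C).
Proof. by apply: (bmf_comp (h := fun z : V * U => (z.2, z.1))) bC; exact: measurable_fun_pair. Qed.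

Let bCs := bmf_swap_kernel.
Let Cs0 z : k0 <= swap_kernel C z. Proof. exact: Ck0. Qed.
Let Cs1 z : swap_kernel C z <= k1. Proof. exact: Ck1. Qed.

Let pos_w (u : U -> R) : bmf_pos u ->
  bmf_pos (sink_half nu (swap_kernel C) (sink_half mu C u)).
Proof. by move=> pu; exact: (sink_half_pos nu bCs k0_gt0 k01 Cs0 Cs1 (sink_half_pos mu bC k0_gt0 k01 Ck0 Ck1 pu)). Qed.

Let step_pos (u : U -> R) : bmf_pos u -> bmf_pos (step u).
Proof.
move=> /pos_w pw; have w0 := bmf_pos_gt0 x0 pw; case: pw => bw [e e0 ew].
split; first by apply: bmfM => //; exact: bmf_cst.
exists (e / sink_half nu (swap_kernel C) (sink_half mu C u) x0); first by rewrite divr_gt0.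
by move=> x; apply: ler_wpM2r => //; rewrite invr_ge0 ltW.
Qed.

Let step_x0 (u : U -> R) : bmf_pos u -> step u x0 = 1.
Proof. by move=> /pos_w pw; rewrite /step /sink_step divff// gt_eqF// bmf_pos_gt0. Qed.

Let step_le (u : U -> R) x : bmf_pos u -> step u x <= L.
Proof.
move=> pu; have w0 := bmf_pos_gt0 x0 (pos_w pu).
rewrite /step /sink_step ler_pdivrMr//.
by apply: (sink_half_harnack nu bCs k0_gt0 k01 Cs0 Cs1); exact: (sink_half_pos mu bC k0_gt0 k01 Ck0 Ck1 pu).
Qed.

Let step_ge (u : U -> R) x : bmf_pos u -> L^-1 <= step u x.
Proof.
move=> pu; have w0 := bmf_pos_gt0 x0 (pos_w pu).
rewrite /step /sink_step ler_pdivlMr// mulrC ler_pdivrMr// mulrC.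
by apply: (sink_half_harnack nu bCs k0_gt0 k01 Cs0 Cs1); exact: (sink_half_pos mu bC k0_gt0 k01 Ck0 Ck1 pu).
Qed.

Let ratio_le_weak (r r' : R) (W : Type) (u u' : W -> R) : (forall x, 0 < u x) ->
  (forall x, 0 < u' x) -> r <= r' -> ratio_le r u u' -> ratio_le r' u u'.
Proof.
move=> u0 u'0 rr h x x'; apply: le_trans (h x x') _.
by rewrite ler_wpM2r// mulr_ge0// ltW.
Qed.

Let step_ratio (r : R) (u u' : U -> R) : bmf_pos u -> bmf_pos u' -> 1 <= r ->
  ratio_le r u u' -> ratio_le (1 + th * (r - 1)) (step u) (step u').
Proof.
move=> pu pu' r1 ur.
have h1 := sink_half_ratio mu bC k0_gt0 Ck0 Ck1 pu pu' r1 ur.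
have pv := sink_half_pos mu bC k0_gt0 k01 Ck0 Ck1 pu.
have pv' := sink_half_pos mu bC k0_gt0 k01 Ck0 Ck1 pu'.
have r1' : 1 <= 1 + (1 - (k0 / k1) ^+ 2) * (r - 1).
  by rewrite lerDl mulr_ge0// subr_ge0.
have := sink_half_ratio nu bCs k0_gt0 Cs0 Cs1 pv pv' r1' h1.
move=> h2.
(* The second half step contracts once more; that extra factor is given up, leaving the rate
   [th]. *)
have h3 : ratio_le (1 + th * (r - 1)) (sink_half nu (swap_kernel C) (sink_half mu C u))
   (sink_half nu (swap_kernel C) (sink_half mu C u')).
  apply: ratio_le_weak h2 => //.
  - by move=> x; exact: bmf_pos_gt0 (pos_w pu).
  - by move=> x; exact: bmf_pos_gt0 (pos_w pu').
  - rewrite lerD2l -/th (_ : 1 + th * (r - 1) - 1 = th * (r - 1)); last by ring.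
    apply: ler_piMl; [by rewrite mulr_ge0// subr_ge0|exact: ltW].
move=> x x'; rewrite /step /sink_step mulf_div [leRHS](_ : _ =
  (1 + th * (r - 1)) * (sink_half nu (swap_kernel C) (sink_half mu C u) x' * sink_half nu (swap_kernel C) (sink_half mu C u') x)
  / (sink_half nu (swap_kernel C) (sink_half mu C u) x0 * sink_half nu (swap_kernel C) (sink_half mu C u') x0)).
  by rewrite ler_pM2r ?h3// invr_gt0 mulr_gt0// bmf_pos_gt0//; exact: pos_w.
by rewrite mulf_div mulrA.
Qed.

(** At [x0] both functions equal 1, which removes the free multiplicative constant: comparing [x]
    with [x0] turns closeness in ratio into closeness of values. *)
Let ratio_dist (r : R) (u u' : U -> R) x : 1 <= r -> (forall x, 0 < u x <= L) ->
  (forall x, 0 < u' x <= L) -> u x0 = 1 -> u' x0 = 1 -> ratio_le r u u' ->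
  `|u x - u' x| <= L * (r - 1).
Proof.
move=> r1 uL u'L ux0 u'x0 h.
have := h x x0; have := h x0 x; rewrite ux0 u'x0 !mul1r !mulr1 => h1 h2.
have /andP[a0 aL] := uL x; have /andP[b0 bL] := u'L x.
have r0 : 0 <= r - 1 by rewrite subr_ge0.
have h3 : u x - u' x <= L * (r - 1).
  apply: (@le_trans _ _ (u' x * (r - 1))); last exact: ler_wpM2r.
  by rewrite mulrBr mulr1 lerD2r mulrC.
have h4 : u' x - u x <= L * (r - 1).
  apply: (@le_trans _ _ (u x * (r - 1))); last exact: ler_wpM2r.
  by rewrite mulrBr mulr1 lerD2r mulrC.
by rewrite ler_norml h3 andbT lerNl opprB.
Qed.

Lemma sink_iter_pos n : bmf_pos (sink_iter mu nu C x0 n).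
Proof.
elim: n => [|n IH]; last exact: step_pos.
by split; [exact: bmf_cst|exists 1].
Qed.

Let un_pos n : bmf_pos (un n) := sink_iter_pos n.

Let un_le n x : 0 < un n x <= L.
Proof.
rewrite bmf_pos_gt0//=; case: n => [//|n]; exact: step_le.
Qed.

Let un_ge n x : L^-1 <= un n x.
Proof.
case: n => [|n]; last exact: step_ge.
by rewrite /un /= invf_le1.
Qed.

Let un_x0 n : un n x0 = 1. Proof. by case: n => [//|n]; exact: step_x0. Qed.

(** The initial ratio is [L ^+ 2] because [un 0] is 1 and [un 1] takes values between [L^-1] and
    [L]; each further step multiplies the excess over 1 by [th]. *)
Let un_ratio n : ratio_le (1 + th ^+ n * (L ^+ 2 - 1)) (un n.+1) (un n).
Proof.
have L21 : 0 <= L ^+ 2 - 1 by rewrite subr_ge0 exprn_ege1.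
elim: n => [|n IH].
  rewrite expr0 mul1r subrKC => x x'.
  have /andP[a0 aL] := un_le 1 x; have hx := un_ge 1 x'.
  rewrite (_ : un 0 x = 1)// (_ : un 0 x' = 1)// !mulr1; apply: le_trans aL _.
  rewrite -[leLHS]mulr1 -(mulfV (lt0r_neq0 L_gt0)) mulrA -expr2.
  by apply: ler_wpM2l => //; exact: exprn_ge0 (ltW L_gt0).
have r1 : 1 <= 1 + th ^+ n * (L ^+ 2 - 1) by rewrite lerDl mulr_ge0// exprn_ge0.
have := step_ratio (sink_iter_pos n.+1) (sink_iter_pos n) r1 IH.
by rewrite addrAC subrr add0r mulrA -exprS.
Qed.

Let K := L * (L ^+ 2 - 1).
Let K0 : 0 <= K. Proof. by apply: mulr_ge0; [exact: ltW | rewrite subr_ge0 exprn_ege1]. Qed.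

Let un_step x n : `|un n.+1 x - un n x| <= K * th ^+ n.
Proof.
apply: le_trans (@ratio_dist _ _ _ _ _ (un_le n.+1) (un_le n) (un_x0 n.+1) (un_x0 n) (un_ratio n)) _.
  by rewrite lerDl; apply: mulr_ge0; [exact: exprn_ge0 | rewrite subr_ge0 exprn_ege1].
by rewrite addrAC subrr add0r mulrCA -/K mulrC.
Qed.

(** The limit is a fixed point of the normalized step, which a priori only says that [u x] times the
    integral of [C v] is constant in [x]. Integrating [C u v] in both orders shows that the constant
    is 1. The convergence clauses serve later for measurability in the sample. *)
Theorem sinkhorn_converges : exists u : U -> R,
  [/\ bmf_pos u, (forall x, u x * \int[nu]_y (C (x, y) * sink_half mu C u y) = 1),
     (forall x, un n x @[n --> \oo] --> u x) &
     (forall y, sink_half mu C (un n) y @[n --> \oo] --> sink_half mu C u y)].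
Proof.
have lim x := geometric_step_cvg th_ge0 th_lt1 (un_step x).
pose u x := limn (un ^~ x).
have unu x : un n x @[n --> \oo] --> u x.
  by have [l h _] := lim x; rewrite /u (cvg_lim _ h).
pose eps n := K * th ^+ n / (1 - th).
have dist n x : `|un n x - u x| <= eps n.
  by have [l h h'] := lim x; rewrite /u (cvg_lim _ h)//; exact: h'.
have eps0 n : 0 <= eps n by apply: divr_ge0; [apply: mulr_ge0 => //; exact: exprn_ge0 | rewrite subr_ge0 ltW].
have epsc : eps n @[n --> \oo] --> (0 : R).
  rewrite -[X in _ --> X](_ : K * 0 / (1 - th) = 0); last by rewrite mulr0 mul0r.
  apply: cvgM; last exact: cvg_cst.
  by apply: cvgM; [exact: cvg_cst | apply: cvg_expr; rewrite ger0_norm].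
have u_le x : u x <= L.
  by apply: (cvgr_to_le (unu x)); near=> n; have /andP[] := un_le n x.
have u_ge x : L^-1 <= u x.
  by apply: (cvgr_to_ge (unu x)); near=> n; exact: un_ge.
have u_gt0 x : 0 < u x by apply: lt_le_trans (u_ge x); rewrite invr_gt0.
have ux0 : u x0 = 1.
  by rewrite /u (_ : (un ^~ x0) = fun=> 1) ?lim_cst//; apply/funext => n; exact: un_x0.
have pu : bmf_pos u.
  split; last by exists L^-1; rewrite ?invr_gt0.
  split; last by exists L => x; rewrite gtr0_norm.
  apply: (@measurable_fun_cvg _ _ _ setT un) => // n.
  by have [[]] := sink_iter_pos n.
(* A uniform error [eps n] is a relative error [eps n * L], as both functions are at least [L^-1];
   two values are compared, hence the square. *)
have rat n : ratio_le ((1 + eps n * L) ^+ 2) (un n) u.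
  move=> x x'; rewrite (_ : _ * (_ * _) = ((1 + eps n * L) * u x) * ((1 + eps n * L) * un n x')); last by ring.
  have hh a b e : L^-1 <= b -> a - b <= e -> 0 <= e -> a <= (1 + e * L) * b.
    move=> bL abe e0.
    have : e <= e * L * b.
      by rewrite -mulrA ler_peMr// mulrC -ler_pdivrMr// div1r.
    by lra.
  apply: ler_pM; [by have /andP[/ltW] := un_le n x|exact: ltW| |].
    apply: hh => //; apply: le_trans (dist n x); exact: ler_norm.
  apply: hh => //.
  by apply: le_trans (dist n x'); rewrite distrC; exact: ler_norm.
have r1 n : 1 <= (1 + eps n * L) ^+ 2.
  by rewrite exprn_ege1// lerDl mulr_ge0// ltW.
have rc : (1 + eps n * L) ^+ 2 - 1 @[n --> \oo] --> (0 : R).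
  rewrite -[X in _ --> X](_ : (1 + 0 * L) ^+ 2 - 1 = 0); last by ring.
  apply: cvgB; last exact: cvg_cst.
  rewrite expr2; under eq_fun do rewrite expr2.
  by apply: cvgM; (apply: cvgD; [exact: cvg_cst | apply: cvgM; [exact: epsc|exact: cvg_cst]]).
have fix_u x : step u x = u x.
  have h1 : (fun n => un n.+1 x) @ \oo --> u x.
    have -> : (fun n => un n.+1 x) = [sequence un (n + 1)%N x]_n by apply/funext => n /=; rewrite addn1.
    by rewrite (cvg_shiftn 1 (un ^~ x)).
  (* Continuity of the step along the iterates follows from its contraction in ratio between [un n]
     and [u], without a limit under the integral. *)
  have h2 : (fun n => un n.+1 x) @ \oo --> step u x.
    apply/cvgrPdistC_le => e e0.
    have c0 : L * (th * ((1 + eps n * L) ^+ 2 - 1)) @[n --> \oo] --> (0 : R).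
      rewrite -[X in _ --> X](_ : L * (th * 0) = 0); last by rewrite !mulr0.
      by apply: cvgM; [exact: cvg_cst|apply: cvgM; [exact: cvg_cst|exact: rc]].
    have hn := @cvgr_le _ _ _ _ _ _ c0 e e0; near=> n.
    apply: (@le_trans _ _ (L * (th * ((1 + eps n * L) ^+ 2 - 1)))); last by near: n; exact: hn.
    have := step_ratio (sink_iter_pos n) pu (r1 n) (rat n).
    move/(ratio_dist x); rewrite addrAC subrr add0r; apply.
    - by rewrite lerDl mulr_ge0// subr_ge0.
    - exact: un_le n.+1.
    - by move=> z; rewrite (bmf_pos_gt0 z (step_pos pu)) step_le.
    - exact: un_x0 n.+1.
    - exact: step_x0.
  exact: (cvg_unique _ h2 h1).
exists u; split => //.
- pose v := sink_half mu C u.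
  have pv : bmf_pos v by exact: (sink_half_pos mu bC k0_gt0 k01 Ck0 Ck1 pu).
  pose w x := \int[nu]_y (C (x, y) * v y).
  have w0 x : 0 < w x by exact: (kernel_Rint_gt0 nu bCs k0_gt0 Cs0 x pv).
  have fixE x : u x * w x = w x0.
    rewrite -[u x]fix_u /step /sink_step /sink_half -/v -/(w x) -/(w x0).
    by rewrite invrK mulrAC mulVf ?mul1r// gt_eqF.
  have bv : bmf v by case: pv.
  have bu : bmf u by case: pu.
  have bf : bmf (fun z : U * V => C z * u z.1 * v z.2).
    apply: bmfM; first apply: bmfM => //.
      by apply: (bmf_comp (h := fst)) => //; exact: measurable_fst.
    by apply: (bmf_comp (h := snd)) => //; exact: measurable_snd.
  (* In one order the double integral is the unknown constant [w x0], in the other it is 1 by the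
     choice of [v]. *)
  have := Rint_swap mu nu bf => /=.
  have -> : \int[mu]_x \int[nu]_y (C (x, y) * u x * v y) = w x0.
    rewrite -[RHS](Rint_cst mu); apply: eq_Rintegral => x _.
    rewrite -(fixE x) /w -RintZl; last by apply: bmfM => //; exact: bmf_pair1.
    by apply: eq_Rintegral => y _; ring.
  have -> : \int[nu]_y \int[mu]_x (C (x, y) * u x * v y) = 1.
    rewrite -[RHS](Rint_cst nu); apply: eq_Rintegral => y _.
    rewrite RintZr; last exact: bmf_kernel_mul.
    by rewrite /v /sink_half mulfV// gt_eqF// (kernel_Rint_gt0 mu bC k0_gt0 Ck0).
  by move=> wE x; rewrite fixE wE.
- move=> y; apply: cvgV; first by rewrite gt_eqF// (kernel_Rint_gt0 mu bC k0_gt0 Ck0).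
  apply/cvgrPdistC_le => e e0.
  have c0 : k1 * eps n @[n --> \oo] --> (0 : R).
    rewrite -[X in _ --> X](mulr0 k1).
    by apply: cvgM; [exact: cvg_cst|exact: epsc].
  have hn := @cvgr_le _ _ _ _ _ _ c0 e e0; near=> n.
  apply: (@le_trans _ _ (k1 * eps n)); last by near: n; exact: hn.
  rewrite -RintB; [|exact: bmf_kernel_mul (sink_iter_pos n).1|exact: bmf_kernel_mul pu.1].
  apply: norm_Rint_le; first by apply: bmfB; [exact: bmf_kernel_mul (sink_iter_pos n).1|exact: bmf_kernel_mul pu.1].
  move=> x; rewrite -mulrBr normrM ler_pM//.
  by rewrite ger0_norm// ltW// (lt_le_trans k0_gt0).
Unshelve. all: by end_near.
Qed.

End sinkhorn_convergence.

(** * The entropic plan as a scaling of the Gibbs kernel *)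

Section density.
Context {R : realType} d {Z : measurableType d}.
Variable m : probability Z R.

Lemma density_probability (xi : Z -> R) : bmf xi -> (forall z, 0 <= xi z) ->
  \int[m]_z xi z = 1 ->
  exists pi : probability Z R, forall A, measurable A ->
    pi A = (\int[m]_(z in A) (xi z)%:E)%E.
Proof.
move=> bxi xi0 xi1.
pose mu (A : set Z) := (\int[m]_(z in A) (xi z)%:E)%E.
have mu0 : mu set0 = 0%E by rewrite /mu integral_set0.
have mu_ge0 A : (0 <= mu A)%E by apply: integral_ge0 => z _; rewrite lee_fin.
have mu_add : semi_sigma_additive mu.
  move=> /= A mA tA mUA; rewrite /mu/= integral_bigcup//=; last first.
    by apply: (integrableS _ _ (subsetT _)) => //; exact: bmf_int.
  apply: is_cvg_ereal_nneg_natsum_cond => n _ _.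
  by apply: integral_ge0 => /= x ?; rewrite lee_fin.
have mu1 : mu setT = 1%E by rewrite /mu -EFin_Rint ?xi1//; exact: bmf_int.
pose h1 := isMeasure.Build _ _ _ mu mu0 mu_ge0 mu_add.
pose nu := HB.pack_for (Measure.type Z R) mu h1.
pose h2 := Measure_isProbability.Build _ _ _ nu mu1.
pose pi := HB.pack_for (Probability.type Z R) (Measure.sort nu) h1 h2.
by exists pi.
Qed.

Variable pi : probability Z R.
Hypothesis pim : pi `<< m.

(** [KL] is stated with a Radon-Nikodym derivative of a charge, with no sign or finiteness at every
    point. A finite nonnegative version [h] agrees with it almost everywhere for [m], hence for
    [pi], and may replace it in the integral. *)
Lemma KL_density : exists h : Z -> R,
  [/\ measurable_fun setT h, (forall z, 0 <= h z),
      (forall A, measurable A -> pi A = (\int[m]_(z in A) (h z)%:E)%E),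
      (forall f : Z -> \bar R, measurable_fun setT f -> (forall z, (0 <= f z)%E) ->
         (\int[pi]_z f z = \int[m]_z (f z * (h z)%:E))%E) &
      KL pi m = (\int[pi]_z (ln (h z))%:E)%E].
Proof.
pose D := Radon_Nikodym_SigmaFinite.f pi m.
have D0 z : (0 <= D z)%E by exact: Radon_Nikodym_SigmaFinite.f_ge0.
have Df z : D z \is a fin_num by exact: Radon_Nikodym_SigmaFinite.f_fin_num.
have mD : measurable_fun setT D by apply: measurable_int; exact: Radon_Nikodym_SigmaFinite.f_integrable.
have DE z : (fine (D z))%:E = D z by rewrite fineK.
have mh : measurable_fun setT (fun z => fine (D z)).
  by apply: measurableT_comp mD; exact: fine_measurable.
exists (fun z => fine (D z)); split => //.
- by move=> z; exact: fine_ge0.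
- move=> A mA; under eq_integral do rewrite DE.
  exact: Radon_Nikodym_SigmaFinite.f_integral.
- move=> f mf f0; under [RHS]eq_integral do rewrite DE.
  by rewrite Radon_Nikodym_SigmaFinite.change_of_variables.
- rewrite /KL; case: (pselect (pi `<< m)) => // ?.
  have h : ae_eq pi setT D (Radon_Nikodym (charge_of_finite_measure pi) m).
    apply: (null_dominates_ae_eq measurableT pim).
    exact: ae_eq_Radon_Nikodym_SigmaFinite.
  have mN : measurable_fun setT (Radon_Nikodym (charge_of_finite_measure pi) m) by [].
  apply: ae_eq_integral => //.
  + apply/measurable_EFinP; apply: measurableT_comp; first exact: measurable_ln.
    by apply: measurableT_comp mN; exact: fine_measurable.
  + by apply/measurable_EFinP; apply: measurableT_comp => //; exact: measurable_ln.
  + case: h => N [mNN N0 sub]; exists N; split => // z /= hz; apply: sub => /= Dz.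
    by apply: hz => _; rewrite Dz.
Qed.

End density.

(** * Gibbs' inequality *)

Section gibbs.
Context {R : realType}.

Lemma ln_le_subr1 (x : R) : 0 < x -> ln x <= x - 1.
Proof.
by move=> x0; have := @le_ln1Dx R (x - 1); rewrite addrCA subrr addr0; apply; lra.
Qed.

Lemma ln_eq_subr1 (x : R) : 0 < x -> ln x = x - 1 -> x = 1.
Proof.
move=> x0 h; apply/eqP/negP => /negP x1.
have l0 : ln x != 0 by rewrite h subr_eq0.
by have := expR_gt1Dx l0; rewrite lnK ?posrE// h; lra.
Qed.

(* Between probability densities this integrates to the relative entropy. *)
Definition entropy_gap (h x : R) := h * ln h - h * ln x - h + x.

(** For [h > 0] the gap is [h * (s - 1 - ln s)] with [s = x / h]; for [h = 0] it is [x]. *)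
Lemma entropy_gap_ge0 (h x : R) : 0 <= h -> 0 < x -> 0 <= entropy_gap h x.
Proof.
move=> h0 x0; rewrite /entropy_gap; move: h0; rewrite le_eqVlt => /predU1P[<-|h0].
  by rewrite !mul0r !subr0 add0r ltW.
have := @ln_le_subr1 (x / h); rewrite divr_gt0// => /(_ isT).
rewrite ln_div ?posrE// => hh.
have : h * (ln x - ln h) <= h * (x / h - 1) by rewrite ler_wpM2l// ltW.
have e1 : h * (x / h) = x by rewrite mulrC divfK// gt_eqF.
by rewrite [leRHS]mulrBr e1; lra.
Qed.

Lemma entropy_gap_eq0 (h x : R) : 0 <= h -> 0 < x -> entropy_gap h x = 0 -> h = x.
Proof.
move=> h0 x0; rewrite /entropy_gap; move: h0; rewrite le_eqVlt => /predU1P[<-|h0].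
  by rewrite !mul0r !subr0 add0r => x00; move: x0; rewrite x00 ltxx.
move=> e; have h1 : ln (x / h) = x / h - 1.
  apply: (@mulfI _ h); first by rewrite gt_eqF.
  have e1 : h * (x / h) = x by rewrite mulrC divfK// gt_eqF.
  by rewrite ln_div ?posrE// [RHS]mulrBr e1; lra.
have := ln_eq_subr1 (divr_gt0 x0 h0) h1.
by move/eqP; rewrite -subr_eq0 -[X in _ - X](mulfV (lt0r_neq0 h0)) -mulrBl mulf_eq0 invr_eq0 (gt_eqF h0) orbF subr_eq0 => /eqP.
Qed.

Context d {Z : measurableType d}.
Variables (m pi : probability Z R) (xi h : Z -> R).
Hypotheses (pxi : bmf xi) (e : R) (e0 : 0 < e) (xie : forall z, e <= xi z)
  (xi1 : \int[m]_z xi z = 1) (mh : measurable_fun setT h) (h0 : forall z, 0 <= h z)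
  (pih : forall f : Z -> \bar R, measurable_fun setT f -> (forall z, (0 <= f z)%E) ->
         (\int[pi]_z f z = \int[m]_z (f z * (h z)%:E))%E).

Let xi_gt0 z : 0 < xi z. Proof. exact: lt_le_trans (xie z). Qed.

Lemma bmf_ln_density : bmf (fun z => ln (xi z)).
Proof. exact: bmf_ln e0 xie. Qed.

Lemma measurable_entropy_gap : measurable_fun setT (fun z => entropy_gap (h z) (xi z)).
Proof.
have ml : measurable_fun setT (fun z => ln (h z)) by apply: measurableT_comp => //; exact: measurable_ln.
have mx := bmf_meas bmf_ln_density; have mxi := bmf_meas pxi.
apply: measurable_funD => //; apply: measurable_funB => //.
by apply: measurable_funB; exact: measurable_funM.
Qed.

(** [ln (h z)] need not be integrable under [pi], so both sides may be infinite and terms cannot be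
    subtracted freely. The identity is rearranged into an equality between integrals of sums of
    nonnegative functions, of which only two can be infinite. *)
Lemma gibbs_identity :
  (\int[pi]_z (ln (h z))%:E =
   \int[m]_z (entropy_gap (h z) (xi z))%:E + (\int[pi]_z ln (xi z))%:E)%E.
Proof.
have ml : measurable_fun setT (fun z => ln (h z)) by apply: measurableT_comp => //; exact: measurable_ln.
have bx := bmf_ln_density; have [B B0 xB] := bmf_bnd bx.
(* [p - q] is [h * ln h], split so that [q <= 1], because [- (h * ln h) <= 1 - h]. *)
pose p z := h z * Num.max (ln (h z)) 0.
pose q z := h z * Num.max (- ln (h z)) 0.
have mp : measurable_fun setT p by apply: measurable_funM => //; exact: measurable_maxr.
have mq : measurable_fun setT q.
  by apply: measurable_funM => //; apply: measurable_maxr => //; exact: measurable_funN.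
have p0 z : 0 <= p z by rewrite mulr_ge0// le_max lexx orbT.
have q0 z : 0 <= q z by rewrite mulr_ge0// le_max lexx orbT.
have q1 z : q z <= 1.
  rewrite /q; move: (h0 z); rewrite le_eqVlt => /predU1P[<-|hz]; first by rewrite mul0r.
  have [hl|hl] := leP (- ln (h z)) 0; first by rewrite mulr0.
  have := @ln_le_subr1 (h z)^-1; rewrite invr_gt0 hz => /(_ isT).
  rewrite lnV ?posrE// => hh.
  have : h z * - ln (h z) <= h z * ((h z)^-1 - 1) by rewrite ler_wpM2l// ltW.
  by rewrite [leRHS]mulrBr mulfV ?gt_eqF// mulr1; lra.
have bq : bmf q by split => //; exists 1 => z; rewrite ger0_norm.
have lnE : (\int[pi]_z (ln (h z))%:E = \int[m]_z (p z)%:E - \int[m]_z (q z)%:E)%E.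
  rewrite integralE; congr (_ - _)%E.
    rewrite pih//; last by apply: measurable_funepos; exact/measurable_EFinP.
    apply: eq_integral => z _; rewrite funeposE /p -EFin_max -EFinM mulrC.
    by [].
  rewrite pih//; last by apply: measurable_funeneg; exact/measurable_EFinP.
  by apply: eq_integral => z _; rewrite funenegE /q /= -EFin_max -EFinM mulrC.
have h1 : (\int[m]_z (h z)%:E = 1)%E.
  transitivity (\int[pi]_z (1%:E))%E.
    by rewrite pih//; apply: eq_integral => z _; rewrite mul1e.
  by rewrite -EFin_Rint ?Rint_cst//; exact: bmf_int (bmf_cst _).
have mx := bmf_meas bx; have mxi := bmf_meas pxi.
have Bx z : 0 <= B + ln (xi z) by have := xB z; rewrite ler_norml; lra.
have I1 : (\int[m]_z (h z * (B + ln (xi z)))%:E = (B + \int[pi]_z ln (xi z))%:E)%E.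
  transitivity (\int[pi]_z (B + ln (xi z))%:E)%E.
    rewrite pih; [by apply: eq_integral => z _; rewrite -EFinM mulrC| |by move=> z; rewrite lee_fin].
    by apply/measurable_EFinP; exact: measurable_funD.
  rewrite -EFin_Rint; last by apply: bmf_int; apply: bmfD => //; exact: bmf_cst.
  by rewrite RintD ?Rint_cst//; exact: bmf_cst.
have I2 : (\int[m]_z (h z * B)%:E = B%:E)%E.
  transitivity (\int[pi]_z (B%:E))%E.
    rewrite pih//.
    by apply: eq_integral => z _; rewrite -EFinM mulrC.
  by rewrite -EFin_Rint ?Rint_cst//; exact: bmf_int (bmf_cst _).
have I3 : (\int[m]_z (xi z)%:E = 1)%E by rewrite -EFin_Rint ?xi1//; exact: bmf_int.
have Iq := EFin_Rint (bmf_int m bq).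
have pxi0 z : 0 <= xi z by exact: ltW.
have mhB : measurable_fun setT (fun z => h z * B) by exact: measurable_funM.
have I4 : (\int[m]_z (p z + (xi z + h z * B))%:E = \int[m]_z (p z)%:E + (1 + B)%:E)%E.
  rewrite ge0_integral_EFinD//; last by move=> z; rewrite addr_ge0// mulr_ge0.
    by rewrite ge0_integral_EFinD// ?I3 ?I2// => z; exact: mulr_ge0.
  exact: measurable_funD.
have mg := measurable_entropy_gap.
have g0 z : 0 <= entropy_gap (h z) (xi z) by exact: entropy_gap_ge0.
have m3 : measurable_fun setT (fun z => h z * (B + ln (xi z))).
  by apply: measurable_funM => //; exact: measurable_funD.
have h3 z : 0 <= h z * (B + ln (xi z)) by exact: mulr_ge0.
have I5 : (\int[m]_z (entropy_gap (h z) (xi z) + (q z + (h z + h z * (B + ln (xi z)))))%:E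
   = \int[m]_z (entropy_gap (h z) (xi z))%:E
     + (\int[m]_z q z + (1 + (B + \int[pi]_z ln (xi z))))%:E)%E.
  have m4 : measurable_fun setT (fun z => h z + h z * (B + ln (xi z))) by exact: measurable_funD.
  have h4 z : 0 <= h z + h z * (B + ln (xi z)) by exact: addr_ge0.
  have m5 : measurable_fun setT (fun z => q z + (h z + h z * (B + ln (xi z)))) by exact: measurable_funD.
  have h5 z : 0 <= q z + (h z + h z * (B + ln (xi z))) by exact: addr_ge0.
  rewrite (ge0_integral_EFinD m mg m5 g0 h5) (ge0_integral_EFinD m mq m4 q0 h4).
  by rewrite (ge0_integral_EFinD m mh m3 h0 h3) -Iq h1 I1 EFinD.
(* The pointwise identity once every negative term has changed side; [B] bounds [ln xi] and so keeps
   [B + ln (xi z)] nonnegative. *)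
have idE z : p z + (xi z + h z * B) =
    entropy_gap (h z) (xi z) + (q z + (h z + h z * (B + ln (xi z)))).
  have pq : p z - q z = h z * ln (h z).
    rewrite /p /q -mulrBr; congr (_ * _).
    by case: (leP (ln (h z)) 0) => hl; case: (leP (- ln (h z)) 0) => hl'; lra.
  by rewrite /entropy_gap -pq; ring.
have I45 : (\int[m]_z (p z)%:E + (1 + B)%:E = \int[m]_z (entropy_gap (h z) (xi z))%:E
     + (\int[m]_z q z + (1 + (B + \int[pi]_z ln (xi z))))%:E)%E.
  rewrite -I4 -I5; apply: eq_integral => z _; by rewrite idE.
rewrite lnE -Iq.
have G0 : (0 <= \int[m]_z (entropy_gap (h z) (xi z))%:E)%E.
  by apply: integral_ge0 => z _; rewrite lee_fin.
have P0 : (0 <= \int[m]_z (p z)%:E)%E by apply: integral_ge0 => z _; rewrite lee_fin.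
move: I45 G0 P0; case: (\int[m]_z (p z)%:E)%E => [a| |] //;
  case: (\int[m]_z (entropy_gap (h z) (xi z))%:E)%E => [b| |] //.
rewrite -!EFinD => -[ab] _ _; congr EFin; move: ab.
by move=> ab; lra.
Qed.

End gibbs.

(** * Optimality and uniqueness of the scaled kernel *)

Section optimal_plan.
Context {R : realType} {T : ptopologicalType}.
Local Notation TT := (borel T * borel T)%type.
Variables (c : T * T -> R) (P Q : probability (borel T) R) (u v : T -> R).
Hypotheses (c_meas : measurable_fun [set: TT] c) (c_bnd : bounded_by_some c).
Hypotheses (pu : bmf_pos (u : borel T -> R)) (pv : bmf_pos (v : borel T -> R)).
Hypotheses (uE : forall x, u x * \int[Q]_y (expR (- c (x, y)) * v y) = 1)
  (vE : forall y, v y * \int[P]_x (expR (- c (x, y)) * u x) = 1).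

Let m : probability TT R := prodP P Q.
Let xi (z : TT) : R := expR (- c z) * u z.1 * v z.2.

Let bc : bmf (c : TT -> R). Proof. by split. Qed.

Let bC : bmf (fun z : TT => expR (- c z)).
Proof. by apply: bmf_expR; exact: bmfN. Qed.

Lemma bmf_fst d1 d2 (U : measurableType d1) (V : measurableType d2) (f : U -> R) :
  bmf f -> bmf (fun z : U * V => f z.1).
Proof. by move=> bf; apply: (bmf_comp (h := fst)) => //; exact: measurable_fst. Qed.

Lemma bmf_snd d1 d2 (U : measurableType d1) (V : measurableType d2) (f : V -> R) :
  bmf f -> bmf (fun z : U * V => f z.2).
Proof. by move=> bf; apply: (bmf_comp (h := snd)) => //; exact: measurable_snd. Qed.

Let bxi : bmf xi.
Proof. by apply: bmfM; [apply: bmfM => //; apply: bmf_fst pu.1 | apply: bmf_snd pv.1]. Qed.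

Let xi_lb : exists2 e, 0 < e & forall z, e <= xi z.
Proof.
have [e1 e10 e1u] := pu.2; have [e2 e20 e2v] := pv.2.
have [M M0 cM] := bmf_bnd bc.
exists (expR (- M) * e1 * e2); first by rewrite !mulr_gt0// expR_gt0.
move=> z; apply: ler_pM => //; rewrite ?mulr_ge0 ?expR_ge0//; try exact: ltW.
apply: ler_pM => //; rewrite ?expR_ge0//; try exact: ltW.
by rewrite ler_expR lerN2; apply: le_trans (cM z); exact: ler_norm.
Qed.

Let xi_Q x : \int[Q]_y xi (x, y) = 1.
Proof.
rewrite -[RHS](uE x) -RintZl; last by apply: bmfM pv.1; exact: (bmf_pair1 x bC).
by apply: eq_Rintegral => y _; rewrite /xi /=; ring.
Qed.

Let xi_P y : \int[P]_x xi (x, y) = 1.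
Proof.
rewrite -[RHS](vE y) -RintZl; last by apply: bmfM pu.1; exact: (bmf_pair2 y bC).
by apply: eq_Rintegral => x _; rewrite /xi /=; ring.
Qed.

Let xi1 : \int[m]_z xi z = 1.
Proof.
rewrite Rint_prod12//; under eq_Rintegral do rewrite xi_Q.
by rewrite Rint_cst.
Qed.

Let J := \int[P]_x ln (u x) + \int[Q]_y ln (v y).

Let bf : bmf (fun x : borel T => ln (u x)).
Proof. by have [e e0 eu] := pu.2; apply: (bmf_ln pu.1 e0 eu). Qed.
Let bg : bmf (fun x : borel T => ln (v x)).
Proof. by have [e e0 ev] := pv.2; apply: (bmf_ln pv.1 e0 ev). Qed.

(** [c + ln xi] is a function of [x] plus a function of [y], so a coupling sees it only through its
    marginals. The common value [J] is the dual value of the problem. *)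
Let coupling_cost (pi : probability TT R) : coupling P Q pi ->
  \int[pi]_z c z + \int[pi]_z ln (xi z) = J.
Proof.
move=> [piP piQ]; have [e e0 exi] := xi_lb.
rewrite -RintD//; last exact: (bmf_ln bxi e0 exi).
transitivity (\int[pi]_z (ln (u z.1) + ln (v z.2))).
  apply: eq_Rintegral => z _; rewrite /xi.
  have u0 := bmf_pos_gt0 z.1 pu; have v0 := bmf_pos_gt0 z.2 pv.
  rewrite !lnM ?posrE ?mulr_gt0 ?expR_gt0// expRK; ring.
rewrite RintD; [|exact: bmf_fst bf|exact: bmf_snd bg].
have EP : \int[P]_x ln (u x) = \int[pi]_z ln (u z.1).
  apply: (@Rint_pushforward _ _ _ _ _ pi P fst (fun x => ln (u x))) => // A mA.
  by rewrite -piP//; congr (pi _); apply/seteqP; split => z //= [].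
have EQ : \int[Q]_y ln (v y) = \int[pi]_z ln (v z.2).
  apply: (@Rint_pushforward _ _ _ _ _ pi Q snd (fun x => ln (v x))) => // A mA.
  by rewrite -piQ//; congr (pi _); apply/seteqP; split => z //= [].
by rewrite /J EP EQ.
Qed.

Let xi_coupling (pi : probability TT R) :
  (forall A, measurable A -> pi A = (\int[m]_(z in A) (xi z)%:E)%E) ->
  coupling P Q pi.
Proof.
move=> piE.
have E (A : set TT) : measurable A -> pi A = (\int[m]_z (\1_A z * xi z))%:E.
  move=> mA; rewrite piE// EFin_Rint; last first.
    by apply: bmf_int; apply: bmfM => //; exact: bmf_indic.
  rewrite integral_mkcond; apply: eq_integral => z _.
  rewrite patchE indicE; case: ifPn => zA; first by rewrite mul1r.
  by rewrite mul0r.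
split => A mA.
  have mAT : measurable (A `*` [set: borel T]) by exact: measurableX.
  rewrite E// Rint_prod12; last by apply: bmfM => //; exact: bmf_indic.
  rewrite -[RHS]fineK ?fin_num_measure//; congr EFin.
  transitivity (\int[P]_x (\1_A x)); last by rewrite /Rintegral integral_indic// setIT.
  apply: eq_Rintegral => x _; rewrite -[RHS]mulr1 -(xi_Q x) -RintZl; last exact: bmf_pair1.
  apply: eq_Rintegral => y _; congr (_ * _); rewrite !indicE; congr (nat_of_bool _)%:R.
  by rewrite in_setX in_setT andbT.
have mAT : measurable ([set: borel T] `*` A) by exact: measurableX.
rewrite E// Rint_prod21; last by apply: bmfM => //; exact: bmf_indic.
rewrite -[RHS]fineK ?fin_num_measure//; congr EFin.
transitivity (\int[Q]_x (\1_A x)); last by rewrite /Rintegral integral_indic// setIT.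
apply: eq_Rintegral => x _; rewrite -[RHS]mulr1 -(xi_P x) -RintZl; last exact: bmf_pair2.
apply: eq_Rintegral => y _; congr (_ * _); rewrite !indicE; congr (nat_of_bool _)%:R.
by rewrite in_setX in_setT.
Qed.

(** By [gibbs_identity] the cost is [J] plus the integral of the entropy gap, or infinite without
    absolute continuity. A cost of at most [J] makes the gap vanish almost everywhere, and this
    forces the density to be [xi]. *)
Let cost_cases (pi : probability TT R) : coupling P Q pi ->
  (J%:E <= eot_cost c P Q pi)%E /\
  ((eot_cost c P Q pi <= J%:E)%E ->
     forall A, measurable A -> pi A = (\int[m]_(z in A) (xi z)%:E)%E).
Proof.
move=> cpi; have [e e0 exi] := xi_lb.
have Jc := coupling_cost cpi.
have ce := EFin_Rint (bmf_int pi bc).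
rewrite /eot_cost -[X in (X + _)%E]ce.
have [pim|npim] := pselect (pi `<< m); last first.
  have -> : KL pi (P \x Q)%E = +oo%E by rewrite /KL; case: pselect.
  by rewrite addey// leey; split => //; rewrite leye_eq.
have [h [mh h0 hA hf KLE]] := KL_density pim.
have -> : KL pi (P \x Q)%E = (\int[pi]_z (ln (h z))%:E)%E by exact: KLE.
rewrite (gibbs_identity bxi e0 exi xi1 mh h0 hf).
have G0 : (0 <= \int[m]_z (entropy_gap (h z) (xi z))%:E)%E.
  by apply: integral_ge0 => z _; rewrite lee_fin entropy_gap_ge0// (lt_le_trans e0).
rewrite addeCA -EFinD Jc.
split; first by rewrite leeDr.
move=> le; have GE : (\int[m]_z (entropy_gap (h z) (xi z))%:E = 0)%E.
  move: G0 le; case: (\int[m]_z (entropy_gap (h z) (xi z))%:E)%E => [g| |]//.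
  by rewrite -EFinD !lee_fin => g0 gle; congr EFin; lra.
have mg := measurable_entropy_gap bxi e0 exi mh.
have ae0 : ae_eq m setT (fun z => (entropy_gap (h z) (xi z))%:E) (cst 0%E).
  apply/ae_eq_integral_abs => //; first exact/measurable_EFinP.
  rewrite -[RHS]GE; apply: eq_integral => z _.
  by rewrite gee0_abs// lee_fin entropy_gap_ge0// (lt_le_trans e0).
move=> A mA; rewrite hA//; apply: ge0_ae_eq_integral => //.
- by apply: measurable_funTS; exact/measurable_EFinP.
- by apply: measurable_funTS; apply/measurable_EFinP; exact: bmf_meas bxi.
- by move=> z _; rewrite lee_fin.
- by move=> z _; rewrite lee_fin; exact: ltW (lt_le_trans e0 (exi z)).
- case: ae0 => N [mN N0 sub]; exists N; split => // z /= hz; apply: sub => /= Dz.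
  apply: hz => _; congr EFin; apply: entropy_gap_eq0 => //; first exact: lt_le_trans (exi z).
  by have := Dz Logic.I; case.
Qed.

(** The measure of density [xi] is a coupling of cost [J], so a minimizer exists and [get] returns
    one; its cost is then at most [J] too, and [cost_cases] identifies it. Any scaling will do, and
    [P] and [Q] may be empirical. *)
Lemma RCol_scaling t :
  RCol c P Q t = \int[prodP P Q]_z (Defs.eta c t z * (expR (- c z) * u z.1 * v z.2)).
Proof.
have [e e0 exi] := xi_lb.
have xi0 z : 0 <= xi z by apply: ltW; exact: lt_le_trans (exi z).
have [pis pisE] := density_probability bxi xi0 xi1.
have cpis := xi_coupling pisE.
have costs : (eot_cost c P Q pis <= J%:E)%E.
  have pim : pis `<< m.
    apply/null_content_dominatesP => A mA A0; rewrite pisE//.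
    apply: null_set_integral => //; first by apply: measurable_funTS; apply/measurable_EFinP; exact: bmf_meas bxi.
  have [h [mh h0 hA hf KLE]] := KL_density pim.
  have aeh : ae_eq m setT (EFin \o xi) (EFin \o h).
    apply: integral_ae_eq => //.
    - exact: bmf_int.
    - exact/measurable_EFinP.
    - by move=> A _ mA; rewrite -pisE// -hA.
  rewrite /eot_cost (_ : KL pis (P \x Q)%E = (\int[pis]_z (ln (h z))%:E)%E); last by exact: KLE.
  rewrite (gibbs_identity bxi e0 exi xi1 mh h0 hf).
  have -> : (\int[m]_z (entropy_gap (h z) (xi z))%:E = 0)%E.
    rewrite -[RHS](integral0 m setT); apply: ae_eq_integral => //.
      by apply/measurable_EFinP; exact: (measurable_entropy_gap bxi e0 exi mh).
    case: aeh => N [mN N0 sub]; exists N; split => // z /= hz; apply: sub => /= Dz.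
    apply: hz => _; have [<-] := Dz Logic.I; congr EFin.
    by rewrite /entropy_gap; ring.
  rewrite add0e -(EFin_Rint (bmf_int pis bc)) -EFinD (coupling_cost cpis).
  by [].
have opts : is_eot_plan c P Q pis.
  split => // pi' cpi'; apply: le_trans costs _.
  by have [] := cost_cases cpi'.
have [cpi0 opt0] : is_eot_plan c P Q (eot_plan c P Q).
  by apply: (@getPex _ [set pi | is_eot_plan c P Q pi]); exists pis.
have [_ uniq0] := cost_cases cpi0.
have mt : measurable ([set z | c z <= t] : set TT).
  have -> : [set z | c z <= t] = c @^-1` `]-oo, t]%classic by apply/seteqP; split => z /=; rewrite in_itv.
  by rewrite -[X in measurable X]setTI; apply: c_meas.
rewrite /RCol uniq0//; last exact: le_trans (opt0 _ cpis) costs.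
rewrite integral_mkcond /Rintegral; congr fine; apply: eq_integral => z _.
rewrite patchE /Defs.eta indicE; case: ifPn => zA; first by rewrite mul1r.
by rewrite mul0r.
Qed.

End optimal_plan.

(** * The population potentials and the density of the plan *)

Section potentials_theory.
Context {R : realType} {T : ptopologicalType}.
Local Notation TT := (borel T * borel T)%type.
Variables (c : T * T -> R).
Hypotheses (c_meas : measurable_fun [set: TT] c) (c_bnd : bounded_by_some c).

Definition gibbs_kernel (z : TT) : R := expR (- c z).

Lemma gibbs_kernel_bounds : exists k0 k1 : R,
  [/\ bmf gibbs_kernel, 0 < k0, k0 <= k1, (forall z, k0 <= gibbs_kernel z) &
      forall z, gibbs_kernel z <= k1].
Proof.
have bc : bmf (c : TT -> R) by split.
have [M M0 cM] := bmf_bnd bc.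
exists (expR (- M)), (expR M); split.
- by apply: bmf_expR; exact: bmfN.
- exact: expR_gt0.
- by rewrite ler_expR; lra.
- by move=> z; rewrite ler_expR lerN2; apply: le_trans (cM z); exact: ler_norm.
- by move=> z; rewrite ler_expR; apply: le_trans (cM z); rewrite -normrN; exact: ler_norm.
Qed.

Lemma scaling_exists (P Q : probability (borel T) R) : exists u v : borel T -> R,
  [/\ bmf_pos u /\ bmf_pos v,
      (forall x, u x * \int[Q]_y (gibbs_kernel (x, y) * v y) = 1),
      (forall y, v y * \int[P]_x (gibbs_kernel (x, y) * u x) = 1),
      (forall x, sink_iter P Q gibbs_kernel (point : T) n x @[n --> \oo] --> u x) &
      (forall y, sink_half P gibbs_kernel
         (sink_iter P Q gibbs_kernel (point : T) n) y @[n --> \oo] --> v y)].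
Proof.
have [k0 [k1 [bC k00 k01 Ck0 Ck1]]] := gibbs_kernel_bounds.
have [u [pu uE uc vc]] := sinkhorn_converges P Q (point : T) bC k00 k01 Ck0 Ck1.
exists u, (sink_half P gibbs_kernel u); split => //.
  by split => //; exact: (sink_half_pos P bC k00 k01 Ck0 Ck1 pu).
move=> y; rewrite /sink_half mulVf// gt_eqF//.
exact: (kernel_Rint_gt0 P bC k00 Ck0 y pu).
Qed.

Variables (P Q : probability (borel T) R).

(** The logarithms of a scaling satisfy both equations; the constant [b] that may be moved between
    them is chosen to give the second one mean zero. *)
Lemma potentialsP : is_potentials c P Q (potentials c P Q).
Proof.
apply: (@getPex _ [set fg | is_potentials c P Q fg]).
have [k0 [k1 [bC k00 k01 Ck0 Ck1]]] := gibbs_kernel_bounds.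
have [u [v [[pu pv] uE vE _ _]]] := scaling_exists P Q.
have [eu eu0 ue] := pu.2; have [ev ev0 ve] := pv.2.
have blu : bmf (fun x => ln (u x)) := bmf_ln pu.1 eu0 ue.
have blv : bmf (fun x => ln (v x)) := bmf_ln pv.1 ev0 ve.
set b := \int[Q]_y ln (v y).
have u0 x : 0 < u x by exact: bmf_pos_gt0 pu.
have v0 x : 0 < v x by exact: bmf_pos_gt0 pv.
exists (fun x => ln (u x) + b, fun y => ln (v y) - b); split => /=.
- by have := bmfD blu (bmf_cst b).
- by have := bmfB blv (bmf_cst b).
- move=> x.
  have -> : \int[Q]_y (expR (- c (x, y)) * expR (ln (v y) - b)) = expR (- b) * (u x)^-1.
    transitivity (expR (- b) * \int[Q]_y (gibbs_kernel (x, y) * v y)).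
      rewrite -RintZl; last exact: (bmfM (bmf_pair1 (x : borel T) bC) pv.1).
      by apply: eq_Rintegral => y _; rewrite expRD lnK ?posrE// /gibbs_kernel; ring.
    congr (_ * _); apply: (@mulfI _ (u x)); first by rewrite gt_eqF.
    by rewrite uE mulfV// gt_eqF.
  by rewrite lnM ?posrE ?expR_gt0 ?invr_gt0// expRK lnV ?posrE//; ring.
- move=> y.
  have -> : \int[P]_x (expR (- c (x, y)) * expR (ln (u x) + b)) = expR b * (v y)^-1.
    transitivity (expR b * \int[P]_x (gibbs_kernel (x, y) * u x)).
      rewrite -RintZl; last exact: (bmfM (bmf_pair2 (y : borel T) bC) pu.1).
      by apply: eq_Rintegral => x _; rewrite expRD lnK ?posrE// /gibbs_kernel; ring.
    congr (_ * _); apply: (@mulfI _ (v y)); first by rewrite gt_eqF.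
    by rewrite vE mulfV// gt_eqF.
  by rewrite lnM ?posrE ?expR_gt0 ?invr_gt0// expRK lnV ?posrE//; ring.
- by rewrite (RintB Q blv (bmf_cst b)) (Rint_cst Q b) subrr.
Qed.

Definition pop_u (x : borel T) : R := expR ((potentials c P Q).1 x).
Definition pop_v (y : borel T) : R := expR ((potentials c P Q).2 y).

Let bf_pos (f : borel T -> R) : bmf f -> bmf_pos (fun x => expR (f x)).
Proof.
move=> bf; split; first exact: bmf_expR.
have [M M0 fM] := bmf_bnd bf; exists (expR (- M)); first exact: expR_gt0.
by move=> x; rewrite ler_expR; have := fM x; rewrite ler_norml => /andP[].
Qed.

Lemma pop_u_pos : bmf_pos pop_u.
Proof. by apply: bf_pos; have [] := potentialsP. Qed.

Lemma pop_v_pos : bmf_pos pop_v.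
Proof. by apply: bf_pos; have [] := potentialsP. Qed.

Lemma xiE z : Defs.xi c P Q z = gibbs_kernel z * pop_u z.1 * pop_v z.2.
Proof. by rewrite /Defs.xi expRD mulrA. Qed.

Lemma pop_uE x : pop_u x * \int[Q]_y (gibbs_kernel (x, y) * pop_v y) = 1.
Proof.
have [k0 [k1 [bC k00 k01 Ck0 Ck1]]] := gibbs_kernel_bounds.
have h0 : 0 < \int[Q]_y (gibbs_kernel (x, y) * pop_v y).
  exact: (kernel_Rint_gt0 Q (bmf_swap_kernel bC) k00 (fun z => Ck0 _) x pop_v_pos).
have [_ _ h _ _] := potentialsP.
by rewrite {1}/pop_u h expRN lnK ?posrE// mulVf// gt_eqF.
Qed.

Lemma pop_vE y : pop_v y * \int[P]_x (gibbs_kernel (x, y) * pop_u x) = 1.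
Proof.
have [k0 [k1 [bC k00 k01 Ck0 Ck1]]] := gibbs_kernel_bounds.
have h0 : 0 < \int[P]_x (gibbs_kernel (x, y) * pop_u x).
  exact: (kernel_Rint_gt0 P bC k00 Ck0 y pop_u_pos).
have [_ _ _ h _] := potentialsP.
by rewrite {1}/pop_v h expRN lnK ?posrE// mulVf// gt_eqF.
Qed.

Lemma xi_bounds : exists k0 k1 : R,
  [/\ bmf (Defs.xi c P Q : TT -> R), 0 < k0, k0 <= k1,
      (forall z, k0 <= Defs.xi c P Q z) & forall z, Defs.xi c P Q z <= k1].
Proof.
have [k0 [k1 [bC k00 k01 Ck0 Ck1]]] := gibbs_kernel_bounds.
have bxi : bmf (Defs.xi c P Q : TT -> R).
  rewrite (_ : Defs.xi c P Q = fun z => gibbs_kernel z * pop_u z.1 * pop_v z.2); last first.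
    by apply/funext => z; exact: xiE.
  by apply: bmfM; [apply: bmfM => //; apply: bmf_fst pop_u_pos.1 | apply: bmf_snd pop_v_pos.1].
have [M M0 xM] := bmf_bnd bxi.
have [eu eu0 ue] := pop_u_pos.2; have [ev ev0 ve] := pop_v_pos.2.
have lb z : k0 * eu * ev <= Defs.xi c P Q z.
  rewrite xiE; apply: ler_pM => //; first by rewrite !mulr_ge0// ltW.
    exact: ltW.
  by apply: ler_pM => //; exact: ltW.
have ub z : Defs.xi c P Q z <= M by apply: le_trans (xM z); exact: ler_norm.
exists (k0 * eu * ev), M; split => //; first by rewrite !mulr_gt0.
exact: le_trans (lb (point, point)) (ub _).
Qed.

Lemma xi_Q x : \int[Q]_y Defs.xi c P Q (x, y) = 1.
Proof.
have [k0 [k1 [bC k00 k01 Ck0 Ck1]]] := gibbs_kernel_bounds.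
rewrite -[RHS](pop_uE x) -RintZl; last exact: (bmfM (bmf_pair1 (x : borel T) bC) pop_v_pos.1).
by apply: eq_Rintegral => y _; rewrite xiE /=; ring.
Qed.

Lemma xi_P y : \int[P]_x Defs.xi c P Q (x, y) = 1.
Proof.
have [k0 [k1 [bC k00 k01 Ck0 Ck1]]] := gibbs_kernel_bounds.
rewrite -[RHS](pop_vE y) -RintZl; last exact: (bmfM (bmf_pair2 (y : borel T) bC) pop_u_pos.1).
by apply: eq_Rintegral => x _; rewrite xiE /=; ring.
Qed.

Lemma RCol_xi t :
  RCol c P Q t = \int[prodP P Q]_z (Defs.eta c t z * Defs.xi c P Q z).
Proof.
rewrite (RCol_scaling c_meas c_bnd pop_u_pos pop_v_pos pop_uE pop_vE).
by apply: eq_Rintegral => z _; rewrite xiE.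
Qed.

Lemma bmf_eta t : bmf (Defs.eta c t : TT -> R).
Proof.
apply: bmf_indic.
have -> : [set z | c z <= t] = c @^-1` `]-oo, t]%classic by apply/seteqP; split => z /=; rewrite in_itv.
by rewrite -[X in measurable X]setTI; apply: c_meas.
Qed.

End potentials_theory.

(** * Gaussian laws *)

Section normal_densities.
Context {R : realType}.
Local Notation leb := (@lebesgue_measure R).

(** The image of Lebesgue measure under the affine map, multiplied by [b], gives every interval its
    length, so it is Lebesgue measure. *)
Lemma lebesgue_integral_affine (F : R -> \bar R) (a b : R) : 0 < b ->
  measurable_fun setT F -> (forall x, (0 <= F x)%E) ->
  (\int[leb]_x F x = b%:E * \int[leb]_x F (a + b * x)%R)%E.
Proof.
move=> b0 mF F0.
pose h (x : measurableTypeR R) : measurableTypeR R := a + b * x.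
have mh : measurable_fun setT h.
  by apply: measurable_funD => //; apply: measurable_funM.
have bnn : 0 <= b by exact: ltW.
pose pf : {measure set (measurableTypeR R) -> \bar R} :=
  measure_function_pushforward__canonical__measure_function_Measure leb mh.
pose nu : {measure set (measurableTypeR R) -> \bar R} := mscale (NngNum bnn) pf.
have E A : measurable A -> leb A = nu A.
  apply: lebesgue_measure_unique => _ [[x y] _ <-].
  rewrite /nu /= /mscale /pf /= /pushforward /=.
  have -> : h @^-1` `]x, y]%classic = `](x - a) / b, (y - a) / b]%classic.
    apply/seteqP; split => z /=; rewrite !in_itv/= ltr_pdivrMr// ler_pdivlMr// /h;
      move=> /andP[h1 h2]; apply/andP; split; lra.
  rewrite !lebesgue_measure_itv/= !lte_fin ltr_pM2r ?invr_gt0// ltrD2r.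
  case: ifP => _; last by rewrite mule0.
  by rewrite -!EFinB -EFinM; congr EFin; field; rewrite gt_eqF.
transitivity (\int[nu]_x F x)%E.
  by apply: eq_measure_integral => // A mA _; exact: E.
rewrite ge0_integral_mscale//=; congr (_ * _)%E.
by rewrite ge0_integral_pushforward.
Qed.

Lemma lebesgue_integralN (F : R -> \bar R) :
  measurable_fun setT F -> (forall x, (0 <= F x)%E) ->
  (\int[leb]_x F x = \int[leb]_x F (- x)%R)%E.
Proof.
move=> mF F0.
transitivity (\int[pushforward leb (-%R : measurableTypeR R -> measurableTypeR R)]_x F x)%E.
  by apply: eq_measure_integral => // A mA _; exact/esym/lebesgue_measureN.
by rewrite ge0_integral_pushforward.
Qed.

Lemma integral_normal_prob (m s : R) (F : R -> \bar R) :
  measurable_fun setT F -> (forall x, (0 <= F x)%E) ->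
  (\int[normal_prob m s]_x F x = \int[leb]_x (F x * (normal_pdf m s x)%:E))%E.
Proof.
move=> mF F0.
have dom : normal_prob m s `<< leb by exact: normal_prob_dominates.
rewrite -(@Radon_Nikodym_SigmaFinite.change_of_variables _ _ _ (normal_prob m s) leb dom)//.
have iD := Radon_Nikodym_SigmaFinite.f_integrable dom.
have mD := measurable_int _ iD.
have mpdf : measurable_fun setT (fun x => (normal_pdf m s x)%:E).
  by apply/measurable_EFinP; exact: measurable_normal_pdf.
have D0 x := Radon_Nikodym_SigmaFinite.f_ge0 dom x.
apply: ge0_ae_eq_integral => //.
- exact: emeasurable_funM.
- exact: emeasurable_funM.
- by move=> x _; rewrite mule_ge0.
- by move=> x _; rewrite mule_ge0// lee_fin normal_pdf_ge0.
have : ae_eq leb setT (Radon_Nikodym_SigmaFinite.f (normal_prob m s) leb)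
    (fun x => (normal_pdf m s x)%:E).
  apply: integral_ae_eq => // E _ mE.
  by rewrite -Radon_Nikodym_SigmaFinite.f_integral.
case=> N [mN N0 sub]; exists N; split => // z /= hz; apply: sub => /= Dz.
by apply: hz => _; rewrite Dz.
Qed.

Definition N01 : probability (measurableTypeR R) R := normal_prob 0 1.

(* The density at [t] of [a Z + b W] for independent standard normal [Z], [W]. *)
Lemma normal_pdf_convolution (a b t : R) : 0 < b ->
  (\int[leb]_z (normal_pdf 0 1 z * (b^-1 * normal_pdf 0 1 ((t - a * z) / b)))%:E =
   (normal_pdf 0 (Num.sqrt (a ^+ 2 + b ^+ 2)) t)%:E)%E.
Proof.
move=> b0; set g := Num.sqrt (a ^+ 2 + b ^+ 2).
have g2 : g ^+ 2 = a ^+ 2 + b ^+ 2 by rewrite sqr_sqrtr// addr_ge0 ?sqr_ge0.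
have g0 : 0 < g by rewrite sqrtr_gt0 ltr_wpDl ?sqr_ge0 ?exprn_gt0.
have gn0 : g != 0 by rewrite gt_eqF.
have bn0 : b != 0 by rewrite gt_eqF.
(* Completing the square: given that [a Z + b W] equals [t], the variable [Z] is normal with mean
   [a * t / g ^+ 2] and deviation [b / g]. The integral over [z] of that density is 1. *)
have -> : (fun z => (normal_pdf 0 1 z * (b^-1 * normal_pdf 0 1 ((t - a * z) / b)))%:E) =
   (fun z => (normal_pdf 0 g t)%:E * (normal_pdf (a * t / g ^+ 2) (b / g) z)%:E)%E.
  apply/funext => z; rewrite -EFinM; congr EFin.
  have bg0 : b / g != 0 by rewrite mulf_neq0 ?invr_neq0.
  rewrite !normal_pdfE ?oner_neq0// /normal_peak /normal_fun.
  have pi0 : 0 < pi :> R := pi_gt0 R.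
  have sq (x : R) : 0 < x -> Num.sqrt (x ^+ 2 * pi *+ 2) = x * Num.sqrt (pi *+ 2).
    by move=> x0; rewrite -mulrnAr sqrtrM ?sqr_ge0// sqrtr_sqr gtr0_norm.
  rewrite !sq ?divr_gt0//.
  set q := Num.sqrt (pi *+ 2).
  have q0 : q != 0 by rewrite gt_eqF// sqrtr_gt0 pmulrn_lgt0.
  have eE : expR (- (z - 0) ^+ 2 / (1 ^+ 2 *+ 2)) * expR (- ((t - a * z) / b - 0) ^+ 2 / (1 ^+ 2 *+ 2)) =
    expR (- (t - 0) ^+ 2 / (g ^+ 2 *+ 2)) *
    expR (- (z - a * t / g ^+ 2) ^+ 2 / ((b / g) ^+ 2 *+ 2)).
    rewrite -!expRD; congr expR.
    have a2 : a ^+ 2 = g ^+ 2 - b ^+ 2 by rewrite g2 addrK.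
    have a2' : a * a = g ^+ 2 - b ^+ 2 by rewrite -expr2.
    apply/eqP; rewrite -subr_eq0; apply/eqP.
    (* The exponents agree only modulo the relation between [a], [b] and [g], so their difference is
       exhibited as a multiple of it. *)
    transitivity ((g ^+ 2 - b ^+ 2 - a ^+ 2) * (- t ^+ 2 / (2 * b ^+ 2 * g ^+ 2) + z ^+ 2 / (2 * b ^+ 2))).
      by field; rewrite gn0 bn0.
    by rewrite g2 addrK subrr mul0r.
  rewrite mul1r [LHS](_ : _ = (q^-1 * q^-1 * b^-1) * (expR (- (z - 0) ^+ 2 / (1 ^+ 2 *+ 2)) * expR (- ((t - a * z) / b - 0) ^+ 2 / (1 ^+ 2 *+ 2)))); last by ring.
  by rewrite eE; field; rewrite q0 gn0 bn0.
rewrite ge0_integralZl//; last 3 first.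
- by apply/measurable_EFinP; exact: measurable_normal_pdf.
- by move=> x _; rewrite lee_fin normal_pdf_ge0.
- by rewrite lee_fin normal_pdf_ge0.
by rewrite integral_normal_pdf mule1.
Qed.

Lemma normal_scale (b : R) (F : R -> \bar R) : 0 < b ->
  measurable_fun setT F -> (forall x, (0 <= F x)%E) ->
  (\int[N01]_z F (b * z)%R = \int[normal_prob 0 b]_x F x)%E.
Proof.
move=> b0 mF F0.
have mFb : measurable_fun setT (fun z => F (b * z)) by apply: measurableT_comp.
rewrite (integral_normal_prob 0 1 mFb (fun z => F0 _)) (integral_normal_prob 0 b mF F0).
have mpdf (s : R) : measurable_fun setT (fun x => (normal_pdf 0 s x)%:E).
  by apply/measurable_EFinP; exact: measurable_normal_pdf.
rewrite [RHS](@lebesgue_integral_affine _ 0 b)//; last 2 first.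
- exact: emeasurable_funM.
- by move=> x; rewrite mule_ge0// lee_fin normal_pdf_ge0.
rewrite -ge0_integralZl//; last 3 first.
- apply: emeasurable_funM.
    by apply: (measurableT_comp mF); apply: measurable_funD => //; apply: measurable_funM.
  by apply: (measurableT_comp (mpdf b)); apply: measurable_funD => //; apply: measurable_funM.
- by move=> x _; rewrite mule_ge0// lee_fin normal_pdf_ge0.
- by rewrite lee_fin ltW.
apply: eq_integral => z _; rewrite add0r muleCA; congr (_ * _)%E; rewrite -EFinM; congr EFin.
have pi0 : 0 < pi :> R := pi_gt0 R.
have bn0 : b != 0 by rewrite gt_eqF.
rewrite !normal_pdfE ?oner_neq0// /normal_peak /normal_fun.
rewrite -[b ^+ 2 * pi *+ 2]mulrnAr sqrtrM ?sqr_ge0// sqrtr_sqr gtr0_norm//.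
rewrite expr1n mul1r; set q := Num.sqrt (pi *+ 2).
have q0 : q != 0 by rewrite gt_eqF// sqrtr_gt0 pmulrn_lgt0.
rewrite [RHS](_ : _ = q^-1 * expR (- (b * z - 0) ^+ 2 / (b ^+ 2 *+ 2))); last by field; rewrite q0 bn0.
by congr (_ * expR _); field.
Qed.

Lemma normal_convolution (a b : R) (F : R -> \bar R) : 0 < b ->
  measurable_fun setT F -> (forall x, (0 <= F x)%E) ->
  (\int[N01]_z \int[N01]_w F (a * z + b * w)%R =
   \int[normal_prob 0 (Num.sqrt (a ^+ 2 + b ^+ 2))]_x F x)%E.
Proof.
move=> b0 mF F0.
have mpdf (s : R) : measurable_fun setT (fun x => (normal_pdf 0 s x)%:E).
  by apply/measurable_EFinP; exact: measurable_normal_pdf.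
have pdf0 (s x : R) : (0 <= (normal_pdf 0 s x)%:E)%E by rewrite lee_fin normal_pdf_ge0.
pose k (zt : measurableTypeR R * measurableTypeR R) := (F zt.2 * (b^-1 * normal_pdf 0 1 ((zt.2 - a * zt.1) / b))%:E)%E.
have mk2 : measurable_fun setT (fun zt : measurableTypeR R * measurableTypeR R => (b^-1 * normal_pdf 0 1 ((zt.2 - a * zt.1) / b))%:E).
  apply/measurable_EFinP; apply: measurable_funM => //.
  apply: (measurableT_comp (@measurable_normal_pdf R 0 1)).
  apply: measurable_funM => //; apply: measurable_funB; first exact: measurable_snd.
  by apply: measurable_funM => //; exact: measurable_fst.
have k20 zt : (0 <= (b^-1 * normal_pdf 0 1 ((zt.2 - a * zt.1) / b))%:E)%E.
  by rewrite lee_fin mulr_ge0 ?normal_pdf_ge0// invr_ge0 ltW.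
have mk : measurable_fun setT k.
  by apply: emeasurable_funM => //; apply: (measurableT_comp mF); exact: measurable_snd.
have k0 zt : (0 <= k zt)%E by rewrite mule_ge0.
have inner z : (\int[N01]_w F (a * z + b * w)%R = \int[leb]_t k (z, t))%E.
  rewrite integral_normal_prob//; last by apply: (measurableT_comp mF); apply: measurable_funD => //; apply: measurable_funM.
  rewrite [RHS](@lebesgue_integral_affine _ (a * z) b)//; last exact: (measurableT_comp mk).
  rewrite -ge0_integralZl//; last 2 first.
  - apply: (measurableT_comp mk); apply: measurable_fun_pair => //.
    by apply: measurable_funD => //; apply: measurable_funM.
  - by rewrite lee_fin ltW.
  apply: eq_integral => w _; rewrite /k /= muleCA; congr (_ * _)%E; rewrite -EFinM; congr EFin.
  by rewrite mulrA mulfV ?gt_eqF// mul1r addrAC subrr add0r mulrAC mulfV ?gt_eqF// mul1r.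
under eq_integral do rewrite inner.
have mG : measurable_fun setT (fun z => \int[leb]_t k (z, t))%E.
  exact: (measurable_fun_fubini_tonelli_F (m2 := leb) k).
have G0 z : (0 <= \int[leb]_t k (z, t))%E by apply: integral_ge0.
rewrite [LHS]integral_normal_prob//.
pose k' (zt : measurableTypeR R * measurableTypeR R) := (k zt * (normal_pdf 0 1 zt.1)%:E)%E.
have mk' : measurable_fun setT k'.
  by apply: emeasurable_funM => //; apply: (measurableT_comp (mpdf 1)); exact: measurable_fst.
have k'0 zt : (0 <= k' zt)%E by rewrite mule_ge0.
transitivity (\int[leb]_z \int[leb]_t k' (z, t))%E.
    apply: eq_integral => z _; rewrite /k' /= ge0_integralZr//.
  exact: (measurableT_comp mk).
rewrite (fubini_tonelli (m1 := leb) (m2 := leb) k')//.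
rewrite integral_normal_prob//; apply: eq_integral => t _.
rewrite -(normal_pdf_convolution a t b0) -ge0_integralZl//; last 2 first.
- apply/measurable_EFinP; apply: measurable_funM; first exact: measurable_normal_pdf.
  apply: measurable_funM => //; apply: (measurableT_comp (@measurable_normal_pdf R 0 1)).
  by apply: measurable_funM => //; apply: measurable_funB => //; apply: measurable_funM.
- by move=> x _; rewrite lee_fin !mulr_ge0 ?normal_pdf_ge0// invr_ge0 ltW.
apply: eq_integral => z _; rewrite /k' /k /= -muleA; congr (_ * _)%E.
by rewrite -EFinM mulrC.
Qed.

Lemma normal_sym (F : R -> \bar R) :
  measurable_fun setT F -> (forall x, (0 <= F x)%E) ->
  (\int[N01]_z F (- z)%R = \int[N01]_z F z)%E.
Proof.
move=> mF F0.
have mpdf (s : R) : measurable_fun setT (fun x => (normal_pdf 0 s x)%:E).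
  by apply/measurable_EFinP; exact: measurable_normal_pdf.
have mFN : measurable_fun setT (fun z : R => F (- z)) by apply: measurableT_comp.
have mG : measurable_fun setT (fun z : R => F z * (normal_pdf 0 1 z)%:E)%E by exact: emeasurable_funM.
have G0 x : (0 <= F x * (normal_pdf 0 1 x)%:E)%E by rewrite mule_ge0// lee_fin normal_pdf_ge0.
rewrite (integral_normal_prob 0 1 mFN (fun z => F0 _)) (integral_normal_prob 0 1 mF F0).
rewrite (lebesgue_integralN mG G0).
apply: eq_integral => z _; congr (_ * _%:E)%E.
by rewrite !normal_pdfE ?oner_neq0// /normal_fun !subr0 sqrrN.
Qed.

End normal_densities.

(** * Moments of the standard normal law *)

Section normal_moments.
Context {R : realType}.
Local Notation leb := (@lebesgue_measure R).
Local Notation N01 := (@N01 R).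

Lemma bmf_shift (U : Type) d (V : measurableType d) (F : V -> R) : bmf F ->
  exists M, (forall x, 0 <= F x + M) /\ bmf (fun x => F x + M).
Proof.
move=> bF; have [M M0 FM] := bmf_bnd bF; exists M; split.
  by move=> x; have := FM x; rewrite ler_norml; lra.
by apply: bmfD => //; exact: bmf_cst.
Qed.

Let mlin (a : R) : measurable_fun setT (fun z : measurableTypeR R => a * z).
Proof. exact: measurable_funM. Qed.

(** A negative [b] is reduced to a positive one by the symmetry of the normal law; for [b = 0] the
    inner integral is constant. *)
Lemma normal_convolution_ge0 (a b : R) (F : R -> \bar R) :
  measurable_fun setT F -> (forall x, (0 <= F x)%E) ->
  (\int[N01]_z \int[N01]_w F (a * z + b * w)%R =
   \int[N01]_z F (Num.sqrt (a ^+ 2 + b ^+ 2) * z)%R)%E.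
Proof.
move=> mF F0.
have pos (a' b' : R) : 0 < b' -> (\int[N01]_z \int[N01]_w F (a' * z + b' * w)%R =
   \int[N01]_z F (Num.sqrt (a' ^+ 2 + b' ^+ 2) * z)%R)%E.
  move=> b0; rewrite (normal_convolution a' b0 mF F0); apply/esym.
  apply: (normal_scale _ mF F0).
  by rewrite sqrtr_gt0 ltr_wpDl ?sqr_ge0 ?exprn_gt0.
have [b0|b0|<-] := ltrgtP 0 b; first exact: pos.
- rewrite -[b ^+ 2]sqrrN; apply: etrans (pos a (- b) _); last by rewrite oppr_gt0.
  apply: eq_integral => z _.
  rewrite -[LHS](@normal_sym _ (fun w => F (a * z + b * w)))//.
    by apply: eq_integral => w _; rewrite mulrN mulNr.
  by apply: (measurableT_comp mF); apply: measurable_funD.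
- under eq_integral => z _.
    under eq_integral => w _ do rewrite mul0r addr0.
    rewrite integral_cst//= (_ : N01 setT = 1%E) ?mule1; last exact: probability_setT.
    over.
  rewrite /= expr0n addr0 sqrtr_sqr.
  have [a0|a0] := ler0P a; last by [].
  rewrite -[LHS](@normal_sym _ (fun w => F (a * w)))//.
    by apply: eq_integral => w _; rewrite mulrN mulNr.
  exact: (measurableT_comp mF).
Qed.

Lemma gauss_convolution (a b : R) (F : R -> R) : bmf F ->
  \int[N01]_z \int[N01]_w F (a * z + b * w) =
  \int[N01]_z F (Num.sqrt (a ^+ 2 + b ^+ 2) * z).
Proof.
move=> bF; have [M [M0 bM]] := bmf_shift R bF.
have bl (s t : R) : bmf (fun w : measurableTypeR R => F (s + t * w)).
  by apply: (bmf_comp _ bF); apply: measurable_funD => //; exact: mlin.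
have bs (t : R) : bmf (fun w : measurableTypeR R => F (t * w)) by apply: (bmf_comp _ bF); exact: mlin.
have bi : bmf (fun z : measurableTypeR R => \int[N01]_w F (a * z + b * w)).
  apply: (bmf_Rint2 N01 (f := fun z : measurableTypeR R * measurableTypeR R => F (a * z.1 + b * z.2))).
  apply: (bmf_comp _ bF); apply: measurable_funD; apply: measurable_funM => //.
have biE z : \int[N01]_w (F (a * z + b * w) + M) = \int[N01]_w F (a * z + b * w) + M.
  by apply: etrans (RintD N01 (bl (a * z) b) (bmf_cst M)) _; rewrite (Rint_cst N01).
have biM : bmf (fun z : measurableTypeR R => \int[N01]_w (F (a * z + b * w) + M)).
  rewrite (_ : (fun z => _) = fun z : measurableTypeR R => \int[N01]_w F (a * z + b * w) + M); first exact: bmfD bi (bmf_cst M).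
  by apply/funext => z; exact: biE.
have h : (\int[N01]_z (\int[N01]_w (F (a * z + b * w) + M)))%:E =
  (\int[N01]_z (F (Num.sqrt (a ^+ 2 + b ^+ 2) * z) + M))%:E.
  have bc := bmf_cst (U := measurableTypeR R) M.
  rewrite !EFin_Rint; last 2 first.
  - by apply: bmf_int; apply: bmfD => //; exact: bs.
  - exact: bmf_int biM.
  transitivity (\int[N01]_z \int[N01]_w (F (a * z + b * w) + M)%:E)%E.
    by apply: eq_integral => z _; rewrite EFin_Rint//; exact: bmf_int (bmfD (bl _ _) (bmf_cst M)).
  apply: (normal_convolution_ge0 a b (F := fun x => (F x + M)%:E)) => //.
  by apply/measurable_EFinP; exact: bmf_meas bM.
case: h; rewrite (_ : Rintegral _ _ _ = \int[N01]_z (\int[N01]_w F (a * z + b * w) + M)); last first.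
  by apply: eq_Rintegral => z _; exact: biE.
rewrite (RintD N01 bi (bmf_cst M)) (RintD N01 (bs _) (bmf_cst M)).
by rewrite (Rint_cst N01); exact: addIr.
Qed.

(** Writing N(0, s^2) as the law of [s * z] treats the point mass [s = 0] and both signs of [s]
    alike, which the case distinction of [centered_normal1] does not. *)
Lemma centered_normal1E (s : R) (B : set R) : measurable B ->
  centered_normal1 (s ^+ 2) B = N01 [set z | B (s * z)].
Proof.
move=> mB.
have mI : measurable_fun setT (fun x => (\1_B x : R)%:E).
  by apply/measurable_EFinP; exact: measurable_indic.
have key (t : R) : N01 [set z | B (t * z)] = (\int[N01]_z (\1_B (t * z))%:E)%E.
  have mt : measurable ([set z | B (t * z)] : set (measurableTypeR R)).
    rewrite (_ : [set z | B (t * z)] = (fun z => t * z) @^-1` B)//.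
    by rewrite -[X in measurable X]setTI; exact: mlin.
  transitivity (\int[N01]_z (\1_[set z | B (t * z)] z)%:E)%E.
    by rewrite integral_indic// setIT.
  by apply: eq_integral => z _.
rewrite /centered_normal1 sqrf_eq0; have [->|s0] := eqVneq s 0.
  have -> : [set z | B (0 * z)] = if 0 \in B then setT else set0.
    case: ifPn; rewrite ?inE ?notin_setE => B0; apply/seteqP; split => z //=; rewrite mul0r//.
  rewrite diracE; case: ifPn => _; last by rewrite measure0.
  by rewrite [RHS](probability_setT N01).
rewrite sqrtr_sqr key.
have -> : (\int[N01]_z (\1_B (s * z))%:E = \int[N01]_z (\1_B (`|s| * z))%:E)%E.
  have [h|h] := ler0P s; last by [].
  rewrite -[LHS](@normal_sym _ (fun z => (\1_B (s * z))%:E))//.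
    by apply: eq_integral => w _; rewrite mulrN mulNr.
  exact: (measurableT_comp mI).
rewrite (@normal_scale _ `|s| (fun x => (\1_B x)%:E)) ?normr_gt0//.
by rewrite integral_indic// setIT.
Qed.

(** The exponential weight turns the standard normal density into [s] times the density of deviation
    [s]. It gives both the integrability of polynomials and the second moment. *)
Lemma gauss_exp (s : R) : 0 < s ->
  (\int[N01]_z (expR ((1 - s ^- 2) / 2 * z ^+ 2))%:E = s%:E)%E.
Proof.
move=> s0.
have me : measurable_fun setT (fun z : measurableTypeR R => (expR ((1 - s ^- 2) / 2 * z ^+ 2))%:E).
  apply/measurable_EFinP; apply: measurableT_comp; first exact: measurable_expR.
  by apply: measurable_funM => //; exact: measurable_funX.
rewrite integral_normal_prob//.
transitivity (\int[leb]_x (s%:E * (normal_pdf 0 s x)%:E))%E; last first.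
  rewrite ge0_integralZl//.
  - by rewrite integral_normal_pdf mule1.
  - by apply/measurable_EFinP; exact: measurable_normal_pdf.
  - by move=> x _; rewrite lee_fin normal_pdf_ge0.
  - by rewrite lee_fin ltW.
apply: eq_integral => z _; rewrite -!EFinM; congr EFin.
have sn0 : s != 0 by rewrite gt_eqF.
rewrite !normal_pdfE ?oner_neq0// /normal_peak /normal_fun !subr0.
have pi0 : 0 < pi :> R := pi_gt0 R.
rewrite -[s ^+ 2 * pi *+ 2]mulrnAr sqrtrM ?sqr_ge0// sqrtr_sqr gtr0_norm//.
rewrite expr1n mul1r; set q := Num.sqrt (pi *+ 2).
have q0 : q != 0 by rewrite gt_eqF// sqrtr_gt0 pmulrn_lgt0.
transitivity (q^-1 * (expR ((1 - s ^- 2) / 2 * z ^+ 2) * expR (- z ^+ 2 / (1 *+ 2)))); first by rewrite mulrCA ?mul1r.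
rewrite -expRD [RHS](_ : _ = q^-1 * expR (- z ^+ 2 / (s ^+ 2 *+ 2))); last by field; rewrite q0 sn0.
by congr (_ * expR _); field.
Qed.

Lemma gauss_integrable (f : R -> R) (K : R) : measurable_fun setT f ->
  (forall z, `|f z| <= K * (1 + z ^+ 4)) ->
  N01.-integrable setT (EFin \o f).
Proof.
move=> mf fK.
have s2 : 0 < Num.sqrt 2 :> R by rewrite sqrtr_gt0.
have K0 : 0 <= K.
  by have := fK 0; rewrite expr0n addr0 mulr1; apply: le_trans.
(* The majorant is integrable by [gauss_exp] at the square root of 2. Here 65 is 1 + 64, with
   [z ^+ 4 <= 64 * expR (z ^+ 2 / 4)] obtained by squaring [1 + z ^+ 2 / 8 <= expR (z ^+ 2 / 8)]. *)
apply: (@le_integrable _ _ _ N01 _ measurableT (EFin \o f) (fun z => (65 * K * expR (z ^+ 2 / 4))%:E)).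
- exact/measurable_EFinP.
- move=> z _ /=; rewrite lee_fin; apply: le_trans (fK z) _.
  apply: le_trans (ler_norm _); rewrite [65 * K]mulrC -mulrA; apply: ler_wpM2l => //.
  have h1 : 1 <= expR (z ^+ 2 / 4) by rewrite -[leLHS]expR0 ler_expR divr_ge0// sqr_ge0.
  have h2 : z ^+ 4 <= 64 * expR (z ^+ 2 / 4).
    have h : 1 + z ^+ 2 / 8 <= expR (z ^+ 2 / 8) by exact: expR_ge1Dx.
    have -> : expR (z ^+ 2 / 4) = expR (z ^+ 2 / 8) ^+ 2.
      by rewrite [RHS]expr2 -expRD; congr expR; field.
    have z2 : 0 <= z ^+ 2 := sqr_ge0 z.
    have : (1 + z ^+ 2 / 8) ^+ 2 <= expR (z ^+ 2 / 8) ^+ 2.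
      by apply: lerXn2r => //; rewrite ?nnegrE ?expR_ge0//; lra.
    have -> : z ^+ 4 = (z ^+ 2) ^+ 2 by rewrite -exprM.
    move: (z ^+ 2) z2 => y y0; nra.
  lra.
- apply/integrableP; split.
    apply/measurable_EFinP; apply: measurable_funM => //.
    apply: measurableT_comp; first exact: measurable_expR.
    by apply: measurable_funM => //; exact: measurable_funX.
  rewrite (_ : integral _ _ _ = \int[N01]_z (65 * K * expR (z ^+ 2 / 4))%:E)%E; last first.
    by apply: eq_integral => z _; rewrite /= ger0_norm// mulr_ge0 ?expR_ge0// mulr_ge0.
  rewrite ge0_integral_EFinZl; last 3 first.
  - apply: measurableT_comp; first exact: measurable_expR.
    by apply: measurable_funM => //; exact: measurable_funX.
  - by move=> z; rewrite expR_ge0.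
  - by rewrite mulr_ge0.
  have -> : (\int[N01]_z (expR (z ^+ 2 / 4))%:E = (Num.sqrt 2)%:E)%E.
    rewrite -(gauss_exp s2); apply: eq_integral => z _; congr (expR _)%:E.
    by rewrite sqr_sqrtr//; field.
  by rewrite -EFinM ltry.
Qed.

Lemma gauss_moment1 : \int[N01]_z z = 0.
Proof.
have i1 : N01.-integrable setT (EFin \o (fun z : R => z)).
  apply: (@gauss_integrable _ 1) => // z; rewrite mul1r.
  have : 0 <= (z ^+ 2 - 1) ^+ 2 by exact: sqr_ge0.
  have : z ^+ 4 = (z ^+ 2) ^+ 2 by rewrite -exprM.
  have : 0 <= (`|z| - 1) ^+ 2 by exact: sqr_ge0.
  have : `|z| ^+ 2 = z ^+ 2 by rewrite real_normK// num_real.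
  by nra.
pose p z : R := Num.max z 0.
have mp : measurable_fun setT (p : measurableTypeR R -> R) by exact: measurable_maxr.
have p0 z : 0 <= p z by rewrite le_max lexx orbT.
rewrite /Rintegral integralE.
rewrite (_ : (\int[N01]_z (EFin^\- z)) = (\int[N01]_z (EFin^\+ z)))%E; last first.
  rewrite -[RHS]normal_sym; last 2 first.
  - exact: measurable_funepos.
  - by move=> x; rewrite funeposE le_max lexx orbT.
  by apply: eq_integral => z _; rewrite funeposE funenegE.
rewrite subee//; apply: integrable_fin_num => //.
exact: integrable_funepos.
Qed.

(** Bounding the exponential in [gauss_exp] below by its tangent gives
    [(1 - s ^- 2) / 2 * v <= s - 1] for all [s > 0], an equality at [s = 1]. Letting [s] tend to 1
    from above and from below pins [v] to 1, with no integration by parts. *)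
Lemma gauss_moment2 : \int[N01]_z (z ^+ 2) = 1.
Proof.
have i2 : N01.-integrable setT (EFin \o (fun z : R => z ^+ 2)).
  apply: (@gauss_integrable _ 1); first exact: measurable_funX.
  move=> z; rewrite mul1r ger0_norm ?sqr_ge0//.
  have : 0 <= (z ^+ 2 - 1) ^+ 2 by exact: sqr_ge0.
  have : z ^+ 4 = (z ^+ 2) ^+ 2 by rewrite -exprM.
  by have := sqr_ge0 z; nra.
set v := Rintegral _ _ _.
have key (s : R) : 0 < s -> (1 - s ^- 2) / 2 * v <= s - 1.
  move=> s0; rewrite lerBrDl.
  have c1 : N01.-integrable setT (EFin \o (fun _ : R => 1 : R)) by apply: bmf_int; exact: bmf_cst.
  have z24 (z : R) : z ^+ 2 <= 1 + z ^+ 4.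
    have : 0 <= (z ^+ 2 - 1) ^+ 2 by exact: sqr_ge0.
    have : z ^+ 4 = (z ^+ 2) ^+ 2 by rewrite -exprM.
    by have := sqr_ge0 z; nra.
  have mz : measurable_fun setT (fun z : measurableTypeR R => (1 - s ^- 2) / 2 * z ^+ 2).
    by apply: measurable_funM => //; exact: measurable_funX.
  have c2 : N01.-integrable setT (EFin \o (fun z : R => (1 - s ^- 2) / 2 * z ^+ 2)).
    apply: (@gauss_integrable _ `|(1 - s ^- 2) / 2|) => // z.
    by rewrite normrM ler_wpM2l// ger0_norm ?sqr_ge0.
  have c3 : N01.-integrable setT (EFin \o (fun z : R => 1 + (1 - s ^- 2) / 2 * z ^+ 2)).
    apply: (@gauss_integrable _ (1 + `|(1 - s ^- 2) / 2|)); first exact: measurable_funD.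
    move=> z; apply: le_trans (ler_normD _ _) _; rewrite normr1 [leRHS]mulrDl mul1r; apply: lerD.
      by rewrite lerDl -[4%N]/(2 * 2)%N exprM sqr_ge0.
    by rewrite normrM ler_wpM2l// ger0_norm ?sqr_ge0.
  have -> : 1 + (1 - s ^- 2) / 2 * v = \int[N01]_z (1 + (1 - s ^- 2) / 2 * z ^+ 2).
    by rewrite RintegralD// RintegralZl// (Rint_cst N01).
  rewrite -lee_fin -(gauss_exp s0) EFin_Rint//.
  apply: le_integral => //.
  - apply/integrableP; split.
      by apply/measurable_EFinP; apply: measurableT_comp => //; exact: measurable_expR.
    under eq_integral => z _ do rewrite /= ger0_norm ?expR_ge0//.
    by rewrite (gauss_exp s0) ltry.
  - by move=> z _; rewrite lee_fin expR_ge1Dx.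
apply/eqP; rewrite eq_le; apply/andP; split.
  apply/ler_addgt0Pr => e e0.
  pose d := Num.min 1 (e / 2).
  have d0 : 0 < d by rewrite lt_min ltr01 divr_gt0.
  have d1 : d <= 1 by rewrite ge_min lexx.
  have de : d <= e / 2 by rewrite ge_min lexx orbT.
  have := key (1 + d); rewrite addr_gt0// => /(_ isT).
  have -> : (1 - (1 + d) ^- 2) / 2 * v = (2 * d + d ^+ 2) * v / (2 * (1 + d) ^+ 2).
    by field; rewrite gt_eqF// addr_gt0.
  rewrite ler_pdivrMr; last by rewrite mulr_gt0// exprn_gt0// addr_gt0.
  move=> h; have {h} : (2 + d) * v <= 2 * (1 + d) ^+ 2.
    rewrite -(ler_pM2l d0); apply: le_trans (le_trans _ h) _; rewrite le_eqVlt; apply/orP; left; apply/eqP; ring.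
  nra.
apply/ler_addgt0Pr => e e0.
pose d := Num.min (2^-1) (e / 2).
have d0 : 0 < d by rewrite lt_min invr_gt0 ltr0n divr_gt0.
have d1 : d <= 2^-1 by rewrite ge_min lexx.
have de : d <= e / 2 by rewrite ge_min lexx orbT.
have d2 : 0 < 1 - d by lra.
have := key (1 - d) d2.
have -> : (1 - (1 - d) ^- 2) / 2 * v = (- 2 * d + d ^+ 2) * v / (2 * (1 - d) ^+ 2).
  by field; rewrite gt_eqF.
rewrite ler_pdivrMr; last by rewrite mulr_gt0// exprn_gt0.
move=> h; have {h} : 2 * (1 - d) ^+ 2 <= (2 - d) * v.
  rewrite -lerN2 -(ler_pM2l d0); apply: le_trans (le_trans _ h) _; rewrite le_eqVlt; apply/orP; left; apply/eqP; ring.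
nra.
Qed.

End normal_moments.

(** * Measurability of maps into row vectors *)

Section borel_rV.
Context {R : realType}.

Lemma continuous_borel_measurable (V : ptopologicalType) (f : V -> R) :
  continuous f -> measurable_fun [set: borel V] f.
Proof.
move=> cf; apply: (measurability _ (RGenOInfty.measurableE R)) => //.
move=> /= _ [_ [a ->] <-]; rewrite setTI.
apply: sub_sigma_algebra; apply: open_comp; last exact: interval_open.
by move=> x _; exact: cf.
Qed.

(** The sigma-algebra on row vectors is generated by the open sets, and an open set is a countable
    union of boxes with rational centres and radii [1 / n]. *)
Lemma measurable_rV d (U : measurableType d) l (f : U -> 'rV[R]_l) :
  (forall i, measurable_fun setT (fun u => f u 0 i)) ->
  measurable_fun setT (f : U -> borel 'rV[R]_l).
Proof.
move=> mf.
apply: (@measurability _ _ U (borel 'rV[R]_l) _ f (@open 'rV[R]_l)) => //.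
move=> _ [W oW <-]; rewrite setTI.
pose box (qn : {ffun 'I_l -> rat} * nat) :=
  [set v : 'rV[R]_l | forall i, `|ratr (qn.1 i) - v 0 i| < (qn.2.+1%:R)^-1].
(* Codes of pairs enumerate the boxes; a number coding none, or a box that is not inside [W],
   contributes the empty set. *)
pose F k := if @unpickle ({ffun 'I_l -> rat} * nat)%type k is Some qn then
    (if pselect (box qn `<=` W) then f @^-1` box qn else set0) else (set0 : set U).
have -> : f @^-1` W = \bigcup_k F k.
  apply/seteqP; split => [u /= Wfu|u [k _]]; last first.
    rewrite /F; case: unpickle => [qn|//]; case: pselect => // bW; exact: bW.
  have [e /= e0 eW] : nbhs_ball (f u) W.
    by apply/nbhs_ballP; exact: open_nbhs_nbhs (conj oW Wfu).
  pose n := Num.truncn (2 / e).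
  have nE : 2 * (n.+1%:R)^-1 < e :> R.
    by rewrite ltr_pdivrMr// mulrC -ltr_pdivrMr// truncnS_gt.
  have n0 : 0 < (n.+1%:R)^-1 :> R by rewrite invr_gt0.
  have [q qE] : exists q : {ffun 'I_l -> rat}, forall i, `|ratr (q i) - f u 0 i| < (n.+1%:R)^-1.
    have h i : exists q : rat, `|ratr q - f u 0 i| < (n.+1%:R)^-1.
      have : f u 0 i - (n.+1%:R)^-1 < f u 0 i + (n.+1%:R)^-1.
        by rewrite ltrBlDr -addrA ltrDl addr_gt0.
      move/rat_in_itvoo => [q]; rewrite in_itv/= => /andP[h1 h2].
      by exists q; rewrite ltr_norml ltrBrDl h1 /= ltrBlDl h2.
    exists [ffun i => sval (cid (h i))] => i.
    by rewrite ffunE; exact: svalP (cid (h i)).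
  exists (pickle (q, n)) => //; rewrite /F pickleK; case: pselect => [h|nb]; first exact: qE.
  case: nb => v /= bv; apply: eW; split => // i j; rewrite /ball /= (ord1 i).
  apply: le_lt_trans nE.
  rewrite (_ : f u 0 j - v 0 j = (f u 0 j - ratr (q j)) + (ratr (q j) - v 0 j)); last by ring.
  apply: le_trans (ler_normD _ _) _; rewrite mulr_natl mulr2n distrC; apply: lerD; apply: ltW.
    exact: qE.
  exact: bv.
apply: bigcup_measurable => k _; rewrite /F; case: unpickle => // qn.
case: pselect => h /=; last exact: measurable0.
have -> : f @^-1` box qn = \bigcap_(i in [set: 'I_l]) ((fun u => f u 0 i) @^-1` [set x | `|ratr (qn.1 i) - x| < (qn.2.+1%:R)^-1]).
  by apply/seteqP; split => u /= hu i; [move=> _|]; exact: hu.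
apply: fin_bigcap_measurable => // i _.
rewrite -[X in measurable X]setTI; apply: mf => //.
by have := measurable_ball (ratr (qn.1 i) : R) (qn.2.+1%:R)^-1.
Qed.

Lemma measurable_coord l (i : 'I_l) :
  measurable_fun [set: borel 'rV[R]_l] (fun v : 'rV[R]_l => v 0 i).
Proof. by apply: continuous_borel_measurable => v; exact: coord_continuous. Qed.

End borel_rV.

(** * Convolution operators *)

Section convolution_operators.
Context {R : realType} {l : nat}.
Local Notation rV := 'rV[R]_l.
Local Notation B := (borel rV).
Implicit Types (Phi : rV -> R).

(** The expectation of [Phi (x + zeta)]. Sums of independent vectors become compositions of these
    operators, so the laws of the sums need never be formed. *)
Definition conv_op d (U : measurableType d) (mu : probability U R) (zeta : U -> rV)
  (Phi : rV -> R) (x : rV) : R := \int[mu]_u Phi (x + zeta u).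

Definition meas_coords d (U : measurableType d) (f : U -> rV) :=
  forall i, measurable_fun setT (fun u => f u 0 i).

Lemma meas_coordsD d (U : measurableType d) (f g : U -> rV) :
  meas_coords f -> meas_coords g -> meas_coords (fun u => f u + g u).
Proof.
move=> mf mg i; under eq_fun do rewrite mxE.
exact: measurable_funD.
Qed.

Lemma meas_coordsZ d (U : measurableType d) (r : U -> R) (f : U -> rV) :
  measurable_fun setT r -> meas_coords f -> meas_coords (fun u => r u *: f u).
Proof.
move=> mr mf i; under eq_fun do rewrite mxE.
exact: measurable_funM.
Qed.

Lemma meas_coords_cst d (U : measurableType d) (x : rV) :
  meas_coords (fun _ : U => x).
Proof. by move=> i; exact: measurable_cst. Qed.

Lemma meas_coords_comp d (U : measurableType d) d' (V : measurableType d') (f : U -> rV) (h : V -> U) :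
  measurable_fun setT h -> meas_coords f -> meas_coords (fun v => f (h v)).
Proof. by move=> mh mf i; exact: (measurableT_comp (mf i)). Qed.

Lemma meas_coords_id : meas_coords (fun v : B => v : rV).
Proof. by move=> i; exact: measurable_coord. Qed.

Lemma bmf_rV_comp d (U : measurableType d) (f : U -> rV) Phi :
  meas_coords f -> bmf (Phi : B -> R) -> bmf (fun u => Phi (f u)).
Proof. by move=> mf; apply: bmf_comp; exact: measurable_rV. Qed.

Section one_operator.
Context d (U : measurableType d) (mu : probability U R) (zeta : U -> rV).
Hypothesis mzeta : meas_coords zeta.

Lemma bmf_shifted Phi x : bmf (Phi : B -> R) -> bmf (fun u => Phi (x + zeta u)).
Proof. by apply: bmf_rV_comp; apply: meas_coordsD => //; exact: meas_coords_cst. Qed.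

Lemma conv_op_bmf Phi : bmf (Phi : B -> R) -> bmf (conv_op mu zeta Phi : B -> R).
Proof.
move=> bP; apply: (bmf_Rint2 mu (f := fun z : B * U => Phi ((z.1 : rV) + zeta z.2))).
apply: bmf_rV_comp => //; apply: meas_coordsD.
  exact: (meas_coords_comp (@measurable_fst _ _ B U) meas_coords_id).
exact: (meas_coords_comp (@measurable_snd _ _ B U) mzeta).
Qed.

Lemma conv_opB Phi Psi x : bmf (Phi : B -> R) -> bmf (Psi : B -> R) ->
  conv_op mu zeta (fun y => Phi y - Psi y) x = conv_op mu zeta Phi x - conv_op mu zeta Psi x.
Proof. by move=> bP bQ; rewrite /conv_op RintB//; exact: bmf_shifted. Qed.

Lemma conv_op_le Phi e x : bmf (Phi : B -> R) -> (forall y, `|Phi y| <= e) ->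
  `|conv_op mu zeta Phi x| <= e.
Proof. by move=> bP Pe; apply: norm_Rint_le => //; exact: bmf_shifted. Qed.

End one_operator.

Lemma conv_opC d (U : measurableType d) (mu : probability U R) (zeta : U -> rV)
    d' (V : measurableType d') (nu : probability V R) (theta : V -> rV) Phi x :
  meas_coords zeta -> meas_coords theta -> bmf (Phi : B -> R) ->
  conv_op mu zeta (conv_op nu theta Phi) x = conv_op nu theta (conv_op mu zeta Phi) x.
Proof.
move=> mz mt bP; rewrite /conv_op.
rewrite (Rint_swap mu nu (f := fun z : U * V => Phi (x + zeta z.1 + theta z.2))).
  by apply: eq_Rintegral => v _; apply: eq_Rintegral => u _; rewrite addrAC.
apply: bmf_rV_comp => //; apply: meas_coordsD; last first.
  exact: (meas_coords_comp (@measurable_snd _ _ U V) mt).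
apply: meas_coordsD; first exact: meas_coords_cst.
exact: (meas_coords_comp (@measurable_fst _ _ U V) mz).
Qed.

Section telescoping.
Context d (U : measurableType d) (mu : probability U R) (zeta : U -> rV).
Context d' (V : measurableType d') (nu : probability V R) (theta : V -> rV).
Hypotheses (mz : meas_coords zeta) (mt : meas_coords theta).

Let A := conv_op mu zeta.
Let C := conv_op nu theta.

Lemma iter_conv_bmf n Phi : bmf (Phi : B -> R) -> bmf (iter n A Phi : B -> R).
Proof. by move=> bP; elim: n => // n IH; exact: conv_op_bmf. Qed.

Lemma iter_convC n Phi x : bmf (Phi : B -> R) -> iter n A (C Phi) x = C (iter n A Phi) x.
Proof.
move=> bP; elim: n x => // n IH x.
rewrite iterS (_ : iter n A (C Phi) = C (iter n A Phi)); last exact/funext.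
by rewrite iterS /A /C conv_opC//; exact: iter_conv_bmf.
Qed.

Lemma iter_conv_le n Phi e x : bmf (Phi : B -> R) -> (forall y, `|Phi y| <= e) ->
  `|iter n A Phi x| <= e.
Proof.
move=> bP Pe; elim: n x => // n IH x.
by rewrite iterS; apply: conv_op_le => //; exact: iter_conv_bmf.
Qed.

Lemma iter_convB n Phi Psi x : bmf (Phi : B -> R) -> bmf (Psi : B -> R) ->
  iter n A (fun y => Phi y - Psi y) x = iter n A Phi x - iter n A Psi x.
Proof.
move=> bP bQ; elim: n x => // n IH x.
rewrite !iterS (_ : iter n A _ = fun y => iter n A Phi y - iter n A Psi y); last exact/funext.
by rewrite /A conv_opB//; exact: iter_conv_bmf.
Qed.
End telescoping.

(* All these operators commute, so replacing [n] factors costs [n] times the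
   error of replacing one. *)
Lemma iter_conv_dist d (U : measurableType d) (mu : probability U R) (zeta : U -> rV)
    d' (V : measurableType d') (nu : probability V R) (theta : V -> rV) n Phi e x :
  meas_coords zeta -> meas_coords theta -> bmf (Phi : B -> R) ->
  (forall y, `|conv_op mu zeta Phi y - conv_op nu theta Phi y| <= e) ->
  `|iter n (conv_op mu zeta) Phi x - iter n (conv_op nu theta) Phi x| <= n%:R * e.
Proof.
move=> mz mt bP Pe; set A := conv_op mu zeta; set C := conv_op nu theta.
have bA := conv_op_bmf mu mz bP; have bC := conv_op_bmf nu mt bP.
elim: n x => [|n IH] x; first by rewrite subrr normr0 mul0r.
rewrite !iterSr (_ : iter n A (A Phi) x - iter n C (C Phi) x =
  (iter n A (A Phi) x - iter n A (C Phi) x) + (iter n A (C Phi) x - iter n C (C Phi) x)); last by ring.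
apply: le_trans (ler_normD _ _) _; rewrite -natr1 mulrDl mul1r addrC; apply: lerD.
  rewrite iter_convC// -[iter n C (C Phi)]iterSr iterS.
  rewrite -conv_opB//; [|exact: iter_conv_bmf|exact: iter_conv_bmf].
  apply: conv_op_le => //; by apply: bmfB; exact: iter_conv_bmf.
rewrite -iter_convB//; apply: iter_conv_le => //; exact: bmfB.
Qed.

End convolution_operators.

(** * Gaussian vectors built from generators *)

Section gaussian_vectors.
Context {R : realType} {l : nat}.
Local Notation rV := 'rV[R]_l.
Local Notation B := (borel rV).
Local Notation N01 := (@N01 R).
Implicit Types (Phi : rV -> R) (s : seq rV).

Definition dotv (u v : rV) : R := \sum_i u 0 i * v 0 i.

Lemma dotvD u v w : dotv u (v + w) = dotv u v + dotv u w.
Proof. by rewrite /dotv -big_split; apply: eq_bigr => i _; rewrite mxE mulrDr. Qed.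

Lemma dotvZ u (r : R) v : dotv u (r *: v) = r * dotv u v.
Proof. by rewrite /dotv mulr_sumr; apply: eq_bigr => i _; rewrite mxE mulrCA. Qed.

Lemma dotv0 u : dotv u 0 = 0.
Proof. by rewrite /dotv big1// => i _; rewrite mxE mulr0. Qed.

Lemma measurable_dotv u : measurable_fun setT (fun v : B => dotv u v).
Proof.
apply: (@measurable_sum _ _ _ _ _ _ (fun i (v : B) => u 0 i * (v : rV) 0 i)) => i.
by apply: measurable_funM => //; exact: measurable_coord.
Qed.

Definition gauss_shift (a : rV) (p : measurableTypeR R * B) : B := p.1 *: a + (p.2 : rV).

Lemma meas_gauss_shift a : meas_coords (fun p : measurableTypeR R * B => p.1 *: a + (p.2 : rV)).
Proof.
apply: meas_coordsD.
  by apply: meas_coordsZ; [exact: measurable_fst|exact: meas_coords_cst].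
exact: (meas_coords_comp (@measurable_snd _ _ (measurableTypeR R) B) meas_coords_id).
Qed.

Lemma measurable_gauss_shift a : measurable_fun setT (gauss_shift a).
Proof. by apply: measurable_rV; exact: meas_gauss_shift. Qed.

HB.instance Definition _ a :=
  isMeasurableFun.Build _ _ _ _ (gauss_shift a) (measurable_gauss_shift a).

(* The law of the sum of [z_a *: a] over [a] in [s], the [z_a] being independent
   standard normal variables. *)
Fixpoint gauss_vec s : probability B R :=
  if s is a :: s' then distribution (prodP N01 (gauss_vec s')) (gauss_shift a)
  else \d_(0 : B).

Lemma gauss_vec_nil Phi : bmf (Phi : B -> R) -> \int[gauss_vec [::]]_v Phi v = Phi 0.
Proof.
move=> bP; rewrite /Rintegral /= integral_dirac//; last by apply/measurable_EFinP; exact: bmf_meas bP.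
by rewrite diracT mul1e.
Qed.

Lemma gauss_vec_cons a s Phi : bmf (Phi : B -> R) ->
  \int[gauss_vec (a :: s)]_v Phi v = \int[N01]_z \int[gauss_vec s]_v Phi (z *: a + v).
Proof.
move=> bP.
rewrite (Rint_pushforward (mu := prodP N01 (gauss_vec s)) (nu := gauss_vec (a :: s)) (measurable_gauss_shift a) _ bP)//.
rewrite Rint_prod12//; exact: (bmf_comp (measurable_gauss_shift a) bP).
Qed.

(** Under a linear form each generator adds one independent normal variable, and [gauss_convolution]
    adds its variance to the total. *)
Lemma gauss_vec_dot u s (F : R -> R) : bmf F ->
  \int[gauss_vec s]_v F (dotv u v) =
  \int[N01]_z F (Num.sqrt (\sum_(a <- s) dotv u a ^+ 2) * z).
Proof.
elim: s F => [|a s IH] F bF.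
  rewrite gauss_vec_nil; last exact: (bmf_comp (measurable_dotv u) bF).
  under [RHS]eq_Rintegral do rewrite big_nil sqrtr0 mul0r.
  by rewrite (Rint_cst N01) dotv0.
rewrite gauss_vec_cons; last exact: (bmf_comp (measurable_dotv u) bF).
set g := Num.sqrt (\sum_(a <- s) dotv u a ^+ 2).
transitivity (\int[N01]_z \int[N01]_w F (dotv u a * z + g * w)).
  apply: eq_Rintegral => z _.
  have bF' : bmf (fun x : measurableTypeR R => F (dotv u a * z + x)).
    by apply: (bmf_comp _ bF); exact: measurable_funD.
  rewrite -(IH _ bF'); apply: eq_Rintegral => v _.
  by rewrite dotvD dotvZ mulrC.
rewrite gauss_convolution// big_cons sqr_sqrtr//.
by apply: sumr_ge0 => b _; exact: sqr_ge0.
Qed.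

(** The covariance matrix of [gauss_vec s]: each generator contributes a matrix of rank at most
    one. *)
Definition gram_mx s : 'M[R]_l := \sum_(a <- s) a^T *m a.

Lemma gram_mxE s i j : gram_mx s i j = \sum_(a <- s) a 0 i * a 0 j.
Proof.
rewrite /gram_mx summxE; apply: eq_bigr => a _.
by rewrite mxE big_ord1 mxE.
Qed.

Lemma gram_mx_form s u : (u *m gram_mx s *m u^T) 0 0 = \sum_(a <- s) dotv u a ^+ 2.
Proof.
rewrite /gram_mx mulmx_sumr mulmx_suml summxE; apply: eq_bigr => a _.
rewrite mulmxA -mulmxA mxE big_ord1 expr2; congr (_ * _).
  by rewrite mxE; apply: eq_bigr => i _; rewrite mxE.
by rewrite mxE; apply: eq_bigr => i _; rewrite mxE mulrC.
Qed.

Lemma Rint_indic d (U : measurableType d) (mu : probability U R) (A : set U) :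
  measurable A -> (\int[mu]_x (\1_A x : R))%:E = mu A.
Proof.
by move=> mA; rewrite EFin_Rint ?integral_indic ?setIT//; exact: bmf_int (bmf_indic mA).
Qed.

Lemma gauss_vec_normal s : is_centered_normal (gram_mx s) (gauss_vec s).
Proof.
move=> u C mC; set g := Num.sqrt (\sum_(a <- s) dotv u a ^+ 2).
rewrite gram_mx_form -[X in centered_normal1 X](@sqr_sqrtr _ (\sum_(a <- s) dotv u a ^+ 2)); last first.
  by apply: sumr_ge0 => b _; exact: sqr_ge0.
rewrite centered_normal1E// -/g.
have mA : measurable ([set v | C (dotv u v)] : set B).
  by rewrite -[X in measurable X]setTI; exact: measurable_dotv.
have mD : measurable ([set z | C (g * z)] : set (measurableTypeR R)).
  rewrite -[X in measurable X]setTI.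
  by apply: (measurable_funM (f := fun _ => g) (g := id)).
rewrite -[LHS](Rint_indic (gauss_vec s) mA) -[RHS](Rint_indic N01 mD); congr EFin.
exact: (gauss_vec_dot u s (bmf_indic mC)).
Qed.

Definition gauss_op s (r : R) := conv_op (gauss_vec s) (fun v : B => r *: (v : rV)).

Lemma meas_scale (r : R) : meas_coords (fun v : B => r *: (v : rV)).
Proof. by apply: meas_coordsZ; [exact: measurable_cst|exact: meas_coords_id]. Qed.

Let meas_line (a : rV) : meas_coords (fun z : measurableTypeR R => z *: a).
Proof. by apply: meas_coordsZ => //; exact: meas_coords_cst. Qed.

Lemma gauss_op_cons a s r Phi x : bmf (Phi : B -> R) ->
  gauss_op (a :: s) r Phi x =
  conv_op N01 (fun z : measurableTypeR R => z *: (r *: a)) (gauss_op s r Phi) x.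
Proof.
move=> bP; rewrite /gauss_op /conv_op gauss_vec_cons; last exact: (bmf_shifted (meas_scale r) x bP).
apply: eq_Rintegral => z _; apply: eq_Rintegral => v _.
by rewrite scalerDr addrA scalerA mulrC -scalerA.
Qed.

Lemma gauss_op_bmf s r Phi : bmf (Phi : B -> R) -> bmf (gauss_op s r Phi : B -> R).
Proof. by apply: conv_op_bmf; exact: meas_scale. Qed.

Lemma gauss_op_nil (r : R) Phi x : bmf (Phi : B -> R) -> gauss_op [::] r Phi x = Phi x.
Proof.
move=> bP; rewrite /gauss_op /conv_op gauss_vec_nil ?scaler0 ?addr0//.
exact: (bmf_shifted (meas_scale r) x bP).
Qed.

(** The semigroup law. The two operators of the head generator are brought together by commutation
    and merged by [gauss_convolution] on the line it spans; the rest is the induction hypothesis. *)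
Lemma gauss_opD s (a b : R) Phi x : bmf (Phi : B -> R) ->
  gauss_op s a (gauss_op s b Phi) x = gauss_op s (Num.sqrt (a ^+ 2 + b ^+ 2)) Phi x.
Proof.
elim: s Phi x => [|c s IH] Phi x bP.
  by rewrite !gauss_op_nil//; exact: gauss_op_bmf.
rewrite !gauss_op_cons//; last exact: gauss_op_bmf.
pose ln r := conv_op N01 (fun z : measurableTypeR R => z *: (r *: c)).
have bln r Psi : bmf (Psi : B -> R) -> bmf (ln r Psi : B -> R).
  by move=> bQ; exact: (conv_op_bmf N01 (meas_line (r *: c)) bQ).
rewrite (_ : gauss_op (c :: s) b Phi = ln b (gauss_op s b Phi)); last first.
  by apply/funext => y; exact: gauss_op_cons.
rewrite (_ : gauss_op s a (ln b (gauss_op s b Phi)) = ln b (gauss_op s a (gauss_op s b Phi))); last first.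
  apply/funext => y; apply: conv_opC; [exact: meas_scale|exact: meas_line|exact: gauss_op_bmf].
rewrite (_ : gauss_op s a (gauss_op s b Phi) = gauss_op s (Num.sqrt (a ^+ 2 + b ^+ 2)) Phi); last first.
  by apply/funext => y; exact: IH.
set Psi := gauss_op s _ Phi.
have bQ : bmf (Psi : B -> R) by exact: gauss_op_bmf.
rewrite /conv_op.
have bF : bmf (fun t : measurableTypeR R => Psi (x + t *: c)).
  exact: (bmf_shifted (meas_line c) x bQ).
have := gauss_convolution a b bF.
under [in X in _ = X -> _]eq_Rintegral do rewrite mulrC -scalerA.
move=> <-; apply: eq_Rintegral => z _; apply: eq_Rintegral => w _.
by rewrite -addrA !scalerA -scalerDl ![_ * z]mulrC ![_ * w]mulrC.
Qed.

(** Stability of the normal law: [n] independent copies at scale [r] amount to one at scale [r]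
    times the square root of [n], which is why Gaussian replacements sum up exactly. *)
Lemma iter_gauss_op s (r : R) n Phi x : 0 <= r -> bmf (Phi : B -> R) ->
  iter n (gauss_op s r) Phi x = gauss_op s (Num.sqrt n%:R * r) Phi x.
Proof.
move=> r0 bP; elim: n x => [|n IH] x.
  rewrite sqrtr0 mul0r /gauss_op /conv_op.
  by under eq_Rintegral do rewrite scale0r addr0; rewrite (Rint_cst (gauss_vec s)).
rewrite iterS (_ : iter n _ Phi = gauss_op s (Num.sqrt n%:R * r) Phi); last exact/funext.
rewrite gauss_opD//; congr (gauss_op s _ Phi x).
rewrite exprMn sqr_sqrtr// (_ : r ^+ 2 + n%:R * r ^+ 2 = n.+1%:R * r ^+ 2); last by rewrite -natr1; ring.
by rewrite sqrtrM// sqrtr_sqr ger0_norm.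
Qed.

(** Expresses the limit law, with one block of generators per sample, in the operator form in which
    the replacement argument delivers it. *)
Lemma gauss_vec_cat s1 s2 (a b : R) Phi : bmf (Phi : B -> R) ->
  \int[gauss_vec (map (fun v => a *: v) s1 ++ map (fun v => b *: v) s2)]_v Phi v =
  gauss_op s1 a (gauss_op s2 b Phi) 0.
Proof.
move=> bP.
have scl (c : R) s x : \int[gauss_vec (map (fun v => c *: v) s)]_v Phi (x + v) = gauss_op s c Phi x.
  elim: s x => [|e s IH] x.
    by rewrite gauss_op_nil// gauss_vec_nil ?addr0//; exact: (bmf_shifted meas_coords_id x bP).
  rewrite /= gauss_vec_cons; last exact: (bmf_shifted meas_coords_id x bP).
  rewrite gauss_op_cons//; apply: eq_Rintegral => z _.
  by rewrite -IH; apply: eq_Rintegral => v _; rewrite addrA.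
suff : forall x, \int[gauss_vec (map (fun v => a *: v) s1 ++ map (fun v => b *: v) s2)]_v Phi (x + v)
    = gauss_op s1 a (gauss_op s2 b Phi) x.
  by move=> /(_ 0) <-; apply: eq_Rintegral => v _; rewrite add0r.
elim: s1 => [|e s IH] x.
  by rewrite /= scl gauss_op_nil//; exact: gauss_op_bmf.
rewrite /= gauss_vec_cons; last exact: (bmf_shifted meas_coords_id x bP).
rewrite gauss_op_cons//; last exact: gauss_op_bmf.
apply: eq_Rintegral => z _; rewrite -IH; apply: eq_Rintegral => v _.
by rewrite addrA.
Qed.

End gaussian_vectors.

(** * Lindeberg's replacement *)

Section taylor_class.
Context {R : realType} {l : nat}.
Local Notation rV := 'rV[R]_l.
Local Notation B := (borel rV).
Local Notation N01 := (@N01 R).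
Implicit Types (Phi : rV -> R).

Definition norm1 (h : rV) : R := \sum_i `|h 0 i|.

Lemma norm1_ge0 h : 0 <= norm1 h.
Proof. by apply: sumr_ge0. Qed.

Lemma norm1Z (r : R) h : norm1 (r *: h) = `|r| * norm1 h.
Proof. by rewrite /norm1 mulr_sumr; apply: eq_bigr => i _; rewrite mxE normrM. Qed.

(** [D] stands for the gradient and [H] for half the Hessian at [x]. Only this expansion is ever
    used, so no derivative has to be formed. *)
Definition taylor3 (K : R) (Phi : rV -> R) (x : rV) (D : 'I_l -> R) (H : 'I_l -> 'I_l -> R) :=
  [/\ (forall i, `|D i| <= K), (forall i j, `|H i j| <= K) &
      forall h, `|Phi (x + h) - Phi x - \sum_i D i * h 0 i
                 - \sum_i \sum_j H i j * (h 0 i * h 0 j)| <= K * norm1 h ^+ 3].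

Definition smooth3 (Phi : rV -> R) := exists2 K, 0 <= K &
  forall x, `|Phi x| <= K /\ exists D H, taylor3 K Phi x D H.

Section moments.
Context d (U : measurableType d) (mu : probability U R) (zeta : U -> rV) (V : 'M[R]_l) (M3 : R).

Definition has_moments :=
  [/\ meas_coords zeta,
      (forall i, mu.-integrable setT (fun u => (zeta u 0 i)%:E) /\ \int[mu]_u zeta u 0 i = 0),
      (forall i j, mu.-integrable setT (fun u => (zeta u 0 i * zeta u 0 j)%:E) /\
         \int[mu]_u (zeta u 0 i * zeta u 0 j) = V i j) &
      mu.-integrable setT (fun u => (norm1 (zeta u) ^+ 3)%:E) /\
         \int[mu]_u (norm1 (zeta u) ^+ 3) <= M3].

Lemma integrable_addR (F G : U -> R) : mu.-integrable setT (EFin \o F) ->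
  mu.-integrable setT (EFin \o G) -> mu.-integrable setT (EFin \o (fun u => F u + G u)).
Proof.
move=> iF iG; rewrite (_ : EFin \o _ = (EFin \o F) \+ (EFin \o G))%E//.
exact: integrableD.
Qed.

Lemma integrable_sumR (I : Type) (s : seq I) (F : I -> U -> R) :
  (forall i, mu.-integrable setT (EFin \o F i)) ->
  mu.-integrable setT (EFin \o (fun u => \sum_(i <- s) F i u)) /\
  \int[mu]_u (\sum_(i <- s) F i u) = \sum_(i <- s) \int[mu]_u F i u.
Proof.
move=> iF; elim: s => [|i s [IH1 IH2]].
  split; last by rewrite big_nil; under eq_Rintegral do rewrite big_nil; rewrite Rint_cst.
  rewrite (_ : (fun u => _) = (fun _ => 0 : R)); last by apply/funext => u; rewrite big_nil.
  exact: bmf_int (bmf_cst _).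
split.
  rewrite (_ : (fun u => _) = (fun u => F i u + \sum_(i <- s) F i u)); last first.
    by apply/funext => u /=; rewrite big_cons.
  exact: integrable_addR.
rewrite big_cons -IH2 -RintegralD//.
by apply: eq_Rintegral => u _; rewrite big_cons.
Qed.

Lemma integrable_scaleR (r : R) (F : U -> R) : mu.-integrable setT (EFin \o F) ->
  mu.-integrable setT (EFin \o (fun u => r * F u)).
Proof.
move=> iF; rewrite (_ : EFin \o _ = fun u => (r%:E * (EFin \o F) u)%E)//.
exact: integrableZl.
Qed.

Lemma integrable_subR (F G : U -> R) : mu.-integrable setT (EFin \o F) ->
  mu.-integrable setT (EFin \o G) -> mu.-integrable setT (EFin \o (fun u => F u - G u)).
Proof.
move=> iF iG; rewrite (_ : EFin \o _ = (EFin \o F) \- (EFin \o G))%E//.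
exact: integrableB.
Qed.

(** Integrating the expansion kills the linear term, the mean being zero, turns the quadratic term
    into a pairing of [H] with [V], and leaves a remainder of order [r ^+ 3]. *)
Lemma conv_op_taylor (K r : R) Phi x D H : has_moments -> 0 <= r -> 0 <= K -> bmf (Phi : B -> R) ->
  taylor3 K Phi x D H ->
  `|conv_op mu (fun u => r *: zeta u) Phi x - Phi x - r ^+ 2 * \sum_i \sum_j H i j * V i j|
   <= K * (r ^+ 3 * M3).
Proof.
move=> [mz m1 m2 [i3 m3]] r0 K0 bP [DK HK TK].
have mrz : meas_coords (fun u => r *: zeta u) by apply: meas_coordsZ => //; exact: measurable_cst.
have iP := bmf_int mu (bmf_shifted mrz x bP).
have [iD eD] := @integrable_sumR _ (enum 'I_l) (fun i u => (r * D i) * zeta u 0 i)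
  (fun i => integrable_scaleR (r * D i) (m1 i).1).
have [iH eH] := @integrable_sumR _ (enum {: 'I_l * 'I_l}) (fun ij u => (r ^+ 2 * H ij.1 ij.2) * (zeta u 0 ij.1 * zeta u 0 ij.2))
  (fun ij => integrable_scaleR _ (m2 ij.1 ij.2).1).
have iC : mu.-integrable setT (EFin \o (fun _ : U => Phi x)) by exact: bmf_int (bmf_cst _).
pose rem u := Phi (x + r *: zeta u) - Phi x - \sum_(i <- enum 'I_l) (r * D i) * zeta u 0 i
  - \sum_(ij <- enum {: 'I_l * 'I_l}) (r ^+ 2 * H ij.1 ij.2) * (zeta u 0 ij.1 * zeta u 0 ij.2).
have i_rem : mu.-integrable setT (EFin \o rem).
  by do 3 (apply: integrable_subR => //).
have eD0 : \int[mu]_u (\sum_(i <- enum 'I_l) (r * D i) * zeta u 0 i) = 0.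
  rewrite eD big1_seq// => i _; rewrite RintegralZl//; last exact: (m1 i).1.
  by rewrite (m1 i).2 mulr0.
have eH0 : \int[mu]_u (\sum_(ij <- enum {: 'I_l * 'I_l}) (r ^+ 2 * H ij.1 ij.2) * (zeta u 0 ij.1 * zeta u 0 ij.2))
   = r ^+ 2 * \sum_i \sum_j H i j * V i j.
  rewrite eH pair_big/= mulr_sumr big_enum/=; apply: eq_bigr => ij _.
  rewrite RintegralZl//; last exact: (m2 _ _).1.
  by rewrite (m2 _ _).2 mulrA.
have -> : conv_op mu (fun u => r *: zeta u) Phi x - Phi x - r ^+ 2 * \sum_i \sum_j H i j * V i j
  = \int[mu]_u rem u.
  rewrite /rem !RintegralB//; try (by do 3 (apply: integrable_subR => //)).
  by rewrite eD0 eH0 Rint_cst subr0.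
apply: le_trans (le_normr_Rintegral measurableT i_rem) _.
have i_rhs := integrable_scaleR (K * r ^+ 3) i3.
apply: (@le_trans _ _ (\int[mu]_u ((K * r ^+ 3) * norm1 (zeta u) ^+ 3))); last first.
  rewrite RintegralZl// -mulrA ler_wpM2l// ler_wpM2l// exprn_ge0//.
apply: le_Rintegral => //.
  by have := integrable_norm i_rem.
move=> u _; have := TK (r *: zeta u).
rewrite norm1Z (ger0_norm r0) exprMn mulrA.
congr (`|_ - _ - _ - _| <= _).
  by rewrite big_enum/=; apply: eq_bigr => i _; rewrite mxE; ring.
rewrite pair_big/= big_enum/=; apply: eq_bigr => i _; rewrite !mxE; ring.
Qed.

End moments.

(** The terms of order below three depend on the law only through its mean and [V], so they cancel
    between two laws that share them. *)
Lemma lindeberg_step d (U : measurableType d) (mu : probability U R) (zeta : U -> rV)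
    d' (W : measurableType d') (nu : probability W R) (theta : W -> rV) (V : 'M[R]_l)
    (M3 M3' : R) Phi : has_moments mu zeta V M3 -> has_moments nu theta V M3' ->
  bmf (Phi : B -> R) -> smooth3 Phi ->
  exists2 K, 0 <= K & forall r x, 0 <= r ->
    `|conv_op mu (fun u => r *: zeta u) Phi x - conv_op nu (fun w => r *: theta w) Phi x|
      <= K * r ^+ 3.
Proof.
move=> hm hn bP [K K0 PK].
have M30 : 0 <= M3.
  by have [_ _ _ [_]] := hm; apply: le_trans; apply: Rint_ge0 => u; rewrite exprn_ge0// norm1_ge0.
have M30' : 0 <= M3'.
  by have [_ _ _ [_]] := hn; apply: le_trans; apply: Rint_ge0 => u; rewrite exprn_ge0// norm1_ge0.
exists (K * (M3 + M3')); first by rewrite mulr_ge0// addr_ge0.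
move=> r x r0; have [_ [D [H T3]]] := PK x.
have h1 := conv_op_taylor hm r0 K0 bP T3.
have h2 := conv_op_taylor hn r0 K0 bP T3.
set X := conv_op mu _ _ _ in h1 *; set Y := conv_op nu _ _ _ in h2 *.
set q := r ^+ 2 * _ in h1 h2.
rewrite (_ : X - Y = (X - Phi x - q) - (Y - Phi x - q)); last by ring.
apply: le_trans (ler_normB _ _) _; apply: le_trans (lerD h1 h2) _.
by rewrite le_eqVlt; apply/orP; left; apply/eqP; ring.
Qed.

End taylor_class.

(** * Third moments of bounded and of Gaussian vectors *)

Section moments_instances.
Context {R : realType} {l : nat}.
Local Notation rV := 'rV[R]_l.
Local Notation B := (borel rV).
Local Notation N01 := (@N01 R).
Implicit Types (Phi : rV -> R).

Lemma bounded_has_moments d (U : measurableType d) (mu : probability U R) (zeta : U -> rV)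
    (V : 'M[R]_l) : (forall i, bmf (fun u => zeta u 0 i)) ->
  (forall i, \int[mu]_u zeta u 0 i = 0) ->
  (forall i j, \int[mu]_u (zeta u 0 i * zeta u 0 j) = V i j) ->
  exists M3, has_moments mu zeta V M3.
Proof.
move=> bz z0 zV; exists (\int[mu]_u (norm1 (zeta u) ^+ 3)); split.
- by move=> i; exact: bmf_meas (bz i).
- by move=> i; split => //; exact: bmf_int (bz i).
- by move=> i j; split => //; exact: bmf_int (bmfM (bz i) (bz j)).
- split => //; apply: (bmf_int mu (f := fun u => norm1 (zeta u) ^+ 3)).
  by apply: bmfX; apply: bmf_sum => i; exact: bmf_norm.
Qed.

(** Each term costs a factor 4, since [4 * (a ^+ 3 + b ^+ 3) - (a + b) ^+ 3] equals
    [3 * (a + b) * (a - b) ^+ 2]. *)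
Lemma cube_sum_le (s : seq R) : {in s, forall x, 0 <= x} ->
  (\sum_(x <- s) x) ^+ 3 <= 4 ^+ size s * \sum_(x <- s) x ^+ 3.
Proof.
elim: s => [|a s IH] h; first by rewrite !big_nil mulr0 expr0n.
have a0 : 0 <= a by apply: h; exact: mem_head.
have h' : {in s, forall x, 0 <= x} by move=> x xs; apply: h; rewrite in_cons xs orbT.
have S0 : 0 <= \sum_(x <- s) x by rewrite big_seq; apply: sumr_ge0.
have S3 : 0 <= \sum_(x <- s) x ^+ 3.
  by rewrite big_seq; apply: sumr_ge0 => x xs; rewrite exprn_ge0// h'.
rewrite !big_cons /= [4 ^+ _]exprS.
have p4 : 1 <= 4 ^+ size s :> R by rewrite exprn_ege1// ler1n.
have c3 : (a + \sum_(x <- s) x) ^+ 3 <= 4 * (a ^+ 3 + (\sum_(x <- s) x) ^+ 3).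
  move: (\sum_(x <- s) x) S0 => b b0.
  have : 0 <= 3 * (a + b) * (a - b) ^+ 2 by rewrite mulr_ge0 ?sqr_ge0// mulr_ge0// addr_ge0.
  by rewrite (_ : 3 * (a + b) * (a - b) ^+ 2 = 4 * (a ^+ 3 + b ^+ 3) - (a + b) ^+ 3); [lra|ring].
apply: le_trans c3 _; rewrite -mulrA ler_pM2l// mulrDr; apply: lerD; last exact: IH.
by apply: ler_peMl => //; exact: exprn_ge0.
Qed.

Lemma norm1_cube (h : rV) : norm1 h ^+ 3 <= 4 ^+ l * \sum_i `|h 0 i| ^+ 3.
Proof.
have := @cube_sum_le [seq `|h 0 i| | i <- enum 'I_l] _.
rewrite size_map size_enum_ord.
rewrite (_ : \sum_(x <- _) x = norm1 h); last by rewrite big_map big_enum.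
rewrite (_ : \sum_(x <- _) x ^+ 3 = \sum_i `|h 0 i| ^+ 3); last by rewrite big_map big_enum.
apply.
by move=> x /mapP[i _ ->].
Qed.

(** Extends [gauss_vec_dot] from bounded functions to quartic growth: the linear form and the scaled
    normal variable have the same law on Borel sets, so integrability and integrals transfer. *)
Lemma gauss_vec_dot_integral u (s : seq rV) (F : R -> R) (K : R) :
  measurable_fun setT F -> (forall z, `|F z| <= K * (1 + z ^+ 4)) ->
  (gauss_vec s).-integrable setT (fun v => (F (dotv u v))%:E) /\
  \int[gauss_vec s]_v F (dotv u v) =
  \int[N01]_z F (Num.sqrt (\sum_(a <- s) dotv u a ^+ 2) * z).
Proof.
move=> mF FK; set g := Num.sqrt _.
have mg : measurable_fun setT (fun z : measurableTypeR R => (g * z : measurableTypeR R)) by exact: measurable_funM.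
have md : measurable_fun setT (fun v : B => (dotv u v : measurableTypeR R)) := measurable_dotv u.
pose pf : {measure set (measurableTypeR R) -> \bar R} :=
  measure_function_pushforward__canonical__measure_function_Measure (gauss_vec s) md.
pose pg : {measure set (measurableTypeR R) -> \bar R} :=
  measure_function_pushforward__canonical__measure_function_Measure N01 mg.
have pfg A : measurable A -> pf A = pg A.
  move=> mA; rewrite /pf /pg /= /pushforward.
  have := gauss_vec_normal s u mA; rewrite gram_mx_form => h.
  apply: etrans h _; rewrite -[X in centered_normal1 X](@sqr_sqrtr _ (\sum_(a <- s) dotv u a ^+ 2)) ?centered_normal1E//.
  by apply: sumr_ge0 => b _; exact: sqr_ge0.
have iN : N01.-integrable setT (EFin \o (fun z : R => F (g * z))).
  apply: (@gauss_integrable _ _ (K * (1 + g ^+ 4))); first exact: (measurableT_comp mF).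
  move=> z; apply: le_trans (FK _) _; rewrite -mulrA; apply: ler_wpM2l.
    by have := le_trans (normr_ge0 _) (FK 0); rewrite expr0n addr0 mulr1.
  rewrite exprMn.
  have z4 : 0 <= z ^+ 4 by rewrite -[4%N]/(2 * 2)%N exprM sqr_ge0.
  have g4 : 0 <= g ^+ 4 by rewrite -[4%N]/(2 * 2)%N exprM sqr_ge0.
  move: (g ^+ 4) (z ^+ 4) g4 z4 => p q p0 q0; lra.
have mFE : measurable_fun setT (fun x : measurableTypeR R => (F x)%:E) by apply/measurable_EFinP.
have iv : (gauss_vec s).-integrable setT (fun v => (F (dotv u v))%:E).
  apply/integrableP; split; first exact: (measurableT_comp mFE md).
  have -> : (\int[gauss_vec s]_x `|(F (dotv u x))%:E| = \int[N01]_z `|(F (g * z))%:E|)%E.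
    transitivity (\int[pf]_x `|(F x)%:E|)%E.
      by rewrite ge0_integral_pushforward//; exact: measurableT_comp.
    transitivity (\int[pg]_x `|(F x)%:E|)%E.
      by apply: eq_measure_integral => // A mA _; exact: pfg.
    by rewrite ge0_integral_pushforward//; exact: measurableT_comp.
  by case/integrableP: iN.
split => //; rewrite /Rintegral; congr fine.
transitivity (\int[pf]_x (F x)%:E)%E; first by rewrite integral_pushforward.
transitivity (\int[pg]_x (F x)%:E)%E.
  by apply: eq_measure_integral => // A mA _; exact: pfg.
by rewrite integral_pushforward.
Qed.

Let e_ (i : 'I_l) : rV := delta_mx 0 i.

Lemma dotv_delta i (v : rV) : dotv (e_ i) v = v 0 i.
Proof.
rewrite /dotv (bigD1 i)//= mxE !eqxx mul1r big1 ?addr0// => j ji.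
by rewrite mxE eqxx (negbTE ji) mul0r.
Qed.

Lemma dotvDl (u w v : rV) : dotv (u + w) v = dotv u v + dotv w v.
Proof. by rewrite /dotv -big_split; apply: eq_bigr => i _; rewrite mxE mulrDl. Qed.

Lemma sqr_growth (z : R) : z ^+ 2 <= 1 + z ^+ 4.
Proof.
have : 0 <= (z ^+ 2 - 1) ^+ 2 by exact: sqr_ge0.
have : z ^+ 4 = (z ^+ 2) ^+ 2 by rewrite -exprM.
by have := sqr_ge0 z; nra.
Qed.

Lemma norm_growth (z : R) : `|z| <= 1 + z ^+ 4.
Proof.
have : 0 <= (`|z| - 1) ^+ 2 by exact: sqr_ge0.
have : `|z| ^+ 2 = z ^+ 2 by rewrite real_normK// num_real.
have : 0 <= (z ^+ 2 - 1) ^+ 2 by exact: sqr_ge0.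
have : z ^+ 4 = (z ^+ 2) ^+ 2 by rewrite -exprM.
by have := normr_ge0 z; nra.
Qed.

Lemma cube_growth (z : R) : `|z| ^+ 3 <= 1 + z ^+ 4.
Proof.
have -> : z ^+ 4 = `|z| ^+ 4.
  by rewrite -normrX ger0_norm// -[4%N]/(2 * 2)%N exprM sqr_ge0.
move: (`|z|) (normr_ge0 z) => y y0.
have [y1|y1] := leP y 1.
  have : y ^+ 3 <= 1 by exact: exprn_ile1.
  have : 0 <= y ^+ 4 by exact: exprn_ge0.
  lra.
have : y ^+ 3 <= y ^+ 4 by rewrite ler_weXn2l// ltW.
lra.
Qed.

Lemma gauss_vec_moments (s : seq rV) :
  exists M3, has_moments (gauss_vec s) (fun v : B => (v : rV)) (gram_mx s) M3.
Proof.
have g0 (u : rV) : 0 <= \sum_(a <- s) dotv u a ^+ 2 by apply: sumr_ge0 => b _; exact: sqr_ge0.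
have mid : measurable_fun setT (fun z : measurableTypeR R => (z : R)) by [].
have iz : N01.-integrable setT (EFin \o (fun z : R => z)).
  by apply: (@gauss_integrable _ _ 1) => // z; rewrite mul1r norm_growth.
have iz2 : N01.-integrable setT (EFin \o (fun z : R => z ^+ 2)).
  apply: (@gauss_integrable _ _ 1); first exact: measurable_funX.
  by move=> z; rewrite mul1r ger0_norm ?sqr_ge0// sqr_growth.
have first (u : rV) : (gauss_vec s).-integrable setT (fun v => (dotv u v)%:E) /\
    \int[gauss_vec s]_v dotv u v = 0.
  have [|i e] := @gauss_vec_dot_integral u s (fun z => z) 1 mid.
    by move=> z; rewrite mul1r norm_growth.
  split => //; rewrite e; apply: etrans (RintegralZl _ measurableT iz) _.
  by rewrite gauss_moment1 mulr0.
have second (u : rV) : (gauss_vec s).-integrable setT (fun v => (dotv u v ^+ 2)%:E) /\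
    \int[gauss_vec s]_v (dotv u v ^+ 2) = \sum_(a <- s) dotv u a ^+ 2.
  have [| |i e] := @gauss_vec_dot_integral u s (fun z => z ^+ 2) 1.
  - exact: measurable_funX.
  - by move=> z; rewrite mul1r ger0_norm ?sqr_ge0// sqr_growth.
  split => //; rewrite e.
  transitivity (\int[N01]_z ((\sum_(a <- s) dotv u a ^+ 2) * z ^+ 2)).
    by apply: eq_Rintegral => z _; rewrite exprMn sqr_sqrtr ?g0.
  by apply: etrans (RintegralZl _ measurableT iz2) _; rewrite gauss_moment2 mulr1.
have third i : (gauss_vec s).-integrable setT (fun v : B => (`|(v : rV) 0 i| ^+ 3)%:E).
  have [| |h _] := @gauss_vec_dot_integral (e_ i) s (fun z => `|z| ^+ 3) 1.
  - by apply: measurable_funX; exact: normr_measurable.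
  - by move=> z; rewrite mul1r normrX normr_id cube_growth.
  by under eq_fun do rewrite -dotv_delta.
exists (\int[gauss_vec s]_v (norm1 (v : rV) ^+ 3)); split.
- exact: meas_coords_id.
- move=> i; have [h1 h2] := first (e_ i); split.
    by under eq_fun do rewrite -dotv_delta.
  by under eq_Rintegral do rewrite -dotv_delta.
- move=> i j.
  have [a1 a2] := second (e_ i); have [b1 b2] := second (e_ j); have [c1 c2] := second (e_ i + e_ j).
  (* Polarization: linear forms give second moments of single directions only, and mixed moments are
     recovered from [e_ i + e_ j]. *)
  have E v : (v : rV) 0 i * v 0 j = 2^-1 * (dotv (e_ i + e_ j) v ^+ 2 - dotv (e_ i) v ^+ 2 - dotv (e_ j) v ^+ 2).
    by rewrite dotvDl !dotv_delta; field.
  have ii := integrable_subR (integrable_subR c1 a1) b1.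
  split.
    under eq_fun do rewrite E.
    exact: (integrable_scaleR 2^-1 ii).
  under eq_Rintegral do rewrite E.
  apply: etrans (RintegralZl _ measurableT ii) _.
  rewrite RintegralB//; last exact: integrable_subR.
  rewrite RintegralB// a2 b2 c2 gram_mxE -!sumrB mulr_sumr; apply: eq_bigr => a _.
  by rewrite dotvDl !dotv_delta; field.
- split => //.
  have [i3 _] := @integrable_sumR _ _ _ (gauss_vec s) _ (enum 'I_l) (fun i (v : B) => `|(v : rV) 0 i| ^+ 3) third.
  have i3' := integrable_scaleR (4 ^+ l) i3.
  apply: le_integrable i3' => //.
    apply/measurable_EFinP; apply: measurable_funX.
    apply: (@measurable_sum _ _ _ _ _ _ (fun i (v : B) => `|(v : rV) 0 i|)) => i.
    by apply: measurableT_comp => //; exact: measurable_coord.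
  move=> v _ /=; rewrite lee_fin (ger0_norm (exprn_ge0 3 (norm1_ge0 v))).
  apply: le_trans (norm1_cube v) _; rewrite big_enum/=; exact: ler_norm.
Qed.

End moments_instances.

(** * Convergence in law from smooth test functions *)

Section spline.
Context {R : realType}.

Definition pcube (x : R) : R := Num.max x 0 ^+ 3.
Definition psq (x : R) : R := Num.max x 0 ^+ 2.
Definition plin (x : R) : R := Num.max x 0.

(** The derivatives of [pcube] are [3 * psq] and [6 * plin], and the latter is Lipschitz with
    constant 6, whence the constant 1. The proof checks the four sign patterns of [x] and
    [x + h]. *)
Lemma pcube_taylor (x h : R) :
  `|pcube (x + h) - pcube x - 3 * psq x * h - 3 * plin x * h ^+ 2| <= `|h| ^+ 3.
Proof.
rewrite /pcube /psq /plin.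
have h3 : `|h| ^+ 3 = Num.max (h ^+ 3) (- h ^+ 3).
  rewrite -normrX; case: (ger0P (h ^+ 3)) => hh; [rewrite max_l//|rewrite max_r//]; lra.
rewrite ler_norml.
have [x0|x0] := lerP x 0; have [y0|y0] := lerP (x + h) 0.
- by rewrite h3 !expr0n /= !mulr0 !mul0r !subr0 oppr_le0 andbb le_max; case: (lerP 0 (h ^+ 3)) => //= hh; lra.
- have hp : 0 < h by lra.
  rewrite (gtr0_norm hp) !expr0n /= !mulr0 !mul0r !subr0; apply/andP; split.
    by have : 0 <= h ^+ 3; [exact: exprn_ge0 (ltW hp)|]; have : 0 <= (x + h) ^+ 3; [exact: exprn_ge0 (ltW y0)|]; lra.
  by apply: lerXn2r; rewrite ?nnegrE; lra.
- have hn : h < 0 by lra.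
  rewrite (ltr0_norm hn) !expr0n /= sub0r.
  have k0 : 0 <= - h - x by lra.
  have e : - x ^+ 3 - 3 * x ^+ 2 * h - 3 * x * h ^+ 2 = (- h - x) ^+ 3 - (- h) ^+ 3 by ring.
  rewrite e.
  have : 0 <= (- h) ^+ 3 by apply: exprn_ge0; lra.
  have : (- h - x) ^+ 3 <= (- h) ^+ 3 by apply: lerXn2r; rewrite ?nnegrE; lra.
  have : 0 <= (- h - x) ^+ 3 by exact: exprn_ge0.
  lra.
- rewrite (_ : (x + h) ^+ 3 - x ^+ 3 - 3 * x ^+ 2 * h - 3 * x * h ^+ 2 = h ^+ 3); last by ring.
  by rewrite -ler_norml normrX.
Qed.

(** A third difference of [pcube]: the integral of the quadratic B-spline, that is a twice
    differentiable step rising from 0 at 0 to 1 at 3. *)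
Definition spline_step (x : R) : R :=
  6^-1 * (pcube x - 3 * pcube (x - 1) + 3 * pcube (x - 2) - pcube (x - 3)).

(* The cubic B-spline, supported in [0, 4]. *)
Definition bspline (x : R) : R := spline_step x - spline_step (x - 1).

Let maxE (x : R) : (0 <= x /\ Num.max x 0 = x) \/ (x <= 0 /\ Num.max x 0 = 0).
Proof. by case: (lerP x 0) => h; [right|left; split => //; exact: ltW]. Qed.

Lemma spline_step_lo (x : R) : x <= 0 -> spline_step x = 0.
Proof.
move=> x0; rewrite /spline_step /pcube.
by rewrite !max_r; try lra; rewrite !expr0n /=; ring.
Qed.

Lemma spline_step_hi (x : R) : 3 <= x -> spline_step x = 1.
Proof.
move=> x0; rewrite /spline_step /pcube.
by rewrite !max_l; try lra; field.
Qed.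

Lemma bspline_lo (x : R) : x <= 0 -> bspline x = 0.
Proof. by move=> x0; rewrite /bspline !spline_step_lo ?subr0//; lra. Qed.

Lemma bspline_hi (x : R) : 4 <= x -> bspline x = 0.
Proof. by move=> x0; rewrite /bspline !spline_step_hi ?subrr//; lra. Qed.

Lemma bspline_ge0 (x : R) : 0 <= bspline x.
Proof.
have [x0|x0] := leP x 0; first by rewrite bspline_lo.
have [x4|x4] := leP 4 x; first by rewrite bspline_hi.
rewrite /bspline /spline_step /pcube -mulrBr mulr_ge0 ?invr_ge0//.
have e1 : Num.max x 0 = x by rewrite max_l// ltW.
have e5 : Num.max (x - 1 - 3) 0 = 0 by rewrite max_r//; lra.
rewrite e1 e5 (_ : x - 1 - 1 = x - 2); last by ring.
rewrite (_ : x - 1 - 2 = x - 3); last by ring.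
have [x1|x1] := leP x 1.
  rewrite !max_r; try lra; rewrite !expr0n /=.
  have : 0 <= x ^+ 3 by apply: exprn_ge0; lra.
  by lra.
have [x2|x2] := leP x 2.
  rewrite (@max_l _ _ (x - 1)) ?(@max_r _ _ (x - 2)) ?(@max_r _ _ (x - 3)); try lra; rewrite !expr0n /=.
  have : 0 <= x - 1 by lra.
  have : x - 1 <= 1 by lra.
  rewrite (_ : x = (x - 1) + 1); last by ring.
  rewrite addrK; move: (x - 1) => s s1 s0.
  have : s ^+ 3 <= s ^+ 2 by rewrite ler_wiXn2l.
  have : 0 <= s ^+ 3 by apply: exprn_ge0.
  by rewrite (_ : (s + 1) ^+ 3 = s ^+ 3 + 3 * s ^+ 2 + 3 * s + 1); [lra|ring].
have [x3|x3] := leP x 3.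
  rewrite (@max_l _ _ (x - 1)) ?(@max_l _ _ (x - 2)) ?(@max_r _ _ (x - 3)); try lra; rewrite !expr0n /=.
  have : 0 <= x - 2 by lra.
  have : x - 2 <= 1 by lra.
  rewrite (_ : x = (x - 2) + 2); last by ring.
  rewrite addrK; move: (x - 2) => s s1 s0.
  have h : 0 <= (1 - s) * (1 + s - s ^+ 2).
    have : s ^+ 2 <= s by rewrite expr2; apply: ler_piMl.
    by move=> ?; apply: mulr_ge0; lra.
  suff -> : forall a : R, a = 0 -> (s + 2) ^+ 3 - 3 * (s + 2 - 1) ^+ 3 + 3 * s ^+ 3 - a - ((s + 2 - 1) ^+ 3 - 3 * s ^+ 3 + 3 * a - a) = 1 + 3 * ((1 - s) * (1 + s - s ^+ 2)).
  - by lra.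
  - by [].
  - by move=> a ->; ring.
rewrite !max_l; try lra.
have : 0 <= (4 - x) ^+ 3 by apply: exprn_ge0; lra.
by rewrite !expr0n /=; lra.
Qed.

Lemma spline_step_mono (x : R) (n : nat) : spline_step (x - n%:R) <= spline_step x.
Proof.
elim: n => [|n IH]; first by rewrite subr0.
apply: le_trans IH; rewrite -subr_ge0.
have := bspline_ge0 (x - n%:R); rewrite /bspline.
by rewrite -natr1 (_ : x - (n%:R + 1) = x - n%:R - 1); last by ring.
Qed.

(** A step decreases under shifts to the left by integers, its increments being values of [bspline];
    shifting far enough reaches the flat parts 0 and 1. *)
Lemma spline_step01 (x : R) : 0 <= spline_step x <= 1.
Proof.
apply/andP; split.
  rewrite -(@spline_step_lo (x - (Num.truncn `|x|).+1%:R)); first exact: spline_step_mono.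
  by have := truncnS_gt `|x|; have := ler_norm x; lra.
rewrite -(@spline_step_hi (x + (Num.truncn `|3 - x|).+1%:R)); last first.
  by have := truncnS_gt `|3 - x|; have := ler_norm (3 - x); lra.
by rewrite -[x in leLHS](addrK ((Num.truncn `|3 - x|).+1%:R)); exact: spline_step_mono.
Qed.

Lemma bspline_sum (x : R) (M : nat) :
  \sum_(k < M + M) bspline (x + M%:R - k%:R) = spline_step (x + M%:R) - spline_step (x - M%:R).
Proof.
suff h n : \sum_(k < n) bspline (x + M%:R - k%:R) = spline_step (x + M%:R) - spline_step (x + M%:R - n%:R).
  by rewrite h natrD opprD !addrA addrK.
elim: n => [|n IH]; first by rewrite big_ord0 subr0 subrr.
rewrite big_ord_recr /= IH /bspline -natr1 opprD !addrA.
by ring.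
Qed.

Definition smooth1 (f : R -> R) := exists2 K, 0 <= K &
  forall x, `|f x| <= K /\ exists D H, [/\ `|D| <= K, `|H| <= K &
    forall h, `|f (x + h) - f x - D * h - H * h ^+ 2| <= K * `|h| ^+ 3].

(** The fourth difference over 6. It produces [bspline] from [pcube] and, applied to [psq] and
    [plin], its Taylor coefficients up to the factor 3. *)
Let cDs (F : R -> R) x := 6^-1 * (F x - 4 * F (x - 1) + 6 * F (x - 2) - 4 * F (x - 3) + F (x - 4)).

Let bsplineE x : bspline x = cDs pcube x.
Proof.
rewrite /bspline /spline_step /cDs.
rewrite (_ : x - 1 - 1 = x - 2); last by ring.
rewrite (_ : x - 1 - 2 = x - 3); last by ring.
rewrite (_ : x - 1 - 3 = x - 4); last by ring.
by ring.
Qed.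

(** Fourth differences annihilate polynomials of degree below four, so only [x] in ]0, 4[ matters.
    There all values of [F] are at most 16, and the coefficients sum to 16 in absolute value: 256 /
    6 is below 43. *)
Let cDs_bound (F : R -> R) (x : R) : (F = psq \/ F = plin) -> `|cDs F x| <= 43.
Proof.
move=> FE.
have [x0|x0] := leP x 0.
  have F0 y : y <= 0 -> F y = 0.
    by case: FE => ->; rewrite /psq /plin => y0; rewrite max_r// expr0n.
  by rewrite /cDs !F0; try lra; rewrite !mulr0 !subr0 !addr0 !mulr0 normr0.
have [x4|x4] := leP 4 x.
  suff -> : cDs F x = 0 by rewrite normr0.
  rewrite /cDs; case: FE => ->; rewrite /psq /plin !max_l; try lra; by field.
have b y : y <= x -> 0 <= F y <= 16.
  move=> yx; case: FE => ->; rewrite /psq /plin.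
    case: (maxE y) => [[y0 ->]|[y0 ->]]; last by rewrite expr0n /= lexx ler0n.
    rewrite sqr_ge0 /=; nra.
  by case: (maxE y) => [[y0 ->]|[y0 ->]]; lra.
have /andP[a0 a1] := b x (lexx x).
have /andP[b0 b1] := b (x - 1) (ltac:(lra)).
have /andP[c0 c1] := b (x - 2) (ltac:(lra)).
have /andP[d0 d1] := b (x - 3) (ltac:(lra)).
have /andP[e0 e1] := b (x - 4) (ltac:(lra)).
rewrite /cDs ler_norml; apply/andP; split; lra.
Qed.

Lemma bspline_smooth : smooth1 bspline.
Proof.
(* 150 exceeds [3 * 43], which bounds both coefficients; the remainder only needs 16 / 6. *)
exists 150 => // x; split.
  rewrite ger0_norm ?bspline_ge0// /bspline.
  have := spline_step01 x; have := spline_step01 (x - 1); lra.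
exists (3 * cDs psq x), (3 * cDs plin x); split.
- rewrite normrM ger0_norm//; have := @cDs_bound psq x (or_introl erefl); lra.
- rewrite normrM ger0_norm//; have := @cDs_bound plin x (or_intror erefl); lra.
- move=> h; rewrite !bsplineE.
  pose rem y := pcube (y + h) - pcube y - 3 * psq y * h - 3 * plin y * h ^+ 2.
  have -> : cDs pcube (x + h) - cDs pcube x - 3 * cDs psq x * h - 3 * cDs plin x * h ^+ 2 = cDs rem x.
    rewrite /cDs /rem !(addrAC _ h); ring.
  have r y : `|rem y| <= `|h| ^+ 3 := pcube_taylor y h.
  have h3 : 0 <= `|h| ^+ 3 by exact: exprn_ge0.
  move: h3 (r x) (r (x - 1)) (r (x - 2)) (r (x - 3)) (r (x - 4)); rewrite /cDs !ler_norml.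
  move: (`|h| ^+ 3) (rem x) (rem (x - 1)) (rem (x - 2)) (rem (x - 3)) (rem (x - 4)) => w a b c d e.
  by lra.
Qed.

Lemma smooth1_affine (f : R -> R) (p q : R) : smooth1 f -> smooth1 (fun x => f (p * x + q)).
Proof.
move=> [K K0 fK]; exists (K * (1 + `|p|) ^+ 3).
  by rewrite mulr_ge0// exprn_ge0// addr_ge0.
have p1 : 1 <= 1 + `|p| by rewrite lerDl.
have P1 : 1 <= (1 + `|p|) ^+ 3 by rewrite exprn_ege1.
have Pp : `|p| <= (1 + `|p|) ^+ 3.
  by apply: le_trans (_ : 1 + `|p| <= _); [rewrite lerDr|rewrite -[leLHS]expr1 ler_weXn2l].
have Pp2 : `|p| ^+ 2 <= (1 + `|p|) ^+ 3.
  apply: le_trans (_ : (1 + `|p|) ^+ 2 <= _); last by rewrite ler_weXn2l.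
  by apply: lerXn2r; rewrite ?nnegrE ?lerDr ?addr_ge0.
have Pp3 : `|p| ^+ 3 <= (1 + `|p|) ^+ 3.
  by apply: lerXn2r; rewrite ?nnegrE ?lerDr ?addr_ge0.
move=> x; have [fb [D [H [DK HK T]]]] := fK (p * x + q); split.
  by apply: le_trans fb _; exact: ler_peMr.
exists (D * p), (H * p ^+ 2); split.
- by rewrite normrM; apply: ler_pM.
- by rewrite normrM normrX; apply: ler_pM => //; exact: exprn_ge0.
- move=> h; have := T (p * h).
  rewrite (_ : p * x + q + p * h = p * (x + h) + q); last by ring.
  rewrite (_ : D * (p * h) = D * p * h); last by ring.
  rewrite (_ : H * (p * h) ^+ 2 = H * p ^+ 2 * h ^+ 2); last by ring.
  move/le_trans; apply; rewrite normrM exprMn mulrA.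
  by apply: ler_wpM2r; [exact: exprn_ge0|exact: ler_wpM2l].
Qed.

End spline.

(** * Products of smooth test functions *)

Section smooth_products.
Context {R : realType} {l : nat}.
Local Notation rV := 'rV[R]_l.
Local Notation B := (borel rV).
Implicit Types (Phi Psi : rV -> R).

Lemma norm1_coord (h : rV) i : `|h 0 i| <= norm1 h.
Proof. by rewrite /norm1 (bigD1 i)//= lerDl sumr_ge0. Qed.

Lemma smooth3_cst (a : R) : smooth3 (fun _ : rV => a).
Proof.
exists `|a| => // x; split => //; exists (fun _ => 0), (fun _ _ => 0); split.
- by move=> i; rewrite normr0.
- by move=> i j; rewrite normr0.
move=> h; rewrite big1 => [|i _]; last by rewrite mul0r.
rewrite big1 => [|i _]; last by rewrite big1// => j _; rewrite mul0r.
by rewrite subrr !subr0 normr0 mulr_ge0// exprn_ge0// norm1_ge0.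
Qed.

Lemma smooth3_coord (f : R -> R) i : smooth1 f -> smooth3 (fun v : rV => f (v 0 i)).
Proof.
move=> [K K0 fK]; exists K => // x; have [fb [D [H [DK HK T]]]] := fK (x 0 i).
split => //; exists (fun j => D *+ (j == i)), (fun j k => H *+ ((j == i) && (k == i))); split.
- by move=> j; case: (j == i); rewrite ?mulr1n// mulr0n normr0.
- by move=> j k; case: (_ && _); rewrite ?mulr1n// mulr0n normr0.
move=> h; rewrite (bigD1 i)//= eqxx mulr1n big1 ?addr0 => [|j ji]; last by rewrite (negbTE ji) mulr0n mul0r.
rewrite (bigD1 i)//= [X in _ - (_ + X)]big1 ?addr0 => [|j ji]; last first.
  by rewrite big1// => k _; rewrite (negbTE ji) mulr0n mul0r.
rewrite (bigD1 i)//= eqxx mulr1n big1 ?addr0 => [|j ji]; last by rewrite (negbTE ji) mulr0n mul0r.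
rewrite mxE -expr2; apply: le_trans (T (h 0 i)) _; apply: ler_wpM2l => //.
by apply: lerXn2r; rewrite ?nnegrE ?norm1_ge0// norm1_coord.
Qed.

(** For [t <= 1] the remainder is a sum of seven products, each of order at least three in [t]. For
    [t > 1] the seven products of the left-hand side are bounded one by one, lower powers of [t]
    being at most the cube. Either way [8 * K ^+ 2] is enough. *)
Lemma taylor3_product_bound (K t a a' p q r b b' p' q' r' : R) : 0 <= K -> 0 <= t ->
  `|a| <= K -> `|a'| <= K -> `|b| <= K -> `|b'| <= K -> `|p| <= K * t -> `|p'| <= K * t ->
  `|q| <= K * t ^+ 2 -> `|q'| <= K * t ^+ 2 -> `|r| <= K * t ^+ 3 -> `|r'| <= K * t ^+ 3 ->
  a' = a + p + q + r -> b' = b + p' + q' + r' ->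
  `|a' * b' - a * b - (a * p' + b * p) - (a * q' + b * q + p * p')| <= 8 * K ^+ 2 * t ^+ 3.
Proof.
move=> K0 t0 aK a'K bK b'K pK p'K qK q'K rK r'K a'E b'E.
have mulN (x y X Y : R) : `|x| <= X -> `|y| <= Y -> `|x * y| <= X * Y.
  by move=> h1 h2; rewrite normrM; apply: ler_pM.
have [t1|t1] := leP t 1.
  have -> : a' * b' - a * b - (a * p' + b * p) - (a * q' + b * q + p * p') =
    r * b' + (a * r' + p * r' + q * r' + p * q' + q * p' + q * q').
    by rewrite a'E b'E; ring.
  have t3 : 0 <= t ^+ 3 by exact: exprn_ge0.
  have t43 : t ^+ 4 <= t ^+ 3 by rewrite ler_wiXn2l.
  have t53 : t ^+ 5 <= t ^+ 3 by rewrite ler_wiXn2l.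
  have K2 : 0 <= K ^+ 2 by exact: sqr_ge0.
  have h43 : K ^+ 2 * t ^+ 4 <= K ^+ 2 * t ^+ 3 by exact: ler_wpM2l.
  have h53 : K ^+ 2 * t ^+ 5 <= K ^+ 2 * t ^+ 3 by exact: ler_wpM2l.
  have h1 := mulN _ _ _ _ rK b'K.
  have h2 := mulN _ _ _ _ aK r'K.
  have h3 := mulN _ _ _ _ pK r'K.
  have h4 := mulN _ _ _ _ qK r'K.
  have h5 := mulN _ _ _ _ pK q'K.
  have h6 := mulN _ _ _ _ qK p'K.
  have h7 := mulN _ _ _ _ qK q'K.
  have e3 : K * t * (K * t ^+ 3) = K ^+ 2 * t ^+ 4 by ring.
  have e4 : K * t ^+ 2 * (K * t ^+ 3) = K ^+ 2 * t ^+ 5 by ring.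
  have e5 : K * t * (K * t ^+ 2) = K ^+ 2 * t ^+ 3 by ring.
  have e6 : K * t ^+ 2 * (K * t) = K ^+ 2 * t ^+ 3 by ring.
  have e7 : K * t ^+ 2 * (K * t ^+ 2) = K ^+ 2 * t ^+ 4 by ring.
  have e1 : K * t ^+ 3 * K = K ^+ 2 * t ^+ 3 by ring.
  have e2 : K * (K * t ^+ 3) = K ^+ 2 * t ^+ 3 by ring.
  rewrite e1 in h1; rewrite e2 in h2; rewrite e3 in h3; rewrite e4 in h4; rewrite e5 in h5; rewrite e6 in h6; rewrite e7 in h7.
  have g0 := ler_normD (r * b') (a * r' + p * r' + q * r' + p * q' + q * p' + q * q').
  have g1 := ler_normD (a * r' + p * r' + q * r' + p * q' + q * p') (q * q').
  have g2 := ler_normD (a * r' + p * r' + q * r' + p * q') (q * p').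
  have g3 := ler_normD (a * r' + p * r' + q * r') (p * q').
  have g4 := ler_normD (a * r' + p * r') (q * r').
  have g5 := ler_normD (a * r') (p * r').
  have K2t : 0 <= K ^+ 2 * t ^+ 3 by exact: mulr_ge0.
  lra.
have t3 : 1 <= t ^+ 3 by rewrite exprn_ege1// ltW.
have tt : t <= t ^+ 3 by rewrite -[leLHS]expr1 ler_weXn2l// ltW.
have t23 : t ^+ 2 <= t ^+ 3 by rewrite ler_weXn2l// ltW.
have K2 : 0 <= K ^+ 2 by exact: sqr_ge0.
have h1 := mulN _ _ _ _ a'K b'K.
have h2 := mulN _ _ _ _ aK bK.
have h3 := mulN _ _ _ _ aK p'K.
have h4 := mulN _ _ _ _ bK pK.
have h5 := mulN _ _ _ _ aK q'K.
have h6 := mulN _ _ _ _ bK qK.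
have h7 := mulN _ _ _ _ pK p'K.
rewrite mulrA -expr2 in h3; rewrite mulrA -expr2 in h4; rewrite mulrA -expr2 in h5; rewrite mulrA -expr2 in h6.
rewrite -expr2 in h1; rewrite -expr2 in h2; rewrite mulrACA -!expr2 in h7.
have k1 : K ^+ 2 * t <= K ^+ 2 * t ^+ 3 by exact: ler_wpM2l.
have k2 : K ^+ 2 * t ^+ 2 <= K ^+ 2 * t ^+ 3 by exact: ler_wpM2l.
have k3 : K ^+ 2 <= K ^+ 2 * t ^+ 3 by exact: ler_peMr.
have g1 := ler_normB (a' * b' - a * b - (a * p' + b * p)) (a * q' + b * q + p * p').
have g2 := ler_normB (a' * b' - a * b) (a * p' + b * p).
have g3 := ler_normB (a' * b') (a * b).
have g4 := ler_normD (a * p') (b * p).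
have g5 := ler_normD (a * q' + b * q) (p * p').
have g6 := ler_normD (a * q') (b * q).
lra.
Qed.

Lemma taylor3_weak K K' Phi x D H : K <= K' -> taylor3 K Phi x D H -> taylor3 K' Phi x D H.
Proof.
move=> KK [DK HK T]; split.
- by move=> i; exact: le_trans (DK i) KK.
- by move=> i j; exact: le_trans (HK i j) KK.
- move=> h; apply: le_trans (T h) _; apply: ler_wpM2r => //.
  by rewrite exprn_ge0// norm1_ge0.
Qed.

Lemma smooth3M Phi Psi : smooth3 Phi -> smooth3 Psi -> smooth3 (fun v => Phi v * Psi v).
Proof.
move=> [K1 K10 P1] [K2 K20 P2].
pose K := 1 + K1 + K2.
have K0 : 0 <= K by rewrite !addr_ge0.
have KK1 : K1 <= K by rewrite /K; lra.
have KK2 : K2 <= K by rewrite /K; lra.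
have K1' : 1 <= K by rewrite /K; lra.
have KKK : K ^+ 2 <= 8 * K ^+ 2 by have := sqr_ge0 K; lra.
exists (8 * K ^+ 2); first by have := sqr_ge0 K; lra.
move=> x; have [b1 [D [H T1]]] := P1 x; have [b2 [D' [H' T2]]] := P2 x.
have {}b1 y : `|Phi y| <= K by apply: le_trans KK1; case: (P1 y).
have {}b2 y : `|Psi y| <= K by apply: le_trans KK2; case: (P2 y).
have [DK HK T] := taylor3_weak KK1 T1; have [DK' HK' T'] := taylor3_weak KK2 T2.
have mulN (u v : R) : `|u| <= K -> `|v| <= K -> `|u * v| <= K ^+ 2.
  by move=> h1 h2; rewrite normrM expr2; apply: ler_pM.
split; first by apply: le_trans KKK; exact: mulN.
exists (fun i => Phi x * D' i + Psi x * D i),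
  (fun i j => Phi x * H' i j + Psi x * H i j + D i * D' j); split.
- move=> i; apply: le_trans (ler_normD _ _) _.
  have := mulN _ _ (b1 x) (DK' i); have := mulN _ _ (b2 x) (DK i); have := sqr_ge0 K; lra.
- move=> i j; have g1 := ler_normD (Phi x * H' i j + Psi x * H i j) (D i * D' j).
  have g2 := ler_normD (Phi x * H' i j) (Psi x * H i j).
  have := mulN _ _ (b1 x) (HK' i j); have := mulN _ _ (b2 x) (HK i j); have := mulN _ _ (DK i) (DK' j).
  have := sqr_ge0 K; lra.
move=> h; set t := norm1 h; have t0 : 0 <= t := norm1_ge0 h.
have linb (E : 'I_l -> R) : (forall i, `|E i| <= K) -> `|\sum_i E i * h 0 i| <= K * t.
  move=> EK; apply: le_trans (ler_norm_sum _ _ _) _; rewrite /t /norm1 mulr_sumr.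
  by apply: ler_sum => i _; rewrite normrM ler_wpM2r.
have quadb (E : 'I_l -> 'I_l -> R) : (forall i j, `|E i j| <= K) ->
    `|\sum_i \sum_j E i j * (h 0 i * h 0 j)| <= K * t ^+ 2.
  move=> EK; apply: le_trans (ler_norm_sum _ _ _) _.
  rewrite expr2 mulrA [X in _ <= _ * X](_ : t = \sum_i `|h 0 i|)// mulr_sumr; apply: ler_sum => i _.
  apply: le_trans (ler_norm_sum _ _ _) _; rewrite /t /norm1 mulrAC mulr_sumr.
  by apply: ler_sum => j _; rewrite !normrM mulrA ler_wpM2r// ler_wpM2r.
have := @taylor3_product_bound K t (Phi x) (Phi (x + h)) (\sum_i D i * h 0 i)
  (\sum_i \sum_j H i j * (h 0 i * h 0 j))
  (Phi (x + h) - Phi x - \sum_i D i * h 0 i - \sum_i \sum_j H i j * (h 0 i * h 0 j))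
  (Psi x) (Psi (x + h)) (\sum_i D' i * h 0 i)
  (\sum_i \sum_j H' i j * (h 0 i * h 0 j))
  (Psi (x + h) - Psi x - \sum_i D' i * h 0 i - \sum_i \sum_j H' i j * (h 0 i * h 0 j)).
move=> /(_ K0 t0 (b1 _) (b1 _) (b2 _) (b2 _) (linb _ DK) (linb _ DK') (quadb _ HK) (quadb _ HK') (T h) (T' h)).
have e1 (u v w z : R) : u = v + w + z + (u - v - w - z) by ring.
move=> /(_ (e1 _ _ _ _) (e1 _ _ _ _)).
congr (`|_ - _ - _ - _| <= _).
  by rewrite !mulr_sumr -big_split; apply: eq_bigr => i _ /=; ring.
rewrite [X in _ + X]mulr_suml !mulr_sumr -!big_split; apply: eq_bigr => i _ /=.
rewrite !mulr_sumr -!big_split; apply: eq_bigr => j _ /=; ring.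
Qed.

Lemma smooth3_prod (I : Type) (s : seq I) (F : I -> rV -> R) :
  (forall i, smooth3 (F i)) -> smooth3 (fun v => \prod_(i <- s) F i v).
Proof.
move=> sF; elim: s => [|i s IH].
  by under eq_fun do rewrite big_nil; exact: smooth3_cst.
by under eq_fun do rewrite big_cons; exact: smooth3M.
Qed.

End smooth_products.

(** * From smooth to continuous test functions *)

Section weak_convergence.
Context {R : realType} {l : nat}.
Local Notation rV := 'rV[R]_l.
Local Notation B := (borel rV).

Definition cube (r : R) : set rV := [set v | forall i, `|v 0 i| <= r].

Lemma measurable_cube r : measurable (cube r : set B).
Proof.
have -> : cube r = \bigcap_(i in [set: 'I_l]) ((fun v : B => (v : rV) 0 i) @^-1` [set x | `|x| <= r]).
  by apply/seteqP; split => v /= h i; [move=> _|]; exact: h.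
apply: fin_bigcap_measurable => // i _.
rewrite -[X in measurable X]setTI; apply: measurable_coord => //.
have -> : [set x : R | `|x| <= r] = `[- r, r]%classic.
  by apply/seteqP; split => x /=; rewrite in_itv/= ler_norml.
exact: measurable_itv.
Qed.

Lemma compact_cube (r : R) : compact (cube r).
Proof.
have -> : cube r = [set v : rV | forall i, `[- r, r]%classic (v ord0 i)].
  by apply/seteqP; split => v /= h i; have := h i; rewrite in_itv/= ler_norml.
by apply: (@rV_compact _ _ (fun=> `[- r, r]%classic)) => i; exact: segment_compact.
Qed.

Lemma cube_tight (N : probability B R) (e : R) : 0 < e ->
  exists n : nat, fine (N (~` cube n%:R)) <= e.
Proof.
move=> e0.
have mC (n : nat) : measurable (cube n%:R : set B) := measurable_cube _.
have cov : N (cube n%:R) @[n --> \oo] --> N (\bigcup_n cube n%:R).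
  apply: nondecreasing_cvg_mu => //; first exact: bigcup_measurable.
  move=> m n mn; apply/subsetPset => v vm i; apply: le_trans (vm i) _.
  by rewrite ler_nat.
have T1 : \bigcup_n cube n%:R = [set: B].
  rewrite -subTset => v _.
  exists (\sum_i (Num.truncn `|(v : rV) ord0 i|%R).+1)%N => // i.
  apply: le_trans (ltW (truncnS_gt _)) _.
  by rewrite ler_nat (bigD1 i)//= leq_addr.
rewrite T1 (_ : N setT = 1%E) in cov; last exact: probability_setT.
have cf : fine (N (cube n%:R)) @[n --> \oo] --> (1 : R) by apply: fine_cvg.
have e1 : 1 - e < 1 by rewrite gtrBl.
have [n _ hn] := @cvgr_ge _ _ _ _ _ _ cf _ e1.
exists n; have := hn n (leqnn n) => /= h.
have := probability_setC N (mC n) => ->.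
by rewrite fineB// ?fin_num_measure//=; lra.
Qed.

(** Unlike in uniform continuity on the cube, [p] may lie outside it; compactness is used in its
    near-covering form, with [dl] tending to 0 from above. *)
Lemma compact_modulus (phi : rV -> R) (r e : R) : continuous phi -> 0 < e ->
  exists2 dl, 0 < dl & forall v p : rV, cube r v -> (forall i, `|v 0 i - p 0 i| <= dl) ->
    `|phi v - phi p| <= e.
Proof.
move=> cphi e0.
pose P (dl : R) (v : rV) := forall p : rV, (forall i, `|v 0 i - p 0 i| <= dl) -> `|phi v - phi p| <= e.
have nc := (compact_near_coveringP (cube r)).1 (@compact_cube r).
have key : \forall dl \near (0 : R)^'+, cube r `<=` P dl.
  apply: nc => x _.
  have /cvgrPdist_le/(_ (e / 2)) := cphi x; rewrite divr_gt0// => /(_ isT).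
  move/nbhs_ballP => [eta /= eta0 heta].
  have hb : nbhs x (ball x (eta / 2)) by apply: nbhsx_ballx; rewrite divr_gt0.
  have hd : \forall dl \near (0 : R)^'+, dl < eta / 2.
    by apply: nbhs_right_lt; rewrite divr_gt0.
  exists (ball x (eta / 2), [set dl | dl < eta / 2]) => //= -[x' dl] /= [bx' dle] p hp.
  have h1 : `|phi x - phi x'| <= e / 2.
    apply: heta; apply: le_ball bx'; lra.
  have h2 : `|phi x - phi p| <= e / 2.
    apply: heta; split => // i j; rewrite /ball /= (ord1 i).
    case: bx' => _ /(_ 0 j); rewrite /ball /= => hx.
    rewrite (_ : x 0 j - p 0 j = (x 0 j - x' 0 j) + (x' 0 j - p 0 j)); last by ring.
    by apply: le_lt_trans (ler_normD _ _) _; have := hp j; lra.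
  rewrite (_ : phi x' - phi p = (phi x - phi p) - (phi x - phi x')); last by ring.
  by apply: le_trans (ler_normB _ _) _; lra.
have [dl] : exists dl, 0 < dl /\ cube r `<=` P dl.
  near (0 : R)^'+ => dl; exists dl; split; first by near: dl; exact: nbhs_right_gt.
  by near: dl.
by move=> [dl0 h]; exists dl => // v p vr; exact: h.
Unshelve. all: by end_near.
Qed.

Section approximant.
Variables (h : R) (M : nat).
Hypothesis h0 : 0 < h.
Local Notation idx := {ffun 'I_l -> 'I_(M + M)}.

Definition grid_weight (f : idx) (v : rV) : R :=
  \prod_i bspline (h^-1 * v 0 i + (M%:R - (f i)%:R)).

(** The centre of the support of [grid_weight f]: the spline lives on [0, 4], hence the offset 2. *)
Definition grid_point (f : idx) : rV := \row_i (h * ((f i)%:R - M%:R + 2)).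

(** The total weight, in closed form because the splines telescope in each coordinate. *)
Definition grid_mass (v : rV) : R := \prod_i (spline_step (v 0 i / h + M%:R) - spline_step (v 0 i / h - M%:R)).

Lemma grid_weight_ge0 f v : 0 <= grid_weight f v.
Proof. by apply: prodr_ge0 => i _; exact: bspline_ge0. Qed.

Lemma grid_weight_smooth f : smooth3 (grid_weight f).
Proof.
apply: smooth3_prod => i.
exact: (smooth3_coord i (smooth1_affine h^-1 (M%:R - (f i)%:R) bspline_smooth)).
Qed.

Lemma sum_grid_weight v : \sum_f grid_weight f v = grid_mass v.
Proof.
rewrite /grid_weight -(bigA_distr_bigA (fun i (k : 'I_(M + M)) => bspline (h^-1 * v 0 i + (M%:R - k%:R)))).
rewrite /grid_mass; apply: eq_bigr => i _; rewrite -bspline_sum; apply: eq_bigr => k _.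
by congr bspline; rewrite addrA mulrC.
Qed.

Lemma grid_mass01 v : 0 <= grid_mass v <= 1.
Proof.
apply/andP; split.
  by rewrite -sum_grid_weight; apply: sumr_ge0 => f _; exact: grid_weight_ge0.
apply: prodr_ile1 => i _; rewrite -bspline_sum; apply/andP; split.
  by apply: sumr_ge0 => k _; exact: bspline_ge0.
rewrite bspline_sum.
by have := spline_step01 (v 0 i / h + M%:R); have := spline_step01 (v 0 i / h - M%:R); lra.
Qed.

(** The margin [3 * h] is the width of the rise of [spline_step]: inside the cube every upper step
    has reached 1 and every lower one is still 0. *)
Lemma grid_mass_eq1 (r : R) v : r + 3 * h <= h * M%:R -> cube r v -> grid_mass v = 1.
Proof.
move=> rM vr; rewrite /grid_mass big1// => i _.
have := vr i; rewrite ler_norml => /andP[v1 v2].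
have h_gt0 := h0.
have a : v 0 i / h <= M%:R by rewrite ler_pdivrMr// mulrC; apply: le_trans v2 _; lra.
have b : 3 - M%:R <= v 0 i / h by rewrite ler_pdivlMr// mulrC mulrBr; apply: le_trans v1; lra.
rewrite spline_step_hi ?spline_step_lo ?subr0//; lra.
Qed.

Lemma grid_weight_support f v i : grid_weight f v != 0 ->
  `|v 0 i - grid_point f 0 i| <= 2 * h.
Proof.
have h_gt0 := h0; move=> fv; have : bspline (h^-1 * v 0 i + (M%:R - (f i)%:R)) != 0.
  apply: contraNN fv => /eqP b0; rewrite /grid_weight (bigD1 i)//= b0 mul0r//.
move=> b0; rewrite mxE.
have [y0|y0] := leP (h^-1 * v 0 i + (M%:R - (f i)%:R)) 0; first by rewrite bspline_lo// eqxx in b0.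
have [y4|y4] := leP 4 (h^-1 * v 0 i + (M%:R - (f i)%:R)); first by rewrite bspline_hi// eqxx in b0.
set y := h^-1 * v 0 i + _ in y0 y4.
rewrite (_ : _ - _ = h * (y - 2)); last by rewrite /y; field; rewrite gt_eqF.
rewrite normrM gtr0_norm// mulrC ler_pM2r// ler_norml; lra.
Qed.

Lemma grid_point_cube (f : idx) v : grid_weight f v != 0 -> cube (h * (M%:R + 4)) v.
Proof.
have h_gt0 := h0; move=> fv i; have hs := grid_weight_support i fv; rewrite mxE in hs.
have f0 : 0 <= (f i)%:R :> R by [].
have fM : (f i)%:R <= M%:R + M%:R :> R by rewrite -natrD ler_nat ltnW.
have g1 : h * ((f i)%:R - M%:R + 2) <= h * (M%:R + 2) by rewrite ler_pM2l//; lra.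
have g2 : h * (- M%:R + 2) <= h * ((f i)%:R - M%:R + 2) by rewrite ler_pM2l//; lra.
move: hs; rewrite !ler_norml => /andP[s1 s2].
have e1 : h * (M%:R + 4) = h * M%:R + 4 * h by ring.
have e2 : h * (M%:R + 2) = h * M%:R + 2 * h by ring.
have e3 : h * (- M%:R + 2) = - (h * M%:R) + 2 * h by ring.
apply/andP; split; lra.
Qed.

Definition grid_approx (phi : rV -> R) (v : rV) : R :=
  \sum_(f : idx) phi (grid_point f) * grid_weight f v.

(** The error has two sources: the mass that the weights miss at [v], and the variation of [phi]
    over the support of each weight that is nonzero at [v]. *)
Lemma grid_approx_dist (phi : rV -> R) (K e r : R) v :
  (forall v, `|phi v| <= K) -> 0 <= e -> h * (M%:R + 4) <= r ->
  (forall v p : rV, cube r v -> (forall i, `|v 0 i - p 0 i| <= 2 * h) -> `|phi v - phi p| <= e) ->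
  `|phi v - grid_approx phi v| <= K * (1 - grid_mass v) + e.
Proof.
move=> phiK e0 hr mod_phi.
have /andP[w0 w1] := grid_mass01 v.
rewrite (_ : phi v - grid_approx phi v = phi v * (1 - grid_mass v) +
   \sum_f (phi v - phi (grid_point f)) * grid_weight f v); last first.
  have -> : \sum_f (phi v - phi (grid_point f)) * grid_weight f v = phi v * grid_mass v - grid_approx phi v.
    by rewrite -sum_grid_weight mulr_sumr -sumrB; apply: eq_bigr => f _; ring.
  by ring.
apply: le_trans (ler_normD _ _) _; apply: lerD.
  by rewrite normrM [`|1 - _|]ger0_norm ?subr_ge0//; apply: ler_wpM2r; rewrite ?subr_ge0.
apply: le_trans (ler_norm_sum _ _ _) _.
apply: (@le_trans _ _ (\sum_f e * grid_weight f v)); last first.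
  by rewrite -mulr_sumr sum_grid_weight ler_piMr.
apply: ler_sum => f _; rewrite normrM [`|grid_weight f v|]ger0_norm ?grid_weight_ge0//.
have [->|fv] := eqVneq (grid_weight f v) 0; first by rewrite !mulr0.
apply: ler_wpM2r; first exact: grid_weight_ge0.
apply: mod_phi => [i|i]; last exact: grid_weight_support.
exact: le_trans (grid_point_cube fv i) hr.
Qed.

Lemma measurable_grid_weight (f : idx) : bmf (grid_weight f : B -> R).
Proof.
apply: bmf_prod => i; split.
  have mstep : measurable_fun setT (@spline_step R).
    have mp (q : R) : measurable_fun setT (fun x : R => pcube (x - q)).
      apply: measurable_funX; apply: measurable_maxr => //; exact: measurable_funB.
    have mp0 : measurable_fun setT (fun x : R => pcube x).
      by apply: measurable_funX; exact: measurable_maxr.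
    apply: measurable_funM => //; apply: measurable_funB => //; apply: measurable_funD.
      by apply: measurable_funB => //; apply: measurable_funM.
    by apply: measurable_funM.
  have mb : measurable_fun setT (@bspline R).
    apply: measurable_funB => //.
    by apply: (measurableT_comp mstep); exact: measurable_funB.
  apply: (measurableT_comp mb); apply: measurable_funD => //; apply: measurable_funM => //.
  exact: measurable_coord.
exists 1 => v; rewrite ger0_norm ?bspline_ge0// /bspline.
set x := (h^-1 * _ + _); have := spline_step01 x; have := spline_step01 (x - 1); lra.
Qed.

Lemma grid_mass_bmf : bmf (grid_mass : B -> R).
Proof.
rewrite (_ : grid_mass = fun v => \sum_f grid_weight f v); last first.
  by apply/funext => v; rewrite sum_grid_weight.
by apply: bmf_sum => f; exact: measurable_grid_weight.
Qed.

Lemma grid_approx_bmf phi : bmf (grid_approx phi : B -> R).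
Proof. by apply: bmf_sum => f; apply: bmfM; [exact: bmf_cst|exact: measurable_grid_weight]. Qed.

End approximant.

(** Tightness of [W] is not assumed: the mass of the grid weights is itself a smooth statistic, so
    its mean converges to a limit close to 1, which bounds what [W k] can lose outside the cube. *)
Lemma cvg_in_law_smooth d (S : measurableType d) (Pr : probability S R)
    (W : nat -> S -> rV) (N : probability B R) :
  (forall k, meas_coords (W k)) ->
  (forall Phi : rV -> R, bmf (Phi : B -> R) -> smooth3 Phi ->
     (fun k => \int[Pr]_w Phi (W k w)) @ \oo --> \int[N]_v Phi v) ->
  cvg_in_law Pr W N.
Proof.
move=> mW cW; split; first by move=> k; apply: measurable_rV => i; exact: mW.
move=> phi cphi [K0 phiK0].
pose K := `|K0| + 1.
have K_gt0 : 0 < K by rewrite ltr_wpDl.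
have phiK v : `|phi v| <= K by apply: le_trans (phiK0 v) _; have := ler_norm K0; rewrite /K; lra.
have bphi : bmf (phi : B -> R) by split; [exact: continuous_borel_measurable|exists K].
apply/cvgrPdist_le => e e0.
(* The errors add up to [3 * K * e1 + 3 * e1]: mass and modulus for both laws, plus the convergence
   of the approximant. *)
pose e1 := e / (4 * (K + 1)).
have e10 : 0 < e1 by rewrite divr_gt0// mulr_gt0// ltr_wpDl// ltW.
have [n Nn] := cube_tight N e10.
pose r : R := n%:R.
have [dl dl0 mdl] := @compact_modulus phi (r + 8) e1 cphi e10.
pose h := Num.min 1 (dl / 2).
have h0 : 0 < h by rewrite lt_min ltr01 divr_gt0.
have h1 : h <= 1 by rewrite ge_min lexx.
have hdl : 2 * h <= dl by have : h <= dl / 2; [rewrite ge_min lexx orbT|lra].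
(* [M] is just large enough for the weights to sum to 1 on [cube r]; as [h <= 1], their supports
   stay in [cube (r + 8)], where [dl] was obtained. *)
pose M := (Num.truncn ((r + 3) / h)).+1.
have hM1 : r + 3 * h <= h * M%:R.
  have := truncnS_gt ((r + 3) / h); rewrite -/M ltr_pdivrMr// mulrC; lra.
have hM2 : h * (M%:R + 4) <= r + 8.
  have r30 : 0 <= (r + 3) / h by rewrite divr_ge0 ?addr_ge0// ltW.
  have : (Num.truncn ((r + 3) / h))%:R <= (r + 3) / h by rewrite truncn_le.
  rewrite ler_pdivlMr// => hh.
  rewrite /M -natr1 (_ : h * _ = (Num.truncn ((r + 3) / h))%:R * h + 5 * h); last by ring.
  lra.
have dist v := @grid_approx_dist h M h0 phi K e1 (r + 8) v phiK (ltW e10) hM2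
   (fun (v p : rV) vr hp => mdl v p vr (fun i => le_trans (hp i) hdl)).
have bm := @grid_mass_bmf h M.
have ba := @grid_approx_bmf h M phi.
have cm : (fun k => \int[Pr]_w grid_mass h M (W k w)) @ \oo --> \int[N]_v grid_mass h M v.
  have E d' (S' : measurableType d') (P' : probability S' R) (g : S' -> rV) : meas_coords g ->
     \int[P']_w grid_mass h M (g w) = \sum_(f : {ffun 'I_l -> 'I_(M + M)}) \int[P']_w grid_weight h f (g w).
    move=> mg; rewrite -Rint_sum; last by move=> f; apply: bmf_rV_comp => //; exact: measurable_grid_weight.
    by apply: eq_Rintegral => w _; rewrite sum_grid_weight.
  rewrite (E _ _ N (fun v : B => (v : rV)) meas_coords_id).
  under eq_fun do rewrite (E _ _ Pr (W _) (mW _)).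
  apply: cvg_big => [|f _]; [exact: add_continuous|]; apply: cW; [exact: measurable_grid_weight|exact: grid_weight_smooth].
have ca : (fun k => \int[Pr]_w grid_approx h M phi (W k w)) @ \oo --> \int[N]_v grid_approx h M phi v.
  have E d' (S' : measurableType d') (P' : probability S' R) (g : S' -> rV) : meas_coords g ->
     \int[P']_w grid_approx h M phi (g w) = \sum_(f : {ffun 'I_l -> 'I_(M + M)}) phi (grid_point h f) * \int[P']_w grid_weight h f (g w).
    move=> mg.
    have bg (f : {ffun 'I_l -> 'I_(M + M)}) : bmf (fun w => grid_weight h f (g w)).
      by apply: bmf_rV_comp => //; exact: measurable_grid_weight.
    rewrite /grid_approx Rint_sum; last by move=> f; apply: bmfM; [exact: bmf_cst|exact: bg].
    by apply: eq_bigr => f _; rewrite RintZl.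
  rewrite (E _ _ N (fun v : B => (v : rV)) meas_coords_id).
  under eq_fun do rewrite (E _ _ Pr (W _) (mW _)).
  apply: cvg_big => [|f _]; [exact: add_continuous|]; apply: cvgM; first exact: cvg_cst.
  by apply: cW; [exact: measurable_grid_weight|exact: grid_weight_smooth].
have Nm : 1 - e1 <= \int[N]_v grid_mass h M v.
  have bC := bmf_indic (R := R) (measurable_cube r).
  apply: (@le_trans _ _ (\int[N]_v (\1_(cube r) v))); last first.
    apply: le_Rint => // v; rewrite indicE; case: (boolP (v \in _)) => [/set_mem vr|_].
      by rewrite (grid_mass_eq1 h0 hM1 vr).
    by have /andP[] := grid_mass01 h M v.
  have E1 : (\int[N]_v (\1_(cube r) v : R)) = fine (N (cube r)).
    by rewrite -(Rint_indic N (measurable_cube r)).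
  rewrite E1; move: Nn; rewrite (_ : N (~` cube n%:R) = 1 - N (cube r))%E; last first.
    by have := probability_setC N (measurable_cube n%:R) => ->.
  by rewrite fineB ?fin_num_measure//; [rewrite /=; lra|exact: measurable_cube].
have gap d' (S' : measurableType d') (P' : probability S' R) (g : S' -> rV) : meas_coords g ->
   `|\int[P']_w phi (g w) - \int[P']_w grid_approx h M phi (g w)| <=
   K * (1 - \int[P']_w grid_mass h M (g w)) + e1.
  move=> mg; have b1 := bmf_rV_comp mg bphi; have b2 := bmf_rV_comp mg ba; have b3 := bmf_rV_comp mg bm.
  rewrite -RintB//; apply: le_trans (norm_Rint P' (bmfB b1 b2)) _.
  have b4 := bmfB (bmf_cst (U := S') 1) b3.
  have b5 := bmfM (bmf_cst (U := S') K) b4.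
  rewrite -[X in K * (X - _)](Rint_cst P') -RintB//; last exact: bmf_cst.
  rewrite -(RintZl P' K b4) -[X in _ <= _ + X](Rint_cst P') -RintD//; last exact: bmf_cst.
  apply: le_Rint => [| |w]; [exact: bmf_norm (bmfB b1 b2)|exact: bmfD b5 (bmf_cst _)|exact: dist].
have gN := gap _ _ N (fun v : B => (v : rV)) meas_coords_id.
have lt1 : 1 - 2 * e1 < \int[N]_v grid_mass h M v by lra.
have hk1 := @cvgr_ge _ _ _ _ _ _ cm _ lt1.
have /cvgrPdist_le/(_ e1 e10) hk2 := ca.
near=> k.
have g1 := gap _ _ Pr (W k) (mW k).
have g2 : 1 - 2 * e1 <= \int[Pr]_w grid_mass h M (W k w) by near: k; exact: hk1.
have g3 : `|\int[N]_v grid_approx h M phi v - \int[Pr]_w grid_approx h M phi (W k w)| <= e1.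
  by near: k; exact: hk2.
have Ke1 : (K + 1) * e1 * 4 = e by rewrite /e1; field; rewrite gt_eqF// ltr_wpDl// ltW.
have k1 : K * (1 - \int[Pr]_w grid_mass h M (W k w)) <= K * (2 * e1) by rewrite ler_pM2l//; lra.
have k2 : K * (1 - \int[N]_w grid_mass h M w) <= K * e1 by rewrite ler_pM2l//; lra.
have n1 := ler_normB (\int[N]_v phi v - \int[N]_v grid_approx h M phi v)
   (\int[Pr]_w phi (W k w) - \int[Pr]_w grid_approx h M phi (W k w)).
have n2 := ler_normD (\int[N]_v phi v - \int[N]_v grid_approx h M phi v
   - (\int[Pr]_w phi (W k w) - \int[Pr]_w grid_approx h M phi (W k w)))
   (\int[N]_v grid_approx h M phi v - \int[Pr]_w grid_approx h M phi (W k w)).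
rewrite (_ : _ - _ = \int[N]_v phi v - \int[N]_v grid_approx h M phi v
   - (\int[Pr]_w phi (W k w) - \int[Pr]_w grid_approx h M phi (W k w)) +
   (\int[N]_v grid_approx h M phi v - \int[Pr]_w grid_approx h M phi (W k w))); last by ring.
by lra.
Unshelve. all: by end_near.
Qed.

End weak_convergence.

(** * Positive semidefinite matrices as Gram matrices *)

Section psd.
Context {R : realType} {l : nat}.
Local Notation dl i := (delta_mx 0 i : 'rV[R]_l).
Implicit Types (V : 'M[R]_l) (u v a : 'rV[R]_l).

Definition psd V := V^T = V /\ forall u, 0 <= (u *m V *m u^T) 0 0.

Lemma form_delta V i j : (dl i *m V *m (dl j)^T) 0 0 = V i j.
Proof. by rewrite -rowE trmx_delta -[_ *m _]colE !mxE. Qed.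

Lemma form_sym V u v : V^T = V -> (v *m V *m u^T) 0 0 = (u *m V *m v^T) 0 0.
Proof.
move=> sV; rewrite -[in LHS](trmxK (v *m V *m u^T)) [in LHS]mxE.
by rewrite !trmx_mul trmxK sV mulmxA.
Qed.

Lemma formDZ V u v (t : R) : V^T = V ->
  ((u + t *: v) *m V *m (u + t *: v)^T) 0 0 =
  (u *m V *m u^T) 0 0 + 2 * t * (u *m V *m v^T) 0 0 + t ^+ 2 * (v *m V *m v^T) 0 0.
Proof.
move=> sV; rewrite !mulmxDl linearD/= !mulmxDr !linearZ/= -!scalemxAl ?linearZ/=.
move: (form_sym u v sV); move: (u *m V *m u^T) (u *m V *m v^T) (v *m V *m u^T) (v *m V *m v^T).
by move=> A B C D BC; rewrite !mxE BC; ring.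
Qed.

Lemma psd_diag_ge0 V i : psd V -> 0 <= V i i.
Proof. by move=> [_ pV]; rewrite -form_delta. Qed.

Lemma psd_diag_eq0 V i j : psd V -> V i i = 0 -> V i j = 0.
Proof.
move=> [sV pV] i0; apply/eqP; apply: contraT => ij0.
have Vji : V j i = V i j by rewrite -[in LHS]sV mxE.
(* With [V i i = 0] the form is affine along [dl i]; this multiple gives it the value -1. *)
have := pV (dl j + (- (V j j + 1) / (2 * V i j)) *: (dl i)).
rewrite formDZ// !form_delta i0 mulr0 addr0 Vji.
rewrite (_ : _ + _ = -1) ?oppr_ge0 ?ler10//.
by field.
Qed.

(** One step of a Cholesky factorization: what remains is the minimum of the form of [V] along the
    direction [dl i], hence nonnegative. *)
Lemma psd_deflate V i : psd V -> 0 < V i i ->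
  psd (V - ((Num.sqrt (V i i))^-1 *: row i V)^T *m ((Num.sqrt (V i i))^-1 *: row i V)).
Proof.
move=> pV i0; have [sV qV] := pV; set a := _ *: row i V; split.
  by rewrite linearB/= trmx_mul trmxK sV.
move=> u; set b := (u *m V *m (dl i)^T) 0 0.
have s2 : Num.sqrt (V i i) ^+ 2 = V i i by rewrite sqr_sqrtr// ltW.
have s0 : Num.sqrt (V i i) != 0 by rewrite gt_eqF// sqrtr_gt0.
have au : (a *m u^T) 0 0 = (Num.sqrt (V i i))^-1 * b.
  by rewrite /a -scalemxAl rowE mxE (form_sym u (dl i) sV).
have aa : (u *m (a^T *m a) *m u^T) 0 0 = ((Num.sqrt (V i i))^-1 * b) ^+ 2.
  rewrite (_ : u *m _ *m _ = (a *m u^T)^T *m (a *m u^T)); last first.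
    by rewrite trmx_mul trmxK !mulmxA.
  by rewrite mxE big_ord1 [(a *m u^T)^T 0 0]mxE au expr2.
have -> : (u *m (V - a^T *m a) *m u^T) 0 0 = (u *m V *m u^T) 0 0 - ((Num.sqrt (V i i))^-1 * b) ^+ 2.
  by rewrite -aa mulmxBr mulmxBl; move: (u *m V *m u^T) (u *m _ *m u^T) => A B; rewrite !mxE.
have := qV (u + (- b / V i i) *: (dl i)); rewrite formDZ// form_delta -/b.
by congr (0 <= _); rewrite -{1 2 3}s2; field.
Qed.

(** Induction on the number of nonzero diagonal entries: deflation clears the [i]-th one and keeps
    vanishing ones at zero, their rows being zero. This is what allows singular covariances. *)
Lemma psd_gram V : psd V -> exists s : seq 'rV[R]_l, V = gram_mx s.
Proof.
have [n] := ubnP #|[pred i | V i i != 0]|; elim: n V => // n IH V; rewrite ltnS => cV pV.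
have [/existsP[i i0]|] := boolP [exists i, V i i != 0]; last first.
  rewrite negb_exists => /forallP d0; exists [::]; rewrite /gram_mx big_nil.
  apply/matrixP => i j; rewrite mxE; apply: psd_diag_eq0 => //.
  by apply/eqP; have := d0 i; rewrite negbK.
have Vi : 0 < V i i by rewrite lt_neqAle eq_sym i0 psd_diag_ge0.
have pV' := psd_deflate pV Vi; set a := _ *: row i V in pV'.
have aE j : (a^T *m a) j j = (V i i)^-1 * V i j ^+ 2.
  rewrite mxE big_ord1 !mxE -[X in X^-1 * _ ^+ _](sqr_sqrtr (ltW Vi)).
  by field; rewrite gt_eqF// sqrtr_gt0.
have [|s Vs] := IH _ _ pV'.
  apply: leq_trans cV; apply: proper_card; apply/properP; split.
    apply/fintype.subsetP => j; rewrite !inE; apply: contraNN => /eqP j0.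
    rewrite mxE [X in _ + X]mxE aE (_ : V i j = V j i); last by rewrite -[in RHS]pV.1 mxE.
    by rewrite j0 (psd_diag_eq0 i pV j0) expr0n mulr0 subr0.
  exists i; rewrite !inE //; rewrite mxE [X in _ + X]mxE aE negbK.
  by rewrite expr2 mulKf// subrr.
by exists (a :: s); rewrite /gram_mx big_cons -/(gram_mx s) -Vs addrC subrK.
Qed.

End psd.

(** * Moments of independent samples *)

Section independence.
Context {R : realType} d (S : measurableType d) (Pr : probability S R).
Context {T : ptopologicalType} {I : eqType} (Z : I -> S -> T).
Hypothesis mZ : forall i, measurable_fun setT (Z i : S -> borel T).
Hypothesis iZ : mutually_independent Pr Z.

(** Events fixed by finitely many variables other than [Z k]. Setting [A i] to [setT] off [s] lets
    the intersection range over all indices, which makes stability under intersection easy. *)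
Definition cylinders_off (k : I) : set (set S) := [set E |
  exists s, exists A : I -> set (borel T), [/\ uniq s, k \notin s,
    (forall i, measurable (A i)), (forall i, i \notin s -> A i = setT) &
    E = \bigcap_(i in [set` s]) Z i @^-1` A i]].

(** [S] with the coarser sigma-algebra of the variables other than [Z k]: measurability on
    [offType k] says that a map does not involve [Z k]. *)
Definition offType (k : I) := g_sigma_algebraType (cylinders_off k).

Lemma cylinders_offE (s : seq I) (A : I -> set (borel T)) :
  (forall i, i \notin s -> A i = setT) ->
  \bigcap_(i in [set` s]) Z i @^-1` A i = \bigcap_i Z i @^-1` A i.
Proof.
move=> AT; apply/seteqP; split => w h i _; last exact: h.
by have [si|/AT ->//] := boolP (i \in s); exact: h.
Qed.

Lemma measurable_cylinder (s : seq I) (A : I -> set (borel T)) :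
  (forall i, measurable (A i)) ->
  measurable (\bigcap_(i in [set` s]) Z i @^-1` A i).
Proof.
move=> mA; apply: fin_bigcap_measurable => // i _.
by rewrite -[X in measurable X]setTI; exact: mZ.
Qed.

Lemma setI_closed_cylinders_off k : setI_closed (cylinders_off k).
Proof.
move=> _ _ [s [A [us ks mA sA ->]]] [r [B [ur kr mB rB ->]]].
have off i : i \notin undup (s ++ r) -> A i = setT /\ B i = setT.
  by rewrite mem_undup mem_cat negb_or => /andP[/sA-> /rB->].
exists (undup (s ++ r)), (fun i => A i `&` B i); split => //.
- exact: undup_uniq.
- by rewrite mem_undup mem_cat negb_or ks.
- by move=> i; exact: measurableI.
- by move=> i /off[-> ->]; rewrite setIT.
rewrite !cylinders_offE//; last by move=> i /off[-> ->]; rewrite setIT.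
by rewrite -bigcapI; apply: eq_bigcapr => i _; rewrite preimage_setI.
Qed.

(** The pi-lambda theorem: events independent of [Z k] form a Dynkin system that contains the
    cylinders. *)
Lemma indep_off k (A : set (borel T)) (E : set S) : measurable A ->
  <<s cylinders_off k >> E ->
  measurable E /\ Pr (Z k @^-1` A `&` E) = (Pr (Z k @^-1` A) * Pr E)%E.
Proof.
move=> mA; have mZA : measurable (Z k @^-1` A).
  by rewrite -[X in measurable X]setTI; exact: mZ.
rewrite -(setI_closed_g_dynkin_g_sigma_algebra (@setI_closed_cylinders_off k)).
pose D : set (set S) := [set E | measurable E /\ Pr (Z k @^-1` A `&` E) = (Pr (Z k @^-1` A) * Pr E)%E].
apply: (smallest_sub (X := D)) => /=.
  split.
  - by split => //; rewrite setIT (probability_setT Pr) mule1.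
  - move=> F [mF FE]; split; first exact: measurableC.
    rewrite -setDE measureD//; last by rewrite ltey_eq fin_num_measure.
    have := probability_setC Pr mF => ->.
    by rewrite muleBr ?fin_num_measure// mule1 -FE.
  - move=> F tF DF; have mF i : measurable (F i) by have [] := DF i.
    split; first exact: bigcup_measurable.
    rewrite setI_bigcupr !measure_bigcup//=; last 2 first.
    + by move=> i _; exact: measurableI.
    + exact: trivIset_setIl.
    rewrite -(fineK (fin_num_measure Pr _ mZA)) -nneseriesZl//; apply: eq_eseriesr => i _.
    by rewrite fineK ?fin_num_measure//; have [] := DF i.
move=> _ [s [B [us ks mB sB ->]]]; split; first exact: measurable_cylinder.
pose C i := if i == k then A else B i.
have Cs i : i \in s -> C i = B i.
  by rewrite /C; case: eqP => // ->; rewrite (negbTE ks).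
have mC i : measurable (C i) by rewrite /C; case: eqP.
have uks : uniq (k :: s) by rewrite /= ks.
have := iZ uks mC.
rewrite big_cons {2}/C eqxx (eq_big_seq (fun i => Pr (Z i @^-1` B i))); last first.
  by move=> i si; rewrite Cs.
rewrite -(iZ us mB) => <-; congr (Pr _); apply/seteqP; split => w /=.
  move=> [wA wB] i /=; rewrite inE => /orP[/eqP ->|si]; first by rewrite /C eqxx.
  by rewrite Cs//; exact: wB.
move=> h; split; first by have := h k; rewrite /= inE eqxx /C eqxx; exact.
by move=> i /= si; have := h i; rewrite /= inE si orbT Cs//; exact.
Qed.

Lemma measurable_off k i : i != k ->
  measurable_fun setT (Z i : offType k -> borel T).
Proof.
move=> ik _ A mA; rewrite setTI; apply: sub_gen_smallest.
exists [:: i], (fun j => if j == i then A else setT); split => //.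
- by rewrite inE eq_sym.
- by move=> j; case: eqP.
- by move=> j; rewrite inE => /negbTE ->.
apply/seteqP; split => w /= h.
  by move=> j /=; rewrite inE => /eqP ->; rewrite eqxx.
by have := h i; rewrite /= inE eqxx; exact.
Qed.

(** The variable [Z k] can be integrated out first with [V] frozen, because the joint law agrees
    with a product measure on rectangles. *)
Lemma Rint_indep k dU (U : measurableType dU) (V : S -> U)
    (P : probability (borel T) R) (F : borel T * U -> R) :
  (forall A : set (borel T), measurable A -> Pr (Z k @^-1` A) = P A) ->
  measurable_fun setT (V : offType k -> U) -> bmf F ->
  \int[Pr]_w F (Z k w, V w) = \int[Pr]_w \int[P]_x F (x, V w).
Proof.
move=> lawZ mV bF.
have mV' : measurable_fun setT V.
  move=> _ B mB; rewrite setTI; have := mV measurableT B mB; rewrite setTI.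
  by move=> /(indep_off (@measurableT _ (borel T)))[].
pose VX : {mfun S >-> U} := mfun_Sub (mem_set mV').
pose nu : probability U R := distribution Pr VX.
have mh : measurable_fun setT (fun w => (Z k w : borel T, V w)) by exact: measurable_fun_pair.
have law C : measurable C -> Pr ((fun w => (Z k w : borel T, V w)) @^-1` C) = prodP P nu C.
  move=> mC; pose m' := measure_function_pushforward__canonical__measure_function_Measure Pr mh.
  apply/esym; apply: (product_measure_unique (m1 := P) (m2 := nu) (m' := m')) mC => A B mA mB.
  have := mV measurableT B mB; rewrite setTI => /(indep_off (k := k) mA)[mVB].
  by rewrite lawZ.
rewrite -(Rint_pushforward mh law bF) Rint_prod21//.
have bG : bmf (fun v => \int[P]_x F (x, v)) by exact: bmf_Rint1.
exact: (Rint_pushforward (mu := Pr) (nu := nu) mV' _ bG).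
Qed.

End independence.

Lemma orthogonal_sum (R : realType) d (S : measurableType d)
    (Pr : probability S R) (J : finType) (f : J -> S -> R) (B : R) :
  (forall j, bmf (f j)) -> (forall j w, `|f j w| <= B) ->
  (forall j j', j != j' -> \int[Pr]_w (f j w * f j' w) = 0) ->
  \int[Pr]_w (\sum_j f j w) ^+ 2 <= #|J|%:R * B ^+ 2.
Proof.
move=> bf fB f0.
have bff j j' : bmf (fun w => f j w * f j' w) by exact: bmfM.
under eq_Rintegral => w _ do rewrite expr2 mulr_suml.
rewrite Rint_sum; last by move=> j; apply: bmfM => //; exact: bmf_sum.
rewrite mulr_natl -sumr_const; apply: ler_sum => j _.
under eq_Rintegral => w _ do rewrite mulr_sumr.
rewrite Rint_sum// (bigD1 j)//= big1 => [|j' jj']; last by rewrite f0// eq_sym.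
rewrite addr0; apply: Rint_le => // w; rewrite -expr2 -[X in X <= _]real_normK ?num_real//.
by rewrite lerXn2r// nnegrE// (le_trans _ (fB j w)).
Qed.

(** * Degenerate sums and sums of independent vectors *)

Section moments.
Context {R : realType} d (S : measurableType d) (Pr : probability S R).
Context {T : ptopologicalType} {I : eqType} (Z : I -> S -> T).
Hypothesis mZ : forall i, measurable_fun setT (Z i : S -> borel T).
Hypothesis iZ : mutually_independent Pr Z.
Local Notation TT := (borel T * borel T)%type.

Lemma bmf_pairZ (q : TT -> R) i j : bmf q -> bmf (fun w => q (Z i w, Z j w)).
Proof. by move=> bq; apply: bmf_comp bq; exact: measurable_fun_pair. Qed.

(** [Z j] occurs in the first factor only, and integrating it out gives 0. The indices [i], [i'] and
    [j'] may coincide. *)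
Lemma degenerate_orthogonal (Q : probability (borel T) R) (q : TT -> R) i j i' j' :
  bmf q -> (forall A : set (borel T), measurable A -> Pr (Z j @^-1` A) = Q A) ->
  (forall x, \int[Q]_y q (x, y) = 0) -> i != j -> i' != j -> j' != j ->
  \int[Pr]_w (q (Z i w, Z j w) * q (Z i' w, Z j' w)) = 0.
Proof.
move=> bq lawj q0 ij i'j j'j.
have mV : measurable_fun setT ((fun w => (Z i w, (Z i' w, Z j' w))) : offType Z j -> (borel T * (borel T * borel T))%type).
  by do 2?apply: measurable_fun_pair; exact: measurable_off.
have mq2 : measurable_fun setT (fun z : borel T * (borel T * (borel T * borel T)) => ((z.2).2 : TT)).
  exact: (measurableT_comp measurable_snd measurable_snd).
have mq1 : measurable_fun setT (fun z : borel T * (borel T * (borel T * borel T)) => (((z.2).1, z.1) : TT)).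
  apply: measurable_fun_pair; last exact: measurable_fst.
  exact: (measurableT_comp measurable_fst measurable_snd).
have bF : bmf (fun z : borel T * (borel T * (borel T * borel T)) => q ((z.2).1, z.1) * q (z.2).2).
  by apply: bmfM; [exact: (bmf_comp mq1 bq)|exact: (bmf_comp mq2 bq)].
have := Rint_indep mZ iZ lawj mV bF => /= ->.
under eq_Rintegral => w _.
  rewrite RintZr; last exact: bmf_pair1.
  by rewrite q0 mul0r over.
exact: Rint_cst.
Qed.

Lemma degenerate_average (Q : probability (borel T) R) (q : TT -> R) (B : R) i
    (k : nat -> I) m : injective k -> (forall j, i != k j) ->
  bmf q -> (forall z, `|q z| <= B) ->
  (forall j (A : set (borel T)), measurable A -> Pr (Z (k j) @^-1` A) = Q A) ->
  (forall x, \int[Q]_y q (x, y) = 0) -> (0 < m)%N ->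
  \int[Pr]_w (m%:R^-1 * \sum_(j < m) q (Z i w, Z (k j) w)) ^+ 2 <= B ^+ 2 / m%:R.
Proof.
move=> ik knE bq qB lawk q0 m0.
have b j : bmf (fun w => q (Z i w, Z (k j) w)) by exact: bmf_pairZ.
under eq_Rintegral => w _ do rewrite exprMn.
rewrite RintZl; last by apply: bmfX; exact: bmf_sum.
have := @orthogonal_sum R d S Pr 'I_m (fun j w => q (Z i w, Z (k j) w)) B.
move=> /(_ (fun j => b j) (fun j w => qB _)) h.
have {}h := h _; rewrite card_ord in h.
have m0' : 0 < m%:R :> R by rewrite ltr0n.
apply: (@le_trans _ _ (m%:R^-1 ^+ 2 * (m%:R * B ^+ 2))).
  rewrite ler_pM2l ?exprn_gt0 ?invr_gt0//; apply: h => j j' jj'.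
  apply: (degenerate_orthogonal bq (lawk j)) => //.
  by rewrite (inj_eq ik) eq_sym.
by rewrite le_eqVlt; apply/orP; left; apply/eqP; field; rewrite gt_eqF.
Qed.

Lemma degenerate_Ustat (P Q : probability (borel T) R) (q : TT -> R) (B : R)
    (kx ky : nat -> I) n m : injective kx -> injective ky -> (forall i j, kx i != ky j) ->
  bmf q -> (forall z, `|q z| <= B) ->
  (forall i (A : set (borel T)), measurable A -> Pr (Z (kx i) @^-1` A) = P A) ->
  (forall j (A : set (borel T)), measurable A -> Pr (Z (ky j) @^-1` A) = Q A) ->
  (forall x, \int[Q]_y q (x, y) = 0) -> (forall y, \int[P]_x q (x, y) = 0) ->
  (0 < n)%N -> (0 < m)%N ->
  \int[Pr]_w (n%:R^-1 * \sum_(i < n) (m%:R^-1 * \sum_(j < m) q (Z (kx i) w, Z (ky j) w))) ^+ 2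
    <= B ^+ 2 / (n%:R * m%:R).
Proof.
move=> ix iy xy bq qB lawx lawy qx qy n0 m0.
have b i j : bmf (fun w => q (Z i w, Z j w)) by exact: bmf_pairZ.
under eq_Rintegral => w _ do rewrite -mulr_sumr mulrA pair_big/= exprMn.
rewrite RintZl; last by apply: bmfX; exact: bmf_sum.
have := @orthogonal_sum R d S Pr ('I_n * 'I_m)%type (fun p w => q (Z (kx p.1) w, Z (ky p.2) w)) B.
move=> /(_ (fun p => b _ _) (fun p w => qB _)) h.
have {}h := h _; rewrite card_prod !card_ord natrM in h.
have m0' : 0 < m%:R :> R by rewrite ltr0n.
have n0' : 0 < n%:R :> R by rewrite ltr0n.
apply: (@le_trans _ _ ((n%:R^-1 * m%:R^-1) ^+ 2 * (n%:R * m%:R * B ^+ 2))).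
  rewrite ler_pM2l ?exprn_gt0 ?mulr_gt0 ?invr_gt0//; apply: h => -[i j] [i' j'] pp' /=.
  (* Distinct pairs differ in some index, and that variable is integrated out: degeneracy under [Q]
     if the second indices differ, otherwise degeneracy under [P] for the transposed kernel. *)
  have [jj'|jj'] := eqVneq j j'; last first.
    apply: (degenerate_orthogonal bq (lawy j)) => //.
    by rewrite (inj_eq iy) eq_sym.
  have ii' : i != i' by apply: contraNN pp' => /eqP ->; rewrite jj'.
  have bq' : bmf (fun z : TT => q (z.2, z.1)).
    by apply: (bmf_comp _ bq); apply: measurable_fun_pair.
  apply: (degenerate_orthogonal bq' (lawx i)) => //; rewrite ?[_ == kx i]eq_sym//.
  by rewrite (inj_eq ix).
by rewrite le_eqVlt; apply/orP; left; apply/eqP; field; rewrite !gt_eqF.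
Qed.

Section sums.
Variable l : nat.
Local Notation rV := 'rV[R]_l.

Lemma meas_coords_sum d' (U : measurableType d') n (f : nat -> U -> rV) :
  (forall i, (i < n)%N -> meas_coords (f i)) -> meas_coords (fun u => \sum_(i < n) f i u).
Proof.
elim: n => [|n IH] mf.
  by under eq_fun do rewrite big_ord0; exact: meas_coords_cst.
under eq_fun do rewrite big_ord_recr/=.
by apply: meas_coordsD; [apply: IH => i i_n; apply: mf; exact: ltnW|exact: mf].
Qed.

(** Summands are integrated out one at a time, the last one being independent of the others and of
    [V]. The vector [V] leaves room for the other sample. *)
Lemma Rint_sum_conv (P : probability (borel T) R) (zeta : borel T -> rV)
    (k : nat -> I) (V : S -> rV) (Phi : rV -> R) n :
  injective k ->
  (forall i (A : set (borel T)), measurable A -> Pr (Z (k i) @^-1` A) = P A) ->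
  meas_coords zeta -> bmf (Phi : borel rV -> R) ->
  (forall i, (i < n)%N -> meas_coords (V : offType Z (k i) -> rV)) ->
  \int[Pr]_w Phi (V w + \sum_(i < n) zeta (Z (k i) w)) =
  \int[Pr]_w iter n (conv_op P zeta) Phi (V w).
Proof.
move=> ik lawk mzeta; elim: n Phi => [|n IH] Phi bPhi mV.
  by under eq_Rintegral => w _ do rewrite big_ord0 addr0.
rewrite iterSr -IH; [|exact: conv_op_bmf|by move=> i i_n; apply: mV; exact: ltnW].
pose W w := V w + \sum_(i < n) zeta (Z (k i) w).
have mW : measurable_fun setT (W : offType Z (k n) -> borel rV).
  apply: measurable_rV; apply: meas_coordsD; first exact: mV.
  apply: (@meas_coords_sum _ (offType Z (k n)) n (fun i w => zeta (Z (k i) w))) => i i_n.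
  have ki : k i != k n by rewrite (inj_eq ik) ltn_eqF.
  have mk := @measurable_off _ _ _ _ Z _ _ ki.
  exact: (meas_coords_comp (V := offType Z (k n)) (U := borel T) mk mzeta).
have bF : bmf (fun z : borel T * borel rV => Phi ((z.2 : rV) + zeta z.1)).
  apply: bmf_rV_comp => //; apply: meas_coordsD.
    exact: (meas_coords_comp (@measurable_snd _ _ (borel T) (borel rV)) meas_coords_id).
  exact: (meas_coords_comp (@measurable_fst _ _ (borel T) (borel rV)) mzeta).
rewrite -(Rint_indep mZ iZ (lawk n) mW bF).
by apply: eq_Rintegral => w _ /=; rewrite big_ord_recr/= addrA.
Qed.

End sums.
End moments.

(** * Influence functions and the limit covariance *)

(** Covers both [opP] and, through [swap_kernel], [opQ], so each property is proved once. *)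
Definition kernel_op (R : realType) d1 d2 (U : measurableType d1)
    (V : measurableType d2) (mu : probability U R) (K : U * V -> R)
    (f : U -> R) (y : V) : R := \int[mu]_x (K (x, y) * f x).

Section markov.
Context {R : realType} d1 d2 {U : measurableType d1} {V : measurableType d2}.
Variables (mu : probability U R) (nu : probability V R).
Variables (K : U * V -> R) (k0 : R).
Hypotheses (bK : bmf K) (K0 : forall z, k0 <= K z) (k0_gt0 : 0 < k0).
Hypothesis margU : forall x, \int[nu]_y K (x, y) = 1.
Hypothesis margV : forall y, \int[mu]_x K (x, y) = 1.

Local Notation A := (kernel_op mu K).

Let bKy y : bmf (fun x => K (x, y)). Proof. exact: bmf_pair2. Qed.

Lemma kernel_op_bmf f : bmf f -> bmf (A f).
Proof.
move=> bf; apply: (bmf_Rint1 mu (f := fun z => K z * f z.1)).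
by apply: bmfM => //; exact: (bmf_comp (@measurable_fst _ _ U V)).
Qed.

Lemma kernel_opB f g y : bmf f -> bmf g -> A (fun x => f x - g x) y = A f y - A g y.
Proof.
move=> bf bg; rewrite /kernel_op -RintB; [|exact: bmfM|exact: bmfM].
by apply: eq_Rintegral => x _; rewrite mulrBr.
Qed.

Lemma kernel_op_sum n (f : nat -> U -> R) y : (forall i, bmf (f i)) ->
  A (fun x => \sum_(i < n) f i x) y = \sum_(i < n) A (f i) y.
Proof.
move=> bf; rewrite /kernel_op -Rint_sum; last by move=> i; exact: bmfM.
by apply: eq_Rintegral => x _; rewrite mulr_sumr.
Qed.

Lemma kernel_op_cst r y : A (fun=> r) y = r.
Proof. by rewrite /kernel_op RintZr// margV mul1r. Qed.

Lemma kernel_op_le f M y : bmf f -> (forall x, `|f x| <= M) -> `|A f y| <= M.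
Proof.
move=> bf fM; apply: le_trans (norm_Rint mu (bmfM (bKy y) bf)) _.
rewrite -[M]mul1r -(margV y) -RintZr//; apply: le_Rint => [| |x].
- by apply: bmf_norm; exact: bmfM.
- by apply: bmfM => //; exact: bmf_cst.
- have Kge : 0 <= K (x, y) by exact: le_trans (ltW k0_gt0) (K0 _).
  by rewrite normrM (ger0_norm Kge) ler_wpM2l.
Qed.

Lemma kernel_op_mean f : bmf f -> \int[nu]_y A f y = \int[mu]_x f x.
Proof.
move=> bf; rewrite -(Rint_swap mu nu (f := fun z => K z * f z.1)); last first.
  by apply: bmfM => //; exact: (bmf_comp (@measurable_fst _ _ U V)).
by apply: eq_Rintegral => x _ /=; rewrite RintZr ?margU ?mul1r//; exact: bmf_pair1.
Qed.

(** On functions of mean zero the constant [k0] may be subtracted from the kernel for free; what is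
    left is nonnegative and has mass [1 - k0]. *)
Lemma kernel_op_contract f M y : bmf f -> \int[mu]_x f x = 0 ->
  (forall x, `|f x| <= M) -> `|A f y| <= (1 - k0) * M.
Proof.
move=> bf f0 fM.
have bk : bmf (fun x => (K (x, y) - k0)) by apply: bmfB => //; exact: bmf_cst.
have -> : A f y = \int[mu]_x ((K (x, y) - k0) * f x).
  have E : \int[mu]_x (k0 * f x) = 0 by rewrite RintZl// f0 mulr0.
  rewrite -[LHS]subr0 -[X in _ - X]E -RintB; [|exact: bmfM|by apply: bmfM => //; exact: bmf_cst].
  by apply: eq_Rintegral => x _; rewrite mulrBl.
apply: le_trans (norm_Rint mu (bmfM bk bf)) _.
have -> : 1 - k0 = \int[mu]_x (K (x, y) - k0).
  by rewrite RintB ?margV ?Rint_cst//; exact: bmf_cst.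
rewrite -RintZr//; apply: le_Rint => [| |x].
- by apply: bmf_norm; exact: bmfM.
- by apply: bmfM => //; exact: bmf_cst.
- have Kge : 0 <= K (x, y) - k0 by rewrite subr_ge0.
  by rewrite normrM (ger0_norm Kge) ler_wpM2l.
Qed.

(** A bounded kernel sends integrable functions to bounded ones. Measurability is shown on the
    positive and negative parts of the integrand, since [h] may be unbounded. *)
Lemma kernel_op_bmf_integrable h : mu.-integrable setT (EFin \o h) -> bmf (A h).
Proof.
move=> ih; have mh : measurable_fun setT h by apply/measurable_EFinP; exact: measurable_int ih.
have [M M0 KM] := bmf_bnd bK; split; last first.
  exists (M * \int[mu]_x `|h x|) => y.
  have iKh : mu.-integrable setT (EFin \o (fun x => K (x, y) * h x)).
    have := @integrableMr _ _ _ mu setT measurableT (fun x => K (x, y)) (EFin \o h) (bmf_meas (bKy y)) _ ih.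
    by apply; exists M; split; [exact: num_real|move=> r Mr x _; exact: le_trans (KM _) (ltW Mr)].
  have ihn : mu.-integrable setT (EFin \o (fun x => `|h x|)) by exact: integrable_norm.
  apply: le_trans (le_normr_Rintegral _ iKh) _ => //.
  rewrite -RintegralZl//; apply: le_Rintegral => //.
  - exact: integrable_norm.
  - have := integrableZl measurableT M ihn.
    by apply: eq_integrable => //.
  - by move=> x _; rewrite normrM ler_wpM2r.
have mf : measurable_fun setT (fun z : U * V => (K z * h z.1)%:E).
  apply/measurable_EFinP; apply: measurable_funM; first exact: bmf_meas.
  exact: (measurableT_comp mh).
have mp := measurable_funepos mf; have mn := measurable_funeneg mf.
have Mp := @measurable_fun_fubini_tonelli_G _ _ U V R mu _ mp (fun z => funepos_ge0 _ z).
have Mn := @measurable_fun_fubini_tonelli_G _ _ U V R mu _ mn (fun z => funeneg_ge0 _ z).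
apply: (measurableT_comp (fine_measurable _)) => //.
have -> : (fun y => \int[mu]_x (K (x, y) * h x)%:E)%E =
  (fun y => fubini_G mu ((fun z : U * V => (K z * h z.1)%:E)^\+)%E y - fubini_G mu ((fun z : U * V => (K z * h z.1)%:E)^\-)%E y)%E.
  apply/funext => y; rewrite integralE /fubini_G; congr (_ - _)%E; apply: eq_integral => x _.
    by rewrite !funeposE.
  by rewrite !funenegE.
exact: emeasurable_funB.
Qed.

Lemma kernel_op_ae h h' y : measurable_fun setT h -> measurable_fun setT h' ->
  ae_eq mu setT h h' -> A h y = A h' y.
Proof.
move=> mh mh' hh'; rewrite /kernel_op /Rintegral; congr fine.
apply: ae_eq_integral => //.
- by apply/measurable_EFinP; apply: measurable_funM => //; exact: bmf_meas.
- by apply/measurable_EFinP; apply: measurable_funM => //; exact: bmf_meas.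
- by apply: filterS hh' => x /= e xT; rewrite e.
Qed.

End markov.

Lemma geometric_bound_eq0 (R : realType) (x C th : R) : 0 <= th -> th < 1 ->
  (forall n, `|x| <= C * th ^+ n) -> x = 0.
Proof.
move=> th0 th1 xC; apply/eqP; rewrite -normr_le0.
have cv : (fun n => C * th ^+ n) @ \oo --> C * 0.
  by apply: cvgM; [exact: cvg_cst|apply: cvg_expr; rewrite ger0_norm].
rewrite -(mulr0 C); apply: (cvgr_to_ge cv); near=> n; exact: xC.
Unshelve. all: by end_near.
Qed.

(** * Inversion on mean-zero functions *)

Section resolvent.
Context {R : realType} d1 d2 {U : measurableType d1} {V : measurableType d2}.
Variables (mu : probability U R) (nu : probability V R).
Variables (K : U * V -> R) (k0 : R).
Hypotheses (bK : bmf K) (K0 : forall z, k0 <= K z) (k0_gt0 : 0 < k0).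
Hypothesis margU : forall x, \int[nu]_y K (x, y) = 1.
Hypothesis margV : forall y, \int[mu]_x K (x, y) = 1.

Local Notation A := (kernel_op mu K).
Local Notation A' := (kernel_op nu (swap_kernel K)).
Let th := 1 - k0.
Let bK' : bmf (swap_kernel K). Proof. exact: bmf_swap_kernel. Qed.
Let K'0 z : k0 <= swap_kernel K z. Proof. exact: K0. Qed.

Let th0 : 0 <= th.
Proof. by rewrite subr_ge0 -(margU point) ; apply: Rint_ge => //; exact: bmf_pair1. Qed.

Let th1 : th < 1. Proof. by rewrite ltrBlDr ltrDl. Qed.

Let B f := A' (A f).

Let B_bmf f : bmf f -> bmf (B f).
Proof. by move=> bf; apply: kernel_op_bmf => //; exact: kernel_op_bmf. Qed.

Let B_mean f : bmf f -> \int[mu]_x B f x = \int[mu]_x f x.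
Proof.
move=> bf; rewrite (kernel_op_mean nu bK' margV); last exact: kernel_op_bmf.
exact: kernel_op_mean.
Qed.

Let B_contract f M x : bmf f -> \int[mu]_x f x = 0 -> (forall x, `|f x| <= M) ->
  `|B f x| <= th * M.
Proof.
move=> bf f0 fM; apply: (kernel_op_le bK' K'0 k0_gt0 margU); first exact: kernel_op_bmf.
by move=> y; exact: kernel_op_contract.
Qed.

Lemma markov_fixpoint f : bmf f -> \int[mu]_x f x = 0 ->
  (forall x, f x = A' (A f) x) -> forall x, f x = 0.
Proof.
move=> bf f0 fB x; have [M M0 fM] := bmf_bnd bf.
apply: (geometric_bound_eq0 (C := M) th0 th1) => n.
elim: n x => [|n IH] x; first by rewrite expr0 mulr1.
rewrite fB exprSr mulrA mulrC -/(B f x); apply: B_contract => //.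
Qed.

(** The Neumann series, summed in the supremum norm, where the composed operator contracts bounded
    functions of mean zero by [th]. *)
Lemma resolvent_exists r : bmf r -> \int[mu]_x r x = 0 ->
  exists2 f, bmf f /\ \int[mu]_x f x = 0 & forall x, f x - A' (A f) x = r x.
Proof.
move=> br r0; have [M M0 rM] := bmf_bnd br.
pose s k := iter k B r.
have bs k : bmf (s k) by elim: k => // k IH; exact: B_bmf.
have s0 k : \int[mu]_x s k x = 0 by elim: k => // k IH; rewrite /s iterS B_mean; [exact: IH|exact: bs].
have sM k x : `|s k x| <= M * th ^+ k.
  elim: k x => [|k IH] x; first by rewrite expr0 mulr1.
  by rewrite exprSr mulrA mulrC /s iterS; apply: B_contract; [exact: bs|exact: s0|exact: IH].
pose a n x := \sum_(k < n) s k x.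
have ba n : bmf (a n) by exact: bmf_sum.
have step x n : `|a n.+1 x - a n x| <= M * th ^+ n.
  by rewrite /a big_ord_recr/= addrAC subrr add0r.
have lim x := geometric_step_cvg th0 th1 (step x).
have /boolp.choice[f fE] : forall x, exists y, (a ^~ x @ \oo --> y) /\
    (forall n, `|a n x - y| <= M * th ^+ n / (1 - th)).
  by move=> x; have [y ? ?] := lim x; exists y.
have bf : bmf f.
  split.
    by apply: (@measurable_fun_cvg _ _ _ setT a) => [n|x _]; [exact: bmf_meas|exact: (fE x).1].
  exists (M / (1 - th)) => x; have := (fE x).2 0%N.
  by rewrite /a big_ord0 expr0 mulr1 sub0r normrN.
exists f; first split => //.
  apply: (geometric_bound_eq0 (C := M / (1 - th)) th0 th1) => n.
  have am : \int[mu]_x a n x = 0 by rewrite Rint_sum// big1.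
  rewrite -[X in `|X|]subr0 -[X in _ - X]am distrC -RintB// mulrAC.
  by apply: norm_Rint_le => [|x]; [exact: bmfB|exact: (fE x).2].
move=> x; apply/eqP; rewrite -subr_eq0; apply/eqP.
apply: (geometric_bound_eq0 (C := 2 * (M / (1 - th))) th0 th1) => n.
(* Applying the operator shifts the partial sums of the series, up to their first term. *)
have Ba : B (a n) x = a n.+1 x - r x.
  have bA k : bmf (A (s k)) by exact: kernel_op_bmf.
  rewrite /B (_ : A (a n) = fun y => \sum_(k < n) A (s k) y); last first.
    by apply/funext => y; exact: kernel_op_sum.
  rewrite (kernel_op_sum nu bK' n x bA) /a big_ord_recl/= addrAC subrr add0r.
  by apply: eq_bigr => i _; rewrite /s -iterS.
have e1 : `|a n.+1 x - f x| <= M * th ^+ n / (1 - th).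
  apply: le_trans ((fE x).2 n.+1) _; rewrite ler_wpM2r ?invr_ge0 ?subr_ge0 ?(ltW th1)//.
  by rewrite ler_wpM2l// exprS ler_piMl ?exprn_ge0// ltW.
have e2 : `|B (a n) x - B f x| <= M * th ^+ n / (1 - th).
  rewrite /B -kernel_opB//; [|exact: kernel_op_bmf|exact: kernel_op_bmf].
  rewrite (_ : (fun y => A (a n) y - A f y) = A (fun x => a n x - f x)); last first.
    by apply/funext => y; rewrite kernel_opB.
  have bd : bmf (fun x => a n x - f x) by exact: bmfB.
  apply: (kernel_op_le bK' K'0 k0_gt0 margU); first exact: kernel_op_bmf.
  by move=> y; apply: (kernel_op_le bK K0 k0_gt0 margV) => // x'; exact: (fE x').2.
rewrite (_ : _ - r x = (B (a n) x - B f x) - (a n.+1 x - f x)); last by rewrite Ba /B; ring.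
apply: le_trans (ler_normB _ _) _.
rewrite (_ : 2 * _ * _ = M * th ^+ n / (1 - th) + M * th ^+ n / (1 - th)); last by ring.
exact: lerD.
Qed.

(** A merely integrable solution coincides almost everywhere with [r] plus its image, which is
    bounded; that function solves the equation at every point, so its difference with [f] is a
    bounded fixed point and vanishes. *)
Lemma resolvent_unique r f h : bmf r -> bmf f -> \int[mu]_x f x = 0 ->
  (forall x, f x - A' (A f) x = r x) ->
  mu.-integrable setT (EFin \o h) -> \int[mu]_x h x = 0 ->
  {ae mu, forall x, h x - A' (A h) x = r x} -> ae_eq mu setT h f.
Proof.
move=> br bf f0 fE ih h0 hE.
have mh : measurable_fun setT h by apply/measurable_EFinP; exact: measurable_int ih.
pose g x := r x + A' (A h) x.
have bAh : bmf (A h) by exact: kernel_op_bmf_integrable.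
have bg : bmf g by apply: bmfD => //; exact: kernel_op_bmf.
have hg : ae_eq mu setT h g.
  by apply: filterS hE => x /= e _; rewrite /g -e subrK.
have AE : A h = A g.
  by apply/funext => y; apply: kernel_op_ae => //; exact: bmf_meas.
have g0 : \int[mu]_x g x = 0.
  rewrite -h0 /Rintegral; congr fine; apply: ae_eq_integral => //.
  - by apply/measurable_EFinP; exact: bmf_meas.
  - exact: measurable_int ih.
  - by apply: filterS hg => x /= e xT; rewrite e.
have gf x : g x - f x = 0.
  move: x; apply: markov_fixpoint; first exact: bmfB.
    by rewrite RintB// g0 f0 subrr.
  move=> x; have -> : A (fun x => g x - f x) = fun y => A g y - A f y.
    by apply/funext => y; exact: kernel_opB.
  rewrite kernel_opB//; [|exact: kernel_op_bmf|exact: kernel_op_bmf].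
  by have := fE x; rewrite {1}/g AE; lra.
by apply: filterS hg => x /= e xT; rewrite e// -[RHS]add0r -(gf x) subrK.
Qed.

(** Eliminating [g] leaves one equation for [f], whose right-hand side has mean zero exactly because
    [p] and [q] have equal means. *)
Lemma resolvent_system p q : bmf p -> bmf q -> \int[mu]_x p x = \int[nu]_y q y ->
  exists f g, [/\ bmf f, bmf g, \int[mu]_x f x = 0,
    forall x, f x + A' g x = p x & forall y, g y + A f y = q y].
Proof.
move=> bp bq pq.
have br : bmf (fun x => p x - A' q x) by apply: bmfB => //; exact: kernel_op_bmf.
have r0 : \int[mu]_x (p x - A' q x) = 0.
  rewrite RintB//; last exact: kernel_op_bmf.
  by rewrite (kernel_op_mean nu bK' margV)// pq subrr.
have [f [bf f0] fE] := resolvent_exists br r0.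
have bAf : bmf (A f) by exact: kernel_op_bmf.
exists f, (fun y => q y - A f y); split => //.
- exact: bmfB.
- by move=> x; rewrite kernel_opB//; have := fE x; lra.
- by move=> y; rewrite subrK.
Qed.

End resolvent.

Lemma bmf_Lfun2 (R : realType) d (U : measurableType d) (mu : probability U R)
    (f : U -> R) : bmf f -> f \in Lfun mu 2%:E.
Proof.
move=> bf; rewrite inE; apply/andP; split; rewrite inE/=; first exact: bmf_meas.
rewrite /finite_norm unlock poweR_lty//.
under eq_integral => x _ /= do rewrite powR_mulrn//.
apply/integrable_lty => //.
exact: (bmf_int mu (bmfX 2 (bmf_norm bf))).
Qed.

Lemma L20_integrable (R : realType) (T : ptopologicalType)
    (mu : probability (borel T) R) (h : T -> R) : L20 mu h ->
  mu.-integrable setT (EFin \o h).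
Proof.
move=> [hL _]; apply/Lfun1_integrable; apply: (Lfun_subset12 _ hL).
exact: fin_num_measure.
Qed.

Lemma ae_eq_fst (R : realType) d1 d2 (U : measurableType d1) (V : measurableType d2)
    (mu : probability U R) (nu : probability V R) (f g : U -> R) :
  ae_eq mu setT f g -> ae_eq (prodP mu nu) setT (fun z => f z.1) (fun z => g z.1).
Proof.
move=> [N [mN N0 fN]]; exists (N `*` setT); split; first exact: measurableX.
  by apply: etrans (product_measure1E mu nu mN measurableT) _; rewrite N0 mul0e.
by move=> z /= nz; split => //; apply: fN => /= h; apply: nz => _; exact: h.
Qed.

Lemma ae_eq_snd (R : realType) d1 d2 (U : measurableType d1) (V : measurableType d2)
    (mu : probability U R) (nu : probability V R) (f g : V -> R) :
  ae_eq nu setT f g -> ae_eq (prodP mu nu) setT (fun z => f z.2) (fun z => g z.2).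
Proof.
move=> [N [mN N0 fN]]; exists (setT `*` N); split; first exact: measurableX.
  by apply: etrans (product_measure1E mu nu measurableT mN) _; rewrite N0 mule0.
by move=> z /= nz; split => //; apply: fN => /= h; apply: nz => _; exact: h.
Qed.

Lemma Rint_ae (R : realType) d (U : measurableType d) (mu : probability U R) (f g : U -> R) :
  measurable_fun setT f -> measurable_fun setT g -> ae_eq mu setT f g ->
  \int[mu]_x f x = \int[mu]_x g x.
Proof.
move=> mf mg fg; rewrite /Rintegral; congr fine; apply: ae_eq_integral => //.
- exact/measurable_EFinP.
- exact/measurable_EFinP.
- by apply: filterS fg => x /= e xT; rewrite e.
Qed.

Lemma covariance_ae (R : realType) d (U : measurableType d) (mu : probability U R)
    (X Y X' Y' : U -> R) : measurable_fun setT X -> measurable_fun setT Y ->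
  bmf X' -> bmf Y' -> ae_eq mu setT X X' -> ae_eq mu setT Y Y' ->
  \int[mu]_x X' x = 0 -> \int[mu]_x Y' x = 0 ->
  fine (covariance mu X Y) = \int[mu]_x (X' x * Y' x).
Proof.
move=> mX mY bX bY XX YY X0 Y0; rewrite !unlock.
rewrite -/(\int[mu]_x X x) -/(\int[mu]_x Y x).
rewrite (Rint_ae mX (bmf_meas bX) XX) (Rint_ae mY (bmf_meas bY) YY) X0 Y0.
rewrite -/(\int[mu]_x (((X \- cst 0) * (Y \- cst 0)) x)); apply: Rint_ae => /=.
- by apply: measurable_funM; apply: measurable_funB.
- exact: bmf_meas (bmfM bX bY).
- by apply: filterS2 XX YY => x /= e1 e2 xT; rewrite /= -e1// -e2// mulrfctE/= !subr0.
Qed.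

(** * The limit covariance in terms of bounded influence functions *)

Section covariance_matrix.
Context {R : realType} {T : ptopologicalType}.
Variables (c : T * T -> R).
Hypotheses (c_meas : measurable_fun [set: (borel T * borel T)%type] c) (c_bnd : bounded_by_some c).
Variables (P Q : probability (borel T) R).
Local Notation K := (Defs.xi c P Q : borel T * borel T -> R).

(** The bounded solution shows that the set searched by [get] is nonempty, and uniqueness identifies
    the chosen representative with it almost everywhere. *)
Lemma inv_L20_ae (mu nu : probability (borel T) R) (k : borel T * borel T -> R) (k0 : R)
    (r f : borel T -> R) : bmf k -> (forall z, k0 <= k z) -> 0 < k0 ->
  (forall x, \int[nu]_y k (x, y) = 1) -> (forall y, \int[mu]_x k (x, y) = 1) ->
  bmf r -> bmf f -> \int[mu]_x f x = 0 ->
  (forall x, f x - kernel_op nu (swap_kernel k) (kernel_op mu k f) x = r x) ->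
  let h := inv_L20 mu (kernel_op nu (swap_kernel k) \o kernel_op mu k) r in
  measurable_fun [set: borel T] h /\ ae_eq mu setT h f.
Proof.
move=> bk k0k k00 mU mV br bf f0 fE h.
have [hL hE] : L20 mu h /\ {ae mu, forall x, h x - kernel_op nu (swap_kernel k) (kernel_op mu k h) x = r x}.
  apply: (@getPex _ [set h | L20 mu h /\ {ae mu, forall x, h x - (kernel_op nu (swap_kernel k) \o kernel_op mu k) h x = r x}]).
  exists f; split; first by split => //; exact: bmf_Lfun2.
  by apply: aeW => x; exact: fE.
have ih := L20_integrable hL.
split; first by apply/measurable_EFinP; exact: measurable_int ih.
exact: (resolvent_unique bk k0k k00 mU mV br bf f0 fE ih hL.2 hE).
Qed.

(** Eliminating one unknown from the system gives the two resolvent equations in [Zlim]. The first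
    is solved by [p]; the second by [q] minus its mean, since [q] itself is not centred and the
    operators preserve constants. *)
Lemma influence_functions t : exists p q : borel T -> R,
  [/\ bmf p, bmf q, \int[P]_x p x = 0,
   (forall x, p x + opQ c P Q q x = eta_x c P Q t x) /\
   (forall y, q y + opP c P Q p y = eta_y c P Q t y) &
   forall lambda, exists2 Z : borel T * borel T -> R,
     measurable_fun setT Z & Z = Zlim c P Q lambda t /\
     ae_eq (prodP P Q) setT Z (fun z => Num.sqrt lambda * p z.1 +
       Num.sqrt (1 - lambda) * (q z.2 - \int[Q]_y q y))].
Proof.
have [k0 [k1 [bK k00 k01 K0 K1]]] := xi_bounds c_meas c_bnd P Q.
have mU := xi_Q c_meas c_bnd P Q; have mV := xi_P c_meas c_bnd P Q.
have bh : bmf (fun z : borel T * borel T => Defs.eta c t z * K z).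
  by apply: bmfM => //; exact: bmf_eta.
have bx : bmf (eta_x c P Q t : borel T -> R) := bmf_Rint2 Q bh.
have by' : bmf (eta_y c P Q t : borel T -> R) := bmf_Rint1 P bh.
have exy : \int[P]_x eta_x c P Q t x = \int[Q]_y eta_y c P Q t y by exact: (Rint_swap P Q bh).
have [p [q [bp bq p0 pE qE]]] := resolvent_system bK K0 k00 mU mV bx by' exy.
exists p, q; split => // lambda.
set th := \int[Q]_y q y.
have bK' := bmf_swap_kernel bK.
have bAp : bmf (kernel_op P K p) by exact: kernel_op_bmf.
have bAq : bmf (kernel_op Q (swap_kernel K) q) by exact: kernel_op_bmf.
have br1 : bmf (eta_x c P Q t \- opQ c P Q (eta_y c P Q t) : borel T -> R).
  by apply: bmfB => //; exact: (kernel_op_bmf Q bK' by').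
have br2 : bmf (eta_y c P Q t \- opP c P Q (eta_x c P Q t) : borel T -> R).
  by apply: bmfB => //; exact: (kernel_op_bmf P bK bx).
have f1 x : p x - kernel_op Q (swap_kernel K) (kernel_op P K p) x =
    (eta_x c P Q t \- opQ c P Q (eta_y c P Q t)) x.
  have -> : p x = eta_x c P Q t x - opQ c P Q q x by rewrite -(pE x) addrK.
  have qE' : q = fun y => eta_y c P Q t y - kernel_op P K p y.
    by apply/funext => y; rewrite -(qE y) addrK.
  have := kernel_opB Q bK' x by' bAp; rewrite -qE' => e.
  by move: e; rewrite /opQ /kernel_op /swap_kernel /= => ->; ring.
have bq0 : bmf (fun y => q y - th) by apply: bmfB => //; exact: bmf_cst.
have q0 : \int[Q]_y (q y - th) = 0.
  by rewrite RintB//; [rewrite Rint_cst subrr|exact: bmf_cst].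
have bK'' := bmf_swap_kernel bK'.
have f2 y : (q y - th) - kernel_op P K (kernel_op Q (swap_kernel K) (fun y => q y - th)) y =
    (eta_y c P Q t \- opP c P Q (eta_x c P Q t)) y.
  have -> : kernel_op Q (swap_kernel K) (fun y => q y - th) =
      fun x => (eta_x c P Q t x - p x) - th.
    apply/funext => x; rewrite (kernel_opB Q bK' x bq (bmf_cst th)).
    by rewrite (kernel_op_cst bK' mU) -(pE x) /opQ /kernel_op /=; ring.
  rewrite (kernel_opB P bK y (bmfB bx bp) (bmf_cst th)) (kernel_opB P bK y bx bp).
  rewrite (kernel_op_cst bK mV) /= -(qE y) /opP /kernel_op; ring.
have [m1 e1] := inv_L20_ae bK K0 k00 mU mV br1 bp p0 f1.
have K'0 z : k0 <= swap_kernel K z by exact: K0.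
have [m2 e2] := inv_L20_ae bK' K'0 k00 mV mU br2 bq0 q0 f2.
exists (Zlim c P Q lambda t); last split => //.
  apply: measurable_funD; apply: measurable_funM => //.
    exact: (measurableT_comp m1 measurable_fst).
  exact: (measurableT_comp m2 measurable_snd).
have E1 := ae_eq_fst Q e1; have E2 := ae_eq_snd P e2.
by apply: filterS2 E1 E2 => z /= h1 h2 _; rewrite /Zlim -h1// -h2.
Qed.

Lemma SigmaE lambda l (t : 'I_l -> R) : 0 < lambda < 1 ->
  exists p q : 'I_l -> borel T -> R,
  [/\ (forall i, bmf (p i) /\ \int[P]_x p i x = 0), (forall i, bmf (q i)),
   (forall i, (forall x, p i x + opQ c P Q (q i) x = eta_x c P Q (t i) x) /\
     (forall y, q i y + opP c P Q (p i) y = eta_y c P Q (t i) y)) &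
   forall i j, Sigma c P Q lambda t i j = lambda * (\int[P]_x (p i x * p j x)) +
     (1 - lambda) * (\int[Q]_y ((q i y - \int[Q]_y q i y) * (q j y - \int[Q]_y q j y)))].
Proof.
move=> /andP[l0 l1].
have /boolp.choice[pq pqE] : forall i, exists pq : (borel T -> R) * (borel T -> R),
  [/\ bmf pq.1, bmf pq.2, \int[P]_x pq.1 x = 0,
   (forall x, pq.1 x + opQ c P Q pq.2 x = eta_x c P Q (t i) x) /\
   (forall y, pq.2 y + opP c P Q pq.1 y = eta_y c P Q (t i) y) &
   forall lambda, exists2 Z : borel T * borel T -> R,
     measurable_fun setT Z & Z = Zlim c P Q lambda (t i) /\
     ae_eq (prodP P Q) setT Z (fun z => Num.sqrt lambda * pq.1 z.1 +
       Num.sqrt (1 - lambda) * (pq.2 z.2 - \int[Q]_y pq.2 y))].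
  by move=> i; have [p [q pqE]] := influence_functions (t i); exists (p, q).
exists (fun i => (pq i).1), (fun i => (pq i).2).
split=> [i|i|i|i j]; [by case: (pqE i)|by case: (pqE i)|by case: (pqE i)|].
have [bpi bqi pi0 _ /(_ lambda)[Zi mZi [ZiE eZi]]] := pqE i.
have [bpj bqj pj0 _ /(_ lambda)[Zj mZj [ZjE eZj]]] := pqE j.
rewrite mxE -ZiE -ZjE.
move: (pq i).1 (pq i).2 (pq j).1 (pq j).2 bpi bqi pi0 bpj bqj pj0 eZi eZj => p q p' q'.
move=> bp bq p0 bp' bq' p'0 eZi eZj.
have b0 (f : borel T -> R) : bmf f -> bmf (fun y => f y - \int[Q]_y f y).
  by move=> bf; apply: bmfB => //; exact: bmf_cst.
have m0 (f : borel T -> R) : bmf f -> \int[Q]_y (f y - \int[Q]_y f y) = 0.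
  by move=> bf; rewrite RintB//; [rewrite Rint_cst subrr|exact: bmf_cst].
have bZ (f g : borel T -> R) : bmf f -> bmf g ->
    bmf (fun z : borel T * borel T => Num.sqrt lambda * f z.1 + Num.sqrt (1 - lambda) * g z.2).
  by move=> bf bg; apply: bmfD; apply: bmfM; [exact: bmf_cst|exact: bmf_fst|exact: bmf_cst|exact: bmf_snd].
have mZ (f g : borel T -> R) : bmf f -> bmf g -> \int[P]_x f x = 0 -> \int[Q]_y g y = 0 ->
    \int[prodP P Q]_z (Num.sqrt lambda * f z.1 + Num.sqrt (1 - lambda) * g z.2) = 0.
  move=> bf bg f0 g0; have b1 := bmf_fst (borel T) bf; have b2 := bmf_snd (borel T) bg.
  rewrite RintD; [|by apply: bmfM => //; exact: bmf_cst|by apply: bmfM => //; exact: bmf_cst].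
  rewrite (RintZl (prodP P Q) _ b1) (RintZl (prodP P Q) _ b2).
  by rewrite (Rint_prod_fst P Q bf) (Rint_prod_snd P Q bg) f0 g0 !mulr0 addr0.
rewrite (covariance_ae mZi mZj (bZ _ _ bp (b0 _ bq)) (bZ _ _ bp' (b0 _ bq')) eZi eZj); last 2 first.
- exact: mZ _ _ bp (b0 _ bq) p0 (m0 _ bq).
- exact: mZ _ _ bp' (b0 _ bq') p'0 (m0 _ bq').
pose g y := q y - \int[Q]_y q y; pose g' y := q' y - \int[Q]_y q' y.
have bg : bmf g := b0 _ bq; have bg' : bmf g' := b0 _ bq'.
have g0 : \int[Q]_y g y = 0 := m0 _ bq; have g'0 : \int[Q]_y g' y = 0 := m0 _ bq'.
have b1 := bmf_fst (borel T) bp; have b1' := bmf_fst (borel T) bp'.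
have b2 := bmf_snd (borel T) bg; have b2' := bmf_snd (borel T) bg'.
have bpp : bmf (fun x => p x * p' x) by exact: bmfM.
have bgg : bmf (fun x => g x * g' x) by exact: bmfM.
have c11 := bmf_fst (borel T) bpp; have c22 := bmf_snd (borel T) bgg.
have c12 : bmf (fun z : borel T * borel T => p z.1 * g' z.2) by exact: bmfM.
have c21 : bmf (fun z : borel T * borel T => p' z.1 * g z.2) by exact: bmfM.
have sl : Num.sqrt lambda ^+ 2 = lambda by rewrite sqr_sqrtr// ltW.
have sl' : Num.sqrt (1 - lambda) ^+ 2 = 1 - lambda by rewrite sqr_sqrtr// subr_ge0 ltW.
set s := Num.sqrt lambda; set s' := Num.sqrt (1 - lambda).
have bZl r (f : borel T * borel T -> R) : bmf f -> bmf (fun z => r * f z).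
  by move=> bf; apply: bmfM => //; exact: bmf_cst.
transitivity (\int[prodP P Q]_z (lambda * (p z.1 * p' z.1) + (1 - lambda) * (g z.2 * g' z.2) +
    (s * s' * (p z.1 * g' z.2) + s * s' * (p' z.1 * g z.2)))).
  by apply: eq_Rintegral => z _; rewrite -sl' -/s' -sl -/s /g /g' /=; ring.
rewrite RintD; [|by apply: bmfD; exact: bZl|by apply: bmfD; exact: bZl].
rewrite RintD; [|exact: bZl|exact: bZl].
rewrite RintD; [|exact: bZl|exact: bZl].
rewrite (RintZl _ _ c11) (RintZl _ _ c22) (RintZl _ _ c12) (RintZl _ _ c21).
rewrite (Rint_prod_fst P Q bpp) (Rint_prod_snd P Q bgg).
have Z12 (f h : borel T -> R) : bmf f -> bmf h -> \int[Q]_y h y = 0 ->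
   \int[prodP P Q]_z (f z.1 * h z.2) = 0.
  move=> bf bh h0; rewrite Rint_prod12; last first.
    by apply: bmfM; [exact: (bmf_fst (borel T) bf)|exact: (bmf_snd (borel T) bh)].
  under eq_Rintegral => x _ /= do rewrite RintZl// h0 mulr0.
  by rewrite Rint_cst.
by rewrite !Z12// !mulr0 !addr0.
Qed.

End covariance_matrix.

(** * Asymptotic linearity of the empirical plan *)

(** The slope of the exponential between 0 and [s] is at least its smallest derivative on the
    interval, [expR (- M)]. *)
Lemma expR_increment_ge (R : realType) (M s : R) : `|s| <= M ->
  expR (- M) * s ^+ 2 <= (expR s - 1) * s.
Proof.
rewrite ler_norml => /andP[s1 s2].
have e1 := expR_ge1Dx s; have e2 := expR_ge1Dx (- s).
have es : expR (- s) * expR s = 1 by rewrite -expRD addNr expR0.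
have es0 := expR_gt0 s.
have [s0|s0] := leP 0 s.
  have h : expR (- M) <= 1 by rewrite expR_le1; lra.
  apply: (@le_trans _ _ (1 * s ^+ 2)); first by rewrite ler_wpM2r ?sqr_ge0.
  by rewrite mul1r expr2 ler_wpM2r//; lra.
have h : expR (- M) <= expR s by rewrite ler_expR.
apply: (@le_trans _ _ (expR s * s ^+ 2)); first by rewrite ler_wpM2r ?sqr_ge0.
rewrite expr2 mulrA ler_wnM2r ?(ltW s0)//.
have : (1 - s) * expR s <= expR (- s) * expR s by rewrite ler_wpM2r ?expR_ge0//; lra.
lra.
Qed.

Lemma expR_taylor2 (R : realType) (M s : R) : 0 <= M -> `|s| <= M ->
  `|expR s - 1 - s| <= expR M * s ^+ 2.
Proof.
move=> M0; rewrite ler_norml => /andP[s1 s2].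
have e1 := expR_ge1Dx s; have e2 := expR_ge1Dx (- s).
have es : expR (- s) * expR s = 1 by rewrite -expRD addNr expR0.
have es0 := expR_gt0 s.
have a : (1 - s) * expR s <= expR (- s) * expR s by rewrite ler_wpM2r ?expR_ge0//; lra.
rewrite ger0_norm; last lra.
apply: (@le_trans _ _ (s * (expR s - 1))); first lra.
have [s0|s0] := leP 0 s.
  apply: (@le_trans _ _ (expR s * s ^+ 2)).
    rewrite expr2 mulrA [expR s * s]mulrC -mulrA ler_wpM2l// mulrC; lra.
  by rewrite ler_wpM2r ?sqr_ge0// ler_expR.
apply: (@le_trans _ _ (1 * s ^+ 2)).
  by rewrite mul1r expr2 ler_wnM2l ?(ltW s0)//; lra.
by rewrite ler_wpM2r ?sqr_ge0// -expR0 ler_expR.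
Qed.

(** * Stability of tilted kernels *)

Section perturbation.
Context {R : realType} d1 d2 {U : measurableType d1} {V : measurableType d2}.
Variables (mu : probability U R) (nu : probability V R).
Variables (K : U * V -> R) (k0 k1 : R).
Hypotheses (bK : bmf K) (k0_gt0 : 0 < k0) (K0 : forall z, k0 <= K z) (K1 : forall z, K z <= k1).
Local Notation pi := (prodP mu nu).

Lemma Rint_fstM f g : bmf f -> bmf g ->
  \int[pi]_z (f z.1 * g z) = \int[mu]_x (f x * \int[nu]_y g (x, y)).
Proof.
move=> bf bg; rewrite Rint_prod12; last by apply: bmfM => //; exact: bmf_fst.
by apply: eq_Rintegral => x _ /=; rewrite RintZl//; exact: bmf_pair1.
Qed.

Lemma Rint_sndM f g : bmf f -> bmf g ->
  \int[pi]_z (f z.2 * g z) = \int[nu]_y (f y * \int[mu]_x g (x, y)).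
Proof.
move=> bf bg; rewrite Rint_prod21; last by apply: bmfM => //; exact: bmf_snd.
by apply: eq_Rintegral => x _ /=; rewrite RintZl//; exact: bmf_pair2.
Qed.

Section tilt.
Variables (a : U -> R) (b : V -> R).
Hypotheses (ba : bmf a) (bb : bmf b).
Local Notation s z := (a z.1 + b z.2).
Hypothesis margU : forall x, \int[nu]_y (K (x, y) * expR (a x + b y)) = 1.
Hypothesis margV : forall y, \int[mu]_x (K (x, y) * expR (a x + b y)) = 1.
Hypothesis b0 : \int[nu]_y b y = 0.

Let bs : bmf (fun z : U * V => s z).
Proof. by apply: bmfD; [exact: bmf_fst|exact: bmf_snd]. Qed.

(** The second marginal equation gives [expR (- b y)] as an integral of [K (x, y)] against a weight
    independent of [y]; changing [y] alters the kernel by a factor at most [k1 / k0]. *)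
Lemma tilt_osc y y' : b y' - b y <= ln (k1 / k0).
Proof.
have k1_gt0 : 0 < k1 by have z : U * V := (point, point); exact: lt_le_trans k0_gt0 (le_trans (K0 z) (K1 z)).
have bE y1 : bmf (fun x => K (x, y1) * expR (a x + b y1)).
  by apply: bmfM; [exact: bmf_pair2|exact: bmf_expR (bmf_pair2 y1 bs)].
rewrite -ler_expR lnK ?posrE ?divr_gt0//.
have : \int[mu]_x (expR (b y' - b y) * (K (x, y) * expR (a x + b y))) <=
   \int[mu]_x (k1 / k0 * (K (x, y') * expR (a x + b y'))).
  apply: le_Rint => [| |x]; try by apply: bmfM; [exact: bmf_cst|].
  rewrite [leLHS](_ : _ = K (x, y) * expR (a x + b y')); last first.
    by rewrite mulrCA -expRD; congr (_ * expR _); ring.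
  rewrite mulrA ler_wpM2r ?expR_ge0//; apply: le_trans (K1 _) _.
  by rewrite -[leLHS]mulr1 -mulrA ler_wpM2l ?(ltW k1_gt0)// ler_pdivlMl// mulr1.
by rewrite !RintZl// !margV !mulr1.
Qed.

(** A function of mean zero is bounded by its oscillation. The bound depends on the kernel only, not
    on [mu] and [nu], and so holds for every sample. *)
Lemma tilt_bound2 y : `|b y| <= ln (k1 / k0).
Proof.
have bB y1 : bmf (fun y' => b y' - b y1) by apply: bmfB => //; exact: bmf_cst.
have bC y1 : bmf (fun y' => b y1 - b y') by apply: bmfB => //; exact: bmf_cst.
rewrite ler_norml; apply/andP; split.
  have := Rint_le nu (bB y) (fun y' => tilt_osc y y').
  by rewrite RintB//; [rewrite b0 Rint_cst; lra|exact: bmf_cst].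
have := Rint_le nu (bC y) (fun y' => tilt_osc y' y).
by rewrite RintB//; [rewrite b0 Rint_cst; lra|exact: bmf_cst].
Qed.

Lemma tilt_bound1 x : `|a x| <= `|ln k0| + `|ln k1| + ln (k1 / k0).
Proof.
have k1_gt0 : 0 < k1 by have z : U * V := (point, point); exact: lt_le_trans k0_gt0 (le_trans (K0 z) (K1 z)).
have bE : bmf (fun y => K (x, y) * expR (b y)).
  by apply: bmfM; [exact: bmf_pair1|exact: bmf_expR].
have E : expR (- a x) = \int[nu]_y (K (x, y) * expR (b y)).
  rewrite -[LHS]mulr1 -(margU x) -RintZl; last first.
    by apply: bmfM; [exact: bmf_pair1|exact: bmf_expR (bmf_pair1 x bs)].
  by apply: eq_Rintegral => y _; rewrite mulrCA -expRD; congr (_ * expR _); ring.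
have lo : ln k0 - ln (k1 / k0) <= - a x.
  rewrite -ler_expR E expRD lnK ?posrE//; apply: Rint_ge => // y.
  apply: ler_pM; rewrite ?expR_ge0 ?(ltW k0_gt0)// ler_expR.
  by have := tilt_bound2 y; rewrite ler_norml => /andP[].
have hi : - a x <= ln k1 + ln (k1 / k0).
  rewrite -ler_expR E expRD lnK ?posrE//; apply: Rint_le => // y.
  apply: ler_pM; rewrite ?expR_ge0 ?(le_trans (ltW k0_gt0) (K0 _))// ler_expR.
  by have := tilt_bound2 y; rewrite ler_norml => /andP[].
have := ler_norm (ln k1); have := ler_norm (- ln k0); rewrite normrN.
have := ler_norm (ln k0); have := ler_norm (- ln k1); rewrite normrN.
by move=> *; rewrite ler_norml; apply/andP; split; lra.
Qed.

(** The cross term factors and [b] has mean zero: this is what the normalization of [b] is for,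
    since otherwise opposite constants in [a] and [b] would go unseen. *)
Lemma tilt_sqr : \int[pi]_z (s z ^+ 2) = \int[mu]_x (a x ^+ 2) + \int[nu]_y (b y ^+ 2).
Proof.
have b1 : bmf (fun z : U * V => a z.1) by exact: bmf_fst.
have b2 : bmf (fun z : U * V => b z.2) by exact: bmf_snd.
have bab : bmf (fun z : U * V => a z.1 * b z.2) by exact: bmfM.
have bx2 : bmf (fun x => a x ^+ 2) by exact: bmfX.
have by2 : bmf (fun y => b y ^+ 2) by exact: bmfX.
have b12 : bmf (fun z : U * V => a z.1 ^+ 2) by exact: bmfX.
have b22 : bmf (fun z : U * V => b z.2 ^+ 2) by exact: bmfX.
under eq_Rintegral => z _ do rewrite sqrrD mulr2n.
rewrite RintD//; last by apply: bmfD => //; exact: bmfD.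
rewrite RintD//; last exact: bmfD.
rewrite (Rint_prod_fst mu nu bx2) (Rint_prod_snd mu nu by2) RintD// (Rint_fstM ba b2).
under [X in _ + (X + X) + _]eq_Rintegral => x _ do rewrite b0 mulr0.
by rewrite Rint_cst !addr0.
Qed.

(** Testing the marginal equations against [a] and [b] expresses the integral of
    [K * (expR s - 1) * s], for [s] the sum [a + b], through the marginal defects of [K], while it
    is at least [k0 * expR (- M)] times the integral of [s ^+ 2]. *)
Lemma tilt_energy M : (forall z : U * V, `|s z| <= M) ->
  \int[mu]_x (a x ^+ 2) + \int[nu]_y (b y ^+ 2) <=
  (k0 * expR (- M)) ^- 2 * (\int[mu]_x ((\int[nu]_y K (x, y) - 1) ^+ 2) +
                \int[nu]_y ((\int[mu]_x K (x, y) - 1) ^+ 2)).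
Proof.
move=> sM; set kappa := k0 * expR (- M).
have kappa0 : 0 < kappa by rewrite mulr_gt0// expR_gt0.
set A := \int[mu]_x (a x ^+ 2); set B := \int[nu]_y (b y ^+ 2).
pose r x := \int[nu]_y K (x, y) - 1; pose q y := \int[mu]_x K (x, y) - 1.
rewrite -/(\int[mu]_x (r x ^+ 2)) -/(\int[nu]_y (q y ^+ 2)).
have br : bmf r by apply: bmfB; [exact: bmf_Rint2|exact: bmf_cst].
have bq : bmf q by apply: bmfB; [exact: bmf_Rint1|exact: bmf_cst].
have b1 : bmf (fun z : U * V => a z.1) by exact: bmf_fst.
have b2 : bmf (fun z : U * V => b z.2) by exact: bmf_snd.
have be : bmf (fun z : U * V => expR (s z)) by exact: bmf_expR.
have bKe : bmf (fun z => K z * (expR (s z) - 1)).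
  by apply: bmfM => //; apply: bmfB => //; exact: bmf_cst.
have bKe1 : bmf (fun z => K z * expR (s z)) by exact: bmfM.
have E1 : \int[pi]_z (a z.1 * (K z * (expR (s z) - 1))) = - \int[mu]_x (a x * r x).
  rewrite Rint_fstM// -[RHS]mulN1r -RintZl; last exact: bmfM.
  apply: eq_Rintegral => x _; rewrite (_ : \int[nu]_y _ = - r x); first by ring.
  under eq_Rintegral => y _ do rewrite mulrBr mulr1.
  rewrite RintB; [|exact: (bmf_pair1 x bKe1)|exact: bmf_pair1].
  by rewrite margU /r; ring.
have E2 : \int[pi]_z (b z.2 * (K z * (expR (s z) - 1))) = - \int[nu]_y (b y * q y).
  rewrite Rint_sndM// -[RHS]mulN1r -RintZl; last exact: bmfM.
  apply: eq_Rintegral => y _; rewrite (_ : \int[mu]_x _ = - q y); first by ring.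
  under eq_Rintegral => x _ do rewrite mulrBr mulr1.
  rewrite RintB; [|exact: (bmf_pair2 y bKe1)|exact: bmf_pair2].
  by rewrite margV /q; ring.
have E4 : kappa * (A + B) <= - (\int[mu]_x (a x * r x)) - \int[nu]_y (b y * q y).
  rewrite -E1 -E2 -tilt_sqr -RintD; [|exact: bmfM|exact: bmfM].
  rewrite -RintZl; last exact: bmfX.
  apply: le_Rint => [| |z]; [by apply: bmfM; [exact: bmf_cst|exact: bmfX]|by apply: bmfD; exact: bmfM|].
  rewrite -mulrDl (_ : s z * (K z * (expR (s z) - 1)) = K z * ((expR (s z) - 1) * s z)); last by ring.
  rewrite /kappa -mulrA.
  apply: ler_pM; [exact: ltW| |exact: K0|exact: expR_increment_ge].
  by apply: mulr_ge0; [exact: expR_ge0|exact: sqr_ge0].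
(* The weights are chosen so that half of [kappa * (A + B)] is absorbed on the left. *)
have young d (W : measurableType d) (rho : probability W R) (f g : W -> R) : bmf f -> bmf g ->
   - (\int[rho]_x (f x * g x)) <= kappa / 2 * (\int[rho]_x (f x ^+ 2)) + (2 * kappa)^-1 * \int[rho]_x (g x ^+ 2).
  move=> bf bg; have bf2 : bmf (fun x => f x ^+ 2) by exact: bmfX.
  have bg2 : bmf (fun x => g x ^+ 2) by exact: bmfX.
  rewrite -!RintZl// -mulN1r -RintZl; last exact: bmfM.
  rewrite -RintD; [|by apply: bmfM => //; exact: bmf_cst|by apply: bmfM => //; exact: bmf_cst].
  apply: le_Rint => [| |x].
  - by apply: bmfM; [exact: bmf_cst|exact: bmfM].
  - by apply: bmfD; apply: bmfM => //; exact: bmf_cst.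
  rewrite -subr_ge0 (_ : _ - _ = (2 * kappa)^-1 * (kappa * f x + g x) ^+ 2).
    by rewrite mulr_ge0 ?sqr_ge0// invr_ge0 mulr_ge0// ltW.
  by field; rewrite gt_eqF.
have y1 := young _ _ mu a r ba br; have y2 := young _ _ nu b q bb bq.
rewrite -/A in y1; rewrite -/B in y2.
set A' := \int[mu]_x (r x ^+ 2) in y1 *; set B' := \int[nu]_y (q y ^+ 2) in y2 *.
have : kappa / 2 * (A + B) <= (2 * kappa)^-1 * (A' + B').
  by move: y1 y2; move: (2 * kappa)^-1 => c y1 y2; rewrite !mulrDr in E4 *; lra.
rewrite -ler_pdivlMl ?divr_gt0// => h; apply: le_trans h _.
by rewrite le_eqVlt; apply/orP; left; apply/eqP; field; rewrite gt_eqF.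
Qed.

(** To first order [h] is integrated against [a + b] and so enters only through its marginals; the
    product of two small quantities is split by Young's inequality. The second order is bounded by
    the energy of the tilt. *)
Lemma tilt_expansion M H (h : U * V -> R) : 0 <= M -> (forall z : U * V, `|s z| <= M) ->
  bmf h -> (forall z, `|h z| <= H) ->
  `|\int[pi]_z (h z * expR (s z)) - \int[pi]_z h z| <=
  (H * expR M + 1) * (\int[mu]_x (a x ^+ 2) + \int[nu]_y (b y ^+ 2)) +
  (\int[mu]_x ((\int[nu]_y h (x, y)) ^+ 2) + \int[nu]_y ((\int[mu]_x h (x, y)) ^+ 2)).
Proof.
move=> M0 sM bh hH.
set A := \int[mu]_x (a x ^+ 2); set B := \int[nu]_y (b y ^+ 2).
pose r x := \int[nu]_y h (x, y); pose q y := \int[mu]_x h (x, y).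
rewrite -/(\int[mu]_x (r x ^+ 2)) -/(\int[nu]_y (q y ^+ 2)).
set A' := \int[mu]_x (r x ^+ 2); set B' := \int[nu]_y (q y ^+ 2).
have br : bmf r by exact: bmf_Rint2.
have bq : bmf q by exact: bmf_Rint1.
have b1 : bmf (fun z : U * V => a z.1) by exact: bmf_fst.
have b2 : bmf (fun z : U * V => b z.2) by exact: bmf_snd.
have be : bmf (fun z : U * V => expR (s z)) by exact: bmf_expR.
have b3 : bmf (fun z : U * V => expR (s z) - 1 - s z).
  by apply: bmfB => //; apply: bmfB => //; exact: bmf_cst.
have b4 : bmf (fun z => h z * (expR (s z) - 1 - s z)) by exact: bmfM.
have bah : bmf (fun z => a z.1 * h z) by exact: bmfM.
have bbh : bmf (fun z => b z.2 * h z) by exact: bmfM.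
have H0 : 0 <= H by exact: le_trans (hH point).
rewrite (_ : \int[pi]_z (h z * expR (s z)) - \int[pi]_z h z =
    \int[mu]_x (a x * r x) + \int[nu]_y (b y * q y) +
    \int[pi]_z (h z * (expR (s z) - 1 - s z))); last first.
  rewrite -(Rint_fstM ba bh) -(Rint_sndM bb bh) -RintB//; last exact: bmfM.
  rewrite -RintD// -RintD//; last exact: bmfD.
  by apply: eq_Rintegral => z _; ring.
have R3 : `|\int[pi]_z (h z * (expR (s z) - 1 - s z))| <= H * expR M * (A + B).
  apply: le_trans (norm_Rint pi b4) _; rewrite -tilt_sqr -RintZl; last exact: bmfX.
  apply: le_Rint => [| |z]; [exact: bmf_norm|by apply: bmfM; [exact: bmf_cst|exact: bmfX]|].
  by rewrite normrM -mulrA ler_pM// expR_taylor2.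
have young d (W : measurableType d) (rho : probability W R) (f g : W -> R) : bmf f -> bmf g ->
   `|\int[rho]_x (f x * g x)| <= (\int[rho]_x (f x ^+ 2) + \int[rho]_x (g x ^+ 2)) / 2.
  move=> bf bg; have bf2 : bmf (fun x => f x ^+ 2) by exact: bmfX.
  have bg2 : bmf (fun x => g x ^+ 2) by exact: bmfX.
  have bfg : bmf (fun x => f x * g x) by exact: bmfM.
  apply: le_trans (norm_Rint rho bfg) _; rewrite -RintD// -RintZr; last exact: bmfD.
  apply: le_Rint => [| |x]; [exact: bmf_norm|by apply: bmfM; [exact: bmfD|exact: bmf_cst]|].
  have p1 := sqr_ge0 (f x - g x); have p2 := sqr_ge0 (f x + g x).
  rewrite sqrrB in p1; rewrite sqrrD in p2.
  by rewrite ler_norml; apply/andP; split; lra.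
have y1 := young _ _ mu a r ba br; have y2 := young _ _ nu b q bb bq.
rewrite -/A -/A' in y1; rewrite -/B -/B' in y2.
have A0 : 0 <= A by apply: Rint_ge0 => x; exact: sqr_ge0.
have B0 : 0 <= B by apply: Rint_ge0 => x; exact: sqr_ge0.
have A'0 : 0 <= A' by apply: Rint_ge0 => x; exact: sqr_ge0.
have B'0 : 0 <= B' by apply: Rint_ge0 => x; exact: sqr_ge0.
have n1 := ler_normD (\int[mu]_x (a x * r x) + \int[nu]_y (b y * q y))
   (\int[pi]_z (h z * (expR (s z) - 1 - s z))).
have n2 := ler_normD (\int[mu]_x (a x * r x)) (\int[nu]_y (b y * q y)).
rewrite [_ * (A + B)]mulrDl mul1r; lra.
Qed.

End tilt.
End perturbation.

(** * Integration against empirical measures *)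

Section empirical_measure.
Context {R : realType} {T : ptopologicalType}.
Variables (n : nat) (x : nat -> T).
Hypothesis n0 : (0 < n)%N.

Let nV_ge0 : 0 <= n%:R^-1 :> R. Proof. by rewrite invr_ge0. Qed.

Lemma empiricalE (A : set (borel T)) :
  empirical (R := R) n x A =
  mscale (NngNum nV_ge0) (msum (fun i => \d_(x i : borel T)) n) A.
Proof.
rewrite /empirical /= /mnormalize /mscale /=.
have -> : msum (fun i => \d_(x i : borel T)) n setT = (n%:R : R)%:E.
  transitivity (\sum_(i < n) (1 : R)%:E)%E; last by rewrite sumEFin sumr_const card_ord.
  by apply: eq_bigr => i _; exact: diracT.
by rewrite orbF eqe pnatr_eq0 -leqn0 leqNgt n0/= muleC.
Qed.

Lemma Rint_empirical (f : borel T -> R) : bmf f ->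
  \int[empirical n x]_z f z = n%:R^-1 * \sum_(i < n) f (x i).
Proof.
move=> bf; have [M M0 fM] := bmf_bnd bf.
have n00 : n%:R != 0 :> R by rewrite pnatr_eq0 -lt0n.
have bg : bmf (fun z => f z + M) by apply: bmfD => //; exact: bmf_cst.
have g0 z : 0 <= f z + M by have := fM z; rewrite ler_norml => /andP[]; lra.
suff : \int[empirical n x]_z (f z + M) = n%:R^-1 * \sum_(i < n) (f (x i) + M).
  rewrite RintD//; last exact: bmf_cst.
  rewrite Rint_cst big_split/= sumr_const card_ord mulrDr -[M *+ n]mulr_natl mulKf//.
  exact: addIr.
have mg : measurable_fun setT (EFin \o (fun z => f z + M)) by apply/measurable_EFinP; exact: bmf_meas.
have ge0 z : [set: borel T] z -> (0 <= (EFin \o (fun z => f z + M)%R) z)%E by rewrite lee_fin.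
rewrite /Rintegral (eq_measure_integral (mscale (NngNum nV_ge0) (msum (fun i => \d_(x i : borel T)) n))); last first.
  by move=> A _ _; exact: empiricalE.
rewrite ge0_integral_mscale//; rewrite ge0_integral_measure_sum//.
under eq_bigr => i _ do rewrite integral_dirac// diracT mul1e.
by rewrite /= sumEFin.
Qed.

End empirical_measure.

(** * Deterministic expansion around the population density *)

Section remainder.
Context {R : realType} {T : ptopologicalType}.
Local Notation TT := (borel T * borel T)%type.
Variables (c : T * T -> R).
Hypotheses (c_meas : measurable_fun [set: TT] c) (c_bnd : bounded_by_some c).
Variables (P Q : probability (borel T) R).
Local Notation K := (Defs.xi c P Q : TT -> R).

Definition marginal_energy (mu nu : probability (borel T) R) (q : TT -> R) : R :=
  \int[mu]_x ((\int[nu]_y q (x, y)) ^+ 2) + \int[nu]_y ((\int[mu]_x q (x, y)) ^+ 2).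

Lemma marginal_energy_ge0 mu nu q : 0 <= marginal_energy mu nu q.
Proof. by apply: addr_ge0; apply: Rint_ge0 => z; exact: sqr_ge0. Qed.

(* The entropic plan of any pair of measures is a tilting e^(a + b) of the
   population density, which pins down the marginals of [p + q] exactly. *)
Lemma RCol_expansion t (p q : borel T -> R) : bmf p -> bmf q ->
  exists2 C, 0 <= C & forall mu nu : probability (borel T) R,
    `|RCol c mu nu t - \int[mu]_x p x - \int[nu]_y q y -
      \int[prodP mu nu]_z ((Defs.eta c t z - p z.1 - q z.2) * K z)| <=
    C * (marginal_energy mu nu (fun z => K z - 1) +
         marginal_energy mu nu (fun z => (Defs.eta c t z - p z.1 - q z.2) * K z)).
Proof.
move=> bp bq.
have [k0 [k1 [bK k00 k01 K0 K1]]] := xi_bounds c_meas c_bnd P Q.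
have k10 : 0 < k1 by exact: lt_le_trans k01.
pose h z := (Defs.eta c t z - p z.1 - q z.2) * K z.
have bh : bmf (h : TT -> R).
  apply: bmfM => //; apply: bmfB; last exact: bmf_snd.
  by apply: bmfB; [exact: bmf_eta|exact: bmf_fst].
have [H H0 hH] := bmf_bnd bh.
(* The sum of the bounds of [tilt_bound1] and [tilt_bound2]; it involves the kernel alone, so the
   final constant is the same for all [mu] and [nu]. *)
pose M := `|ln k0| + `|ln k1| + ln (k1 / k0) + ln (k1 / k0).
have lk : 0 <= ln (k1 / k0) by rewrite ln_ge0// ler_pdivlMr// mul1r.
have M0 : 0 <= M by rewrite !addr_ge0.
pose ka := (k0 * expR (- M)) ^- 2.
have ka0 : 0 <= ka by rewrite invr_ge0 sqr_ge0.
have C1 : 0 <= (H * expR M + 1) * ka by rewrite mulr_ge0// addr_ge0// mulr_ge0// expR_ge0.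
exists ((H * expR M + 1) * ka + 1); first by rewrite addr_ge0.
move=> mu nu; rewrite -/(h _).
have [u [v [[pu pv] uE vE _ _]]] := scaling_exists c_meas c_bnd mu nu.
have [eu eu0 ue] := pu.2; have [ev ev0 ve] := pv.2.
have pU := pop_u_pos c_meas c_bnd P Q; have pV := pop_v_pos c_meas c_bnd P Q.
have [eU eU0 Ue] := pU.2; have [eV eV0 Ve] := pV.2.
have bln f : bmf_pos f -> bmf (fun x : borel T => ln (f x)).
  by move=> [bf [e e0 ef]]; exact: bmf_ln bf e0 ef.
pose a0 x := ln (u x) - ln (pop_u c P Q x).
pose b0 y := ln (v y) - ln (pop_v c P Q y).
have ba0 : bmf (a0 : borel T -> R) by apply: bmfB; exact: bln.
have bb0 : bmf (b0 : borel T -> R) by apply: bmfB; exact: bln.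
(* Moving a constant between [a0] and [b0] leaves the tilt unchanged; [b] is centred under [nu], the
   measure against which [tilt_sqr] integrates it. *)
pose s := \int[nu]_y b0 y.
pose a x := a0 x + s; pose b y := b0 y - s.
have ba : bmf (a : borel T -> R) by apply: bmfD => //; exact: bmf_cst.
have bb : bmf (b : borel T -> R) by apply: bmfB => //; exact: bmf_cst.
have b_mean : \int[nu]_y b y = 0 by rewrite RintB//; [rewrite Rint_cst subrr|exact: bmf_cst].
have Ke z : K z * expR (a z.1 + b z.2) = gibbs_kernel c z * (u z.1 * v z.2).
  have -> : a z.1 + b z.2 = a0 z.1 + b0 z.2 by rewrite /a /b; ring.
  have pos f (x : borel T) : bmf_pos f -> 0 < f x by move=> [_ [e e0 ef]]; exact: lt_le_trans (ef x).
  rewrite (_ : K z = gibbs_kernel c z * pop_u c P Q z.1 * pop_v c P Q z.2); last exact: xiE.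
  rewrite expRD /a0 /b0 !expRB !lnK ?posrE ?pos//.
  by field; rewrite !gt_eqF ?pos.
have mU x : \int[nu]_y (K (x, y) * expR (a x + b y)) = 1.
  rewrite -(uE x) -RintZl; last first.
    apply: bmfM; last exact: pv.1.
    by have [? [? [bC _ _ _ _]]] := gibbs_kernel_bounds c_meas c_bnd; exact: (bmf_pair1 (x : borel T) bC).
  by apply: eq_Rintegral => y _; rewrite (Ke (x, y)) /=; ring.
have mV y : \int[mu]_x (K (x, y) * expR (a x + b y)) = 1.
  rewrite -(vE y) -RintZl; last first.
    apply: bmfM; last exact: pu.1.
    by have [? [? [bC _ _ _ _]]] := gibbs_kernel_bounds c_meas c_bnd; exact: (bmf_pair2 (y : borel T) bC).
  by apply: eq_Rintegral => x _; rewrite (Ke (x, y)) /=; ring.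
have sM (z : TT) : `|a z.1 + b z.2| <= M.
  apply: le_trans (ler_normD _ _) _; rewrite /M; apply: lerD.
    exact: (tilt_bound1 bK k00 K0 K1 ba bb mU mV b_mean).
  exact: (tilt_bound2 bK k00 K0 K1 ba bb mV b_mean).
have en := tilt_energy bK k00 K0 ba bb mU mV b_mean sM.
have ex := tilt_expansion mu ba bb b_mean M0 sM bh hH.
have be : bmf (fun z : TT => expR (a z.1 + b z.2)).
  by apply: bmf_expR; apply: bmfD; [exact: bmf_fst|exact: bmf_snd].
have bKe : bmf (fun z : TT => K z * expR (a z.1 + b z.2)) by exact: bmfM.
have RE : \int[prodP mu nu]_z (h z * expR (a z.1 + b z.2)) =
    RCol c mu nu t - \int[mu]_x p x - \int[nu]_y q y.
  have p1 : \int[prodP mu nu]_z (p z.1 * (K z * expR (a z.1 + b z.2))) = \int[mu]_x p x.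
    by rewrite Rint_fstM//; apply: eq_Rintegral => x _; rewrite mU mulr1.
  have q1 : \int[prodP mu nu]_z (q z.2 * (K z * expR (a z.1 + b z.2))) = \int[nu]_y q y.
    by rewrite Rint_sndM//; apply: eq_Rintegral => x _; rewrite mV mulr1.
  have bE : bmf (fun z : TT => Defs.eta c t z * (K z * expR (a z.1 + b z.2))).
    by apply: bmfM => //; exact: bmf_eta.
  rewrite (RCol_scaling c_meas c_bnd pu pv uE vE) -p1 -q1.
  under [X in _ = X - _ - _]eq_Rintegral => z _.
    rewrite -mulrA -/(gibbs_kernel c z) -Ke; over.
  have bP : bmf (fun z : TT => p z.1 * (K z * expR (a z.1 + b z.2))) by apply: bmfM => //; exact: bmf_fst.
  have bQ : bmf (fun z : TT => q z.2 * (K z * expR (a z.1 + b z.2))) by apply: bmfM => //; exact: bmf_snd.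
  rewrite -RintB// -RintB//; last exact: bmfB.
  by apply: eq_Rintegral => z _; rewrite /h; ring.
rewrite RE in ex; apply: le_trans ex _.
have bK1 : bmf (fun z => K z - 1) by apply: bmfB => //; exact: bmf_cst.
pose D := marginal_energy mu nu (fun z => K z - 1); rewrite -/D.
have DE : D = \int[mu]_x ((\int[nu]_y K (x, y) - 1) ^+ 2) + \int[nu]_y ((\int[mu]_x K (x, y) - 1) ^+ 2).
  congr (_ + _); apply: eq_Rintegral => z _; congr (_ ^+ 2).
    by rewrite RintB ?Rint_cst//; [exact: bmf_pair1|exact: bmf_cst].
  by rewrite RintB ?Rint_cst//; [exact: bmf_pair2|exact: bmf_cst].
rewrite -DE -/ka in en; rewrite -/(marginal_energy mu nu h).
have d0 := marginal_energy_ge0 mu nu h.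
have D0 : 0 <= D := marginal_energy_ge0 _ _ _.
have c0 : 0 <= H * expR M + 1 by rewrite addr_ge0// mulr_ge0// expR_ge0.
move: (marginal_energy mu nu h) d0 => d d0.
have := ler_wpM2l c0 en; rewrite mulrA => h1.
apply: le_trans (lerD h1 (lexx d)) _.
have h2 := mulr_ge0 C1 d0; move: h2; move: ((H * expR M + 1) * ka) => G h2.
rewrite -subr_ge0 (_ : _ - _ = G * d + D); last by ring.
by rewrite addr_ge0.
Qed.

End remainder.

(** * Measurability of the empirical statistic *)

Section measurable_RCol.
Context {R : realType} {T : ptopologicalType} d {S : measurableType d}.
Local Notation TT := (borel T * borel T)%type.
Variables (c : T * T -> R).
Hypotheses (c_meas : measurable_fun [set: TT] c) (c_bnd : bounded_by_some c).
Variables (n m : nat) (X Y : nat -> S -> T).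
Hypotheses (n0 : (0 < n)%N) (m0 : (0 < m)%N).
Hypotheses (mX : forall i, measurable_fun setT (X i : S -> borel T))
  (mY : forall j, measurable_fun setT (Y j : S -> borel T)).

Local Notation C := (gibbs_kernel c : TT -> R).
Local Notation Pn w := (empirical (R := R) n (X ^~ w)).
Local Notation Qm w := (empirical (R := R) m (Y ^~ w)).

(* Weaker than the joint measurability of [u], but stable under Sinkhorn's steps. *)
Definition measurable_family (u : S -> T -> R) : Prop :=
  forall Z : S -> borel T, measurable_fun setT Z -> measurable_fun setT (fun w => u w (Z w)).

Lemma measurable_family_pair (f : TT -> R) (Z Z' : S -> borel T) : bmf f ->
  measurable_fun setT Z -> measurable_fun setT Z' ->
  measurable_fun setT (fun w => f (Z w, Z' w)).
Proof.
by move=> [mf _] mZ mZ'; apply: (measurableT_comp mf); exact: measurable_fun_pair.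
Qed.

(** Under an empirical measure the integral is a finite sum of values at the sample points, so
    evaluation along measurable maps is all that is required of [u]. *)
Lemma measurable_sink_half k (W : nat -> S -> T) (D : TT -> R) (k0 : R) (u : S -> T -> R) : (0 < k)%N ->
  (forall i, measurable_fun setT (W i : S -> borel T)) -> bmf D -> 0 < k0 ->
  (forall z, k0 <= D z) -> (forall w, bmf_pos (u w : borel T -> R)) ->
  measurable_family u ->
  measurable_family (fun w => sink_half (empirical (R := R) k (W ^~ w)) D (u w)).
Proof.
move=> kk mW bD k00 Dk0 pu mu Z mZ; apply: measurable_funV => [|w]; last first.
  exact: (kernel_Rint_gt0 _ bD k00 Dk0 _ (pu w)).
have E w : \int[empirical (R := R) k (W ^~ w)]_x (D (x, Z w) * u w x) =
    k%:R^-1 * \sum_(i < k) (D (W i w, Z w) * u w (W i w)).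
  rewrite (Rint_empirical (W ^~ w) kk (f := fun x : borel T => D (x, Z w) * u w x))//.
  by apply: bmfM; [exact: (bmf_pair2 (Z w) bD)|exact: (pu w).1].
under eq_fun do rewrite E.
apply: measurable_funM => //; apply: measurable_sum => i.
by apply: measurable_funM; [exact: measurable_family_pair|exact: mu].
Qed.

Lemma measurable_sink_iter N : measurable_family (fun w => sink_iter (Pn w) (Qm w) C (point : T) N).
Proof.
have [k0 [k1 [bC k00 k01 Ck0 Ck1]]] := gibbs_kernel_bounds c_meas c_bnd.
elim: N => [|N IH]; first by move=> Z mZ; exact: measurable_cst.
pose u w := sink_iter (Pn w) (Qm w) C (point : T) N.
have pu w : bmf_pos (u w : borel T -> R) by exact: (sink_iter_pos (Pn w) (Qm w) (point : T) bC k00 k01 Ck0 Ck1 N).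
have pv w : bmf_pos (sink_half (Pn w) C (u w)) by exact: (sink_half_pos (Pn w) bC k00 k01 Ck0 Ck1 (pu w)).
have bC' := bmf_swap_kernel bC.
have mv := measurable_sink_half n0 mX bC k00 Ck0 pu IH.
have mz := measurable_sink_half m0 mY bC' k00 (fun z => Ck0 _) pv mv.
have p0 w x : 0 < sink_half (Qm w) (swap_kernel C) (sink_half (Pn w) C (u w)) x.
  exact: bmf_pos_gt0 x (sink_half_pos (Qm w) bC' k00 k01 (fun z => Ck0 _) (fun z => Ck1 _) (pv w)).
move=> Z mZ; rewrite /sink_iter /= /sink_step.
apply: measurable_funM; first exact: mz.
by apply: measurable_funV => //; apply: mz; exact: measurable_cst.
Qed.

(** For each sample the statistic is the limit of the finite sums formed with Sinkhorn's iterates,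
    which are measurable in the sample. *)
Lemma measurable_RCol t : measurable_fun setT (fun w => RCol c (Pn w) (Qm w) t).
Proof.
have [k0 [k1 [bC k00 k01 Ck0 Ck1]]] := gibbs_kernel_bounds c_meas c_bnd.
pose G N w := n%:R^-1 * \sum_(i < n) (m%:R^-1 * \sum_(j < m)
  (Defs.eta c t (X i w, Y j w) * (expR (- c (X i w, Y j w)) * sink_iter (Pn w) (Qm w) C (point : T) N (X i w) *
     sink_half (Pn w) C (sink_iter (Pn w) (Qm w) C (point : T) N) (Y j w)))).
apply: (@measurable_fun_cvg _ _ _ setT G) => [N|w _].
  apply: measurable_funM => //; apply: measurable_sum => i.
  apply: measurable_funM => //; apply: measurable_sum => j.
  apply: measurable_funM; first by apply: measurable_family_pair => //; exact: bmf_eta.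
  apply: measurable_funM; last first.
    apply: (measurable_sink_half n0 mX bC k00 Ck0 _ (@measurable_sink_iter N)) => // w.
    exact: (sink_iter_pos (Pn w) (Qm w) (point : T) bC k00 k01 Ck0 Ck1 N).
  by apply: measurable_funM; [exact: (measurable_family_pair bC)|exact: measurable_sink_iter].
have [u [v [[pu pv] uE vE cu cv]]] := scaling_exists c_meas c_bnd (Pn w) (Qm w).
rewrite (RCol_scaling c_meas c_bnd pu pv uE vE).
have bF : bmf (fun z : TT => Defs.eta c t z * (expR (- c z) * u z.1 * v z.2)).
  apply: bmfM; first exact: bmf_eta.
  by apply: bmfM; [apply: bmfM => //; exact: (bmf_fst _ pu.1)|exact: (bmf_snd _ pv.1)].
rewrite Rint_prod12// (Rint_empirical (X ^~ w) n0); last exact: (bmf_Rint2 (Qm w) bF).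
apply: cvgM; first exact: cvg_cst.
apply: cvg_big => [|i _]; first exact: add_continuous.
rewrite (Rint_empirical (Y ^~ w) m0); last exact: (bmf_pair1 (X i w : borel T) bF).
apply: cvgM; first exact: cvg_cst.
apply: cvg_big => [|j _]; first exact: add_continuous.
apply: cvgM; first exact: cvg_cst.
by apply: cvgM; [apply: cvgM; [exact: cvg_cst|exact: cu]|exact: cv].
Qed.

End measurable_RCol.

(** * Stochastic size of the remainder *)

Section fluctuations.
Context {R : realType} {T : ptopologicalType} d {S : measurableType d}.
Local Notation TT := (borel T * borel T)%type.
Variables (Pr : probability S R) (P Q : probability (borel T) R).
Variables (X Y : nat -> S -> T).
Hypotheses (X_law : forall i, has_law Pr (X i) P) (Y_law : forall j, has_law Pr (Y j) Q).

Definition joint_sample (k : nat + nat) : S -> T :=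
  match k with inl i => X i | inr j => Y j end.

Hypothesis XY_indep : mutually_independent Pr joint_sample.

Let mZ k : measurable_fun setT (joint_sample k : S -> borel T).
Proof. by case: k => i; [have [] := X_law i|have [] := Y_law i]. Qed.

Let mX i : measurable_fun setT (X i : S -> borel T). Proof. by have [] := X_law i. Qed.
Let mY i : measurable_fun setT (Y i : S -> borel T). Proof. by have [] := Y_law i. Qed.

Let lX i (A : set (borel T)) : measurable A -> Pr (joint_sample (inl i) @^-1` A) = P A.
Proof. by have [_] := X_law i; exact. Qed.
Let lY i (A : set (borel T)) : measurable A -> Pr (joint_sample (inr i) @^-1` A) = Q A.
Proof. by have [_] := Y_law i; exact. Qed.

Let inl_inj : injective (@inl nat nat). Proof. by move=> i j []. Qed.
Let inr_inj : injective (@inr nat nat). Proof. by move=> i j []. Qed.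

Local Notation Pn n w := (empirical (R := R) n (X ^~ w)).
Local Notation Qm m w := (empirical (R := R) m (Y ^~ w)).

Section degenerate.
Variables (q : TT -> R) (B : R).
Hypotheses (bq : bmf q) (qB : forall z, `|q z| <= B).
Hypotheses (qQ : forall x, \int[Q]_y q (x, y) = 0) (qP : forall y, \int[P]_x q (x, y) = 0).
Variables (n m : nat).
Hypotheses (n0 : (0 < n)%N) (m0 : (0 < m)%N).

Let bqXY i j : bmf (fun w => q (X i w, Y j w)).
Proof. by apply: bmf_comp bq; exact: measurable_fun_pair. Qed.

Lemma Rint_empirical2 w (f : TT -> R) : bmf f -> \int[prodP (Pn n w) (Qm m w)]_z f z =
  n%:R^-1 * \sum_(i < n) (m%:R^-1 * \sum_(j < m) f (X i w, Y j w)).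
Proof.
move=> bf; rewrite Rint_prod12// (Rint_empirical (X ^~ w) n0); last exact: (bmf_Rint2 (Qm m w) bf).
congr (_ * _); apply: eq_bigr => i _.
by rewrite (Rint_empirical (Y ^~ w) m0)//; exact: (bmf_pair1 (X i w : borel T) bf).
Qed.

Lemma marginal_energyE w : marginal_energy (Pn n w) (Qm m w) q =
  n%:R^-1 * \sum_(i < n) (m%:R^-1 * \sum_(j < m) q (X i w, Y j w)) ^+ 2 +
  m%:R^-1 * \sum_(j < m) (n%:R^-1 * \sum_(i < n) q (X i w, Y j w)) ^+ 2.
Proof.
rewrite /marginal_energy; congr (_ + _).
  rewrite (Rint_empirical (X ^~ w) n0); last exact: bmfX (bmf_Rint2 (Qm m w) bq).
  congr (_ * _); apply: eq_bigr => i _; congr (_ ^+ 2).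
  by rewrite (Rint_empirical (Y ^~ w) m0)//; exact: (bmf_pair1 (X i w : borel T) bq).
rewrite (Rint_empirical (Y ^~ w) m0); last exact: bmfX (bmf_Rint1 (Pn n w) bq).
congr (_ * _); apply: eq_bigr => i _; congr (_ ^+ 2).
by rewrite (Rint_empirical (X ^~ w) n0)//; exact: (bmf_pair2 (Y i w : borel T) bq).
Qed.

Let bavg k (f : nat -> S -> R) : (forall i, bmf (f i)) -> bmf (fun w => k%:R^-1 * \sum_(i < k) f i w).
Proof. by move=> bf; apply: bmfM; [exact: bmf_cst|exact: bmf_sum]. Qed.

Let brow : bmf (fun w => n%:R^-1 * \sum_(i < n) (m%:R^-1 * \sum_(j < m) q (X i w, Y j w)) ^+ 2).
Proof.
by apply: (bavg n (f := fun i w => (m%:R^-1 * \sum_(j < m) q (X i w, Y j w)) ^+ 2)) => i; apply: bmfX; exact: (bavg m (f := fun j w => q (X i w, Y j w))).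
Qed.

Let bcol : bmf (fun w => m%:R^-1 * \sum_(j < m) (n%:R^-1 * \sum_(i < n) q (X i w, Y j w)) ^+ 2).
Proof.
apply: (bavg m (f := fun j w => (n%:R^-1 * \sum_(i < n) q (X i w, Y j w)) ^+ 2)) => j; apply: bmfX.
exact: (bavg n (f := fun i w => q (X i w, Y j w))).
Qed.

Lemma bmf_marginal_energy : bmf (fun w => marginal_energy (Pn n w) (Qm m w) q).
Proof. by under eq_fun do rewrite marginal_energyE; exact: bmfD. Qed.

Lemma mean_marginal_energy :
  \int[Pr]_w marginal_energy (Pn n w) (Qm m w) q <= B ^+ 2 * (n%:R^-1 + m%:R^-1).
Proof.
under eq_Rintegral => w _ do rewrite marginal_energyE.
have avg_le k (f : nat -> S -> R) e : (0 < k)%N -> (forall i, bmf (f i)) ->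
    (forall i, \int[Pr]_w f i w <= e) -> \int[Pr]_w (k%:R^-1 * \sum_(i < k) f i w) <= e.
  move=> k0 bf fe; rewrite RintZl; last exact: bmf_sum.
  rewrite Rint_sum//; have k00 : 0 < k%:R :> R by rewrite ltr0n.
  rewrite ler_pdivrMl// mulr_natl -[in leRHS](card_ord k) -sumr_const.
  by apply: ler_sum => i _.
rewrite RintD// mulrDr addrC; apply: lerD.
  apply: (avg_le m (fun j w => (n%:R^-1 * \sum_(i < n) q (X i w, Y j w)) ^+ 2)) => //.
    by move=> j; apply: bmfX; exact: (bavg n (f := fun i w => q (X i w, Y j w))).
  move=> j; have bq' : bmf (fun z : TT => q (z.2, z.1)).
    by apply: (bmf_comp _ bq); apply: measurable_fun_pair.
  have := @degenerate_average R d S Pr T _ joint_sample mZ XY_indep P (fun z => q (z.2, z.1)) B (inr j) inl n inl_inj.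
  by apply => //; exact: lX.
apply: (avg_le n (fun i w => (m%:R^-1 * \sum_(j < m) q (X i w, Y j w)) ^+ 2)) => //.
  by move=> i; apply: bmfX; exact: (bavg m (f := fun j w => q (X i w, Y j w))).
move=> i.
have := @degenerate_average R d S Pr T _ joint_sample mZ XY_indep Q q B (inl i) inr m inr_inj.
by apply => //; exact: lY.
Qed.

Lemma bmf_degenerate_double : bmf (fun w => \int[prodP (Pn n w) (Qm m w)]_z q z).
Proof.
under eq_fun do rewrite Rint_empirical2//.
apply: (bavg n (f := fun i w => m%:R^-1 * \sum_(j < m) q (X i w, Y j w))) => i.
exact: (bavg m (f := fun j w => q (X i w, Y j w))).
Qed.

(** The second moment of the degenerate statistic is at most [B ^+ 2] over [n * m], and the
    geometric mean of 1/n and 1/m is at most their sum. *)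
Lemma mean_degenerate_double :
  \int[Pr]_w `|\int[prodP (Pn n w) (Qm m w)]_z q z| <= B * (n%:R^-1 + m%:R^-1).
Proof.
have B0 : 0 <= B by exact: le_trans (qB point).
have n00 : 0 < n%:R^-1 :> R by rewrite invr_gt0 ltr0n.
have m00 : 0 < m%:R^-1 :> R by rewrite invr_gt0 ltr0n.
have bd := bmf_degenerate_double.
rewrite -[leLHS]ger0_norm; last by apply: Rint_ge0.
rewrite -(@ler_pXn2r _ 2)// ?nnegrE// ?mulr_ge0 ?addr_ge0 ?(ltW n00) ?(ltW m00)//.
apply: le_trans (norm_Rint1_le Pr (bmf_norm bd)) _.
under eq_Rintegral => w _ do rewrite real_normK ?num_real// Rint_empirical2//.
have := @degenerate_Ustat R d S Pr T _ joint_sample mZ XY_indep P Q q B inl inr n m inl_inj inr_inj.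
move=> /(_ (fun _ _ => isT) bq qB lX lY qQ qP n0 m0) h; apply: le_trans h _.
rewrite exprMn ler_wpM2l ?sqr_ge0// invfM.
have := mulr_gt0 n00 m00; have := sqr_ge0 (n%:R^-1 : R); have := sqr_ge0 (m%:R^-1 : R).
rewrite sqrrD mulr2n; lra.
Qed.

End degenerate.

Variables (c : T * T -> R).
Hypotheses (c_meas : measurable_fun [set: TT] c) (c_bnd : bounded_by_some c).
Local Notation K := (Defs.xi c P Q : TT -> R).

(** The two equations for [p] and [q] say exactly that [h] integrates to 0 in each variable, while
    the marginals of the population density do the same for [K - 1]. Each term of [RCol_expansion]
    is then a degenerate average. *)
Lemma mean_RCol_linearization t (p q : borel T -> R) : bmf p -> bmf q ->
  (forall x, p x + opQ c P Q q x = eta_x c P Q t x) ->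
  (forall y, q y + opP c P Q p y = eta_y c P Q t y) ->
  exists2 C, 0 <= C & forall n m, (0 < n)%N -> (0 < m)%N ->
  bmf (fun w => RCol c (Pn n w) (Qm m w) t - \int[Pn n w]_x p x - \int[Qm m w]_y q y) /\
  \int[Pr]_w `|RCol c (Pn n w) (Qm m w) t - \int[Pn n w]_x p x - \int[Qm m w]_y q y|
    <= C * (n%:R^-1 + m%:R^-1).
Proof.
move=> bp bq pE qE.
have [k0 [k1 [bK k00 k01 K0 K1]]] := xi_bounds c_meas c_bnd P Q.
have mU := xi_Q c_meas c_bnd P Q; have mV := xi_P c_meas c_bnd P Q.
have [C C0 expn] := RCol_expansion c_meas c_bnd P Q t bp bq.
pose h z := (Defs.eta c t z - p z.1 - q z.2) * K z.
have be := bmf_eta c_meas t.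
have bh : bmf (h : TT -> R).
  apply: bmfM => //; apply: bmfB; last exact: bmf_snd.
  by apply: bmfB => //; exact: bmf_fst.
have bK1 : bmf (fun z => K z - 1) by apply: bmfB => //; exact: bmf_cst.
have [Bh Bh0 hB] := bmf_bnd bh; have [Bk Bk0 kB] := bmf_bnd bK1.
have [Bp Bp0 pB] := bmf_bnd bp; have [Bq Bq0 qB] := bmf_bnd bq.
have hQ x : \int[Q]_y h (x, y) = 0.
  transitivity (eta_x c P Q t x - p x - opQ c P Q q x); last by rewrite -pE; ring.
  have b1 := bmf_pair1 (x : borel T) bK; have b2 := bmf_pair1 (x : borel T) be.
  have b3 : bmf (fun y : borel T => K (x, y) * q y) by exact: bmfM.
  have b4 : bmf (fun y : borel T => Defs.eta c t (x, y) * K (x, y)) by exact: bmfM.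
  have b5 : bmf (fun y : borel T => p x * K (x, y)) by apply: bmfM => //; exact: bmf_cst.
  have -> : p x = \int[Q]_y (p x * K (x, y)) by rewrite RintZl// mU mulr1.
  rewrite /eta_x /opQ -RintB// -RintB//; last exact: bmfB.
  by apply: eq_Rintegral => y _; rewrite /h /=; ring.
have hP y : \int[P]_x h (x, y) = 0.
  transitivity (eta_y c P Q t y - opP c P Q p y - q y); last by rewrite -qE; ring.
  have b1 := bmf_pair2 (y : borel T) bK; have b2 := bmf_pair2 (y : borel T) be.
  have b3 : bmf (fun x : borel T => K (x, y) * p x) by exact: bmfM.
  have b4 : bmf (fun x : borel T => Defs.eta c t (x, y) * K (x, y)) by exact: bmfM.
  have b5 : bmf (fun x : borel T => q y * K (x, y)) by apply: bmfM => //; exact: bmf_cst.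
  have -> : q y = \int[P]_x (q y * K (x, y)) by rewrite RintZl// mV mulr1.
  rewrite /eta_y /opP -RintB// -RintB//; last exact: bmfB.
  by apply: eq_Rintegral => x _; rewrite /h /=; ring.
have kQ x : \int[Q]_y (K (x, y) - 1) = 0.
  by rewrite RintB ?mU ?Rint_cst ?subrr//; [exact: (bmf_pair1 (x : borel T) bK)|exact: bmf_cst].
have kP y : \int[P]_x (K (x, y) - 1) = 0.
  by rewrite RintB ?mV ?Rint_cst ?subrr//; [exact: (bmf_pair2 (y : borel T) bK)|exact: bmf_cst].
exists (C * (Bk ^+ 2 + Bh ^+ 2) + Bh); first by rewrite addr_ge0// mulr_ge0// addr_ge0 ?sqr_ge0.
move=> n m n0 m0.
set F := fun w => _ - \int[Qm m w]_y q y.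
have e1 := bmf_marginal_energy bK1 n0 m0; have e2 := bmf_marginal_energy bh n0 m0.
have e3 := bmf_degenerate_double bh n0 m0.
have D w : `|F w| <= C * (marginal_energy (Pn n w) (Qm m w) (fun z => K z - 1) +
    marginal_energy (Pn n w) (Qm m w) h) + `|\int[prodP (Pn n w) (Qm m w)]_z h z|.
  rewrite -lerBlDr; apply: le_trans (expn (Pn n w) (Qm m w)).
  by apply: le_trans (lerB_dist _ _).
have bavg k (f : nat -> S -> R) : (forall i, bmf (f i)) -> bmf (fun w => k%:R^-1 * \sum_(i < k) f i w).
  by move=> bf; apply: bmfM; [exact: bmf_cst|exact: bmf_sum].
have bR : bmf (fun w => C * (marginal_energy (Pn n w) (Qm m w) (fun z => K z - 1) +
    marginal_energy (Pn n w) (Qm m w) h) + `|\int[prodP (Pn n w) (Qm m w)]_z h z|).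
  exact: (bmfD (bmfM (bmf_cst C) (bmfD e1 e2)) (bmf_norm e3)).
have bF : bmf F.
  have [M M0 hM] := bmf_bnd bR; split; last first.
    by exists M => w; apply: le_trans (D w) _; apply: le_trans (ler_norm _) (hM w).
  have bpw : bmf (fun w => \int[Pn n w]_x p x).
    under eq_fun do rewrite (Rint_empirical _ n0 bp).
    exact: (bavg n (fun i w => p (X i w)) (fun i => bmf_comp (mX i) bp)).
  have bqw : bmf (fun w => \int[Qm m w]_y q y).
    under eq_fun do rewrite (Rint_empirical _ m0 bq).
    exact: (bavg m (fun j w => q (Y j w)) (fun j => bmf_comp (mY j) bq)).
  apply: measurable_funB; last exact: bmf_meas bqw.
  apply: measurable_funB; last exact: bmf_meas bpw.
  exact: measurable_RCol.
split=> //; apply: le_trans (le_Rint Pr (bmf_norm bF) bR D) _.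
rewrite (RintD Pr (bmfM (bmf_cst C) (bmfD e1 e2)) (bmf_norm e3)).
rewrite (RintZl Pr C (bmfD e1 e2)) (RintD Pr e1 e2).
have i1 := mean_marginal_energy bK1 kB kQ kP n0 m0.
have i2 := mean_marginal_energy bh hB hQ hP n0 m0.
have i3 := mean_degenerate_double bh hB hQ hP n0 m0.
have := ler_wpM2l C0 (lerD i1 i2) => i4.
apply: le_trans (lerD i4 i3) _.
by rewrite le_eqVlt; apply/orP; left; apply/eqP; ring.
Qed.

End fluctuations.

(** * The central limit theorem *)

Section lipschitz.
Context {R : realType} {l : nat}.
Local Notation rV := 'rV[R]_l.
Local Notation B := (borel rV).

Definition lip1 (L : R) (Phi : rV -> R) := forall x h, `|Phi (x + h) - Phi x| <= L * norm1 h.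

(** Increments of size at least 1 are covered by the bound on [Phi]; for smaller ones each of the
    three Taylor terms is at most [K * norm1 h]. *)
Lemma smooth3_lip1 (Phi : rV -> R) : smooth3 Phi -> exists2 L, 0 <= L & lip1 L Phi.
Proof.
move=> [K K0 PK]; exists (3 * K); first by rewrite mulr_ge0.
move=> x h; have [Px [D [H [DK HK tay]]]] := PK x; have [Pxh _] := PK (x + h).
have s0 := norm1_ge0 h.
have e1 : `|\sum_i D i * h 0 i| <= K * norm1 h.
  apply: le_trans (ler_norm_sum _ _ _) _; rewrite mulr_sumr; apply: ler_sum => i _.
  by rewrite normrM ler_wpM2r.
have e2 : `|\sum_i \sum_j H i j * (h 0 i * h 0 j)| <= K * (norm1 h * norm1 h).
  apply: le_trans (ler_norm_sum _ _ _) _.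
  rewrite [norm1 h in X in _ <= _ * (X * _)]/norm1 mulr_suml mulr_sumr; apply: ler_sum => i _.
  apply: le_trans (ler_norm_sum _ _ _) _.
  rewrite /norm1 mulr_sumr mulr_sumr; apply: ler_sum => j _.
  by rewrite !normrM ler_wpM2r// mulr_ge0.
have e3 := tay h.
have [s1|s1] := leP 1 (norm1 h).
  have a1 := ler_normB (Phi (x + h)) (Phi x).
  have a2 : K * 1 <= K * norm1 h by rewrite ler_wpM2l.
  lra.
have s2 : norm1 h * norm1 h <= norm1 h by rewrite ler_piMr// ltW.
have s3 : norm1 h ^+ 3 <= norm1 h.
  by rewrite exprS ler_piMr// expr2 mulr_ile1// ltW.
have k2 := ler_wpM2l K0 s2; have k3 := ler_wpM2l K0 s3.
set A := \sum_i D i * h 0 i in e1 e3; set C := \sum_i \sum_j H i j * _ in e2 e3.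
have b1 := ler_normD (Phi (x + h) - Phi x - A - C) (A + C).
have b2 := ler_normD A C.
have -> : Phi (x + h) - Phi x = Phi (x + h) - Phi x - A - C + (A + C) by ring.
by lra.
Qed.

Lemma conv_op_lip1 d (U : measurableType d) (mu : probability U R) (zeta : U -> rV) L Phi :
  meas_coords zeta -> bmf (Phi : B -> R) -> lip1 L Phi -> lip1 L (conv_op mu zeta Phi).
Proof.
move=> mz bP PL x h; have b y := bmf_shifted mz y bP.
rewrite /conv_op -RintB//; apply: norm_Rint_le => [|u]; first exact: bmfB.
by rewrite addrAC; exact: PL.
Qed.

Lemma gauss_norm1_integrable (s : seq rV) :
  (gauss_vec s).-integrable setT (EFin \o (fun v : B => norm1 (v : rV))).
Proof.
have [M3 [_ m1 _ _]] := gauss_vec_moments s.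
have mi i : (gauss_vec s).-integrable setT (EFin \o (fun v : B => `|(v : rV) 0 i|)).
  exact: integrable_norm (m1 i).1.
exact: (integrable_sumR _ mi).1.
Qed.

Lemma gauss_op_scale_dist (s : seq rV) L Phi (a a' : R) x : bmf (Phi : B -> R) ->
  0 <= L -> lip1 L Phi ->
  `|gauss_op s a Phi x - gauss_op s a' Phi x| <=
  L * (\int[gauss_vec s]_v norm1 (v : rV)) * `|a - a'|.
Proof.
move=> bP L0 PL; have b r := bmf_shifted (meas_scale r) x bP.
rewrite /gauss_op /conv_op -RintB//; apply: le_trans (norm_Rint _ (bmfB (b a) (b a'))) _.
rewrite mulrAC -RintegralZl//; last exact: gauss_norm1_integrable.
apply: le_Rintegral => //.
- exact: bmf_int (bmf_norm (bmfB (b a) (b a'))).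
- exact: integrable_scaleR (gauss_norm1_integrable s).
move=> v _; have -> : x + a *: (v : rV) = x + a' *: (v : rV) + (a - a') *: (v : rV).
  by rewrite -addrA -scalerDl subrKC.
by apply: le_trans (PL _ _) _; rewrite norm1Z mulrA.
Qed.

End lipschitz.

(** * Gaussian comparison for two independent samples *)

Section two_sample_clt.
Context {R : realType} {T : ptopologicalType} d {S : measurableType d}.
Variables (Pr : probability S R) (P Q : probability (borel T) R).
Variables (X Y : nat -> S -> T).
Hypotheses (X_law : forall i, has_law Pr (X i) P) (Y_law : forall j, has_law Pr (Y j) Q).
Hypothesis XY_indep : mutually_independent Pr (joint_sample X Y).
Context {l : nat}.
Local Notation rV := 'rV[R]_l.
Local Notation B := (borel rV).
Variables (zeta theta : borel T -> rV) (s1 s2 : seq rV) (M1 M2 : R).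
Hypotheses (hz : has_moments P zeta (gram_mx s1) M1) (ht : has_moments Q theta (gram_mx s2) M2).

Let mZ k : measurable_fun setT (joint_sample X Y k : S -> borel T).
Proof. by case: k => i; [have [] := X_law i|have [] := Y_law i]. Qed.

Let lX i (A : set (borel T)) : measurable A -> Pr (joint_sample X Y (inl i) @^-1` A) = P A.
Proof. by have [_] := X_law i; exact. Qed.
Let lY i (A : set (borel T)) : measurable A -> Pr (joint_sample X Y (inr i) @^-1` A) = Q A.
Proof. by have [_] := Y_law i; exact. Qed.

Let inl_inj : injective (@inl nat nat). Proof. by move=> i j []. Qed.
Let inr_inj : injective (@inr nat nat). Proof. by move=> i j []. Qed.

Definition linear_statistic (a b : R) n m (w : S) : rV :=
  \sum_(i < n) a *: zeta (X i w) + \sum_(j < m) b *: theta (Y j w).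

Lemma mean_linear_statistic a b n m Phi : bmf (Phi : B -> R) ->
  \int[Pr]_w Phi (linear_statistic a b n m w) =
  iter n (conv_op P (fun x => a *: zeta x))
    (iter m (conv_op Q (fun y => b *: theta y)) Phi) 0.
Proof.
move=> bP.
have mz : meas_coords (fun x => a *: zeta x).
  by apply: meas_coordsZ; [exact: measurable_cst|case: hz].
have mt : meas_coords (fun y => b *: theta y).
  by apply: meas_coordsZ; [exact: measurable_cst|case: ht].
rewrite (Rint_sum_conv (k := inr) (zeta := fun y => b *: theta y)
  (V := fun w => \sum_(i < n) a *: zeta (X i w)) mZ XY_indep inr_inj lY mt bP); last first.
  move=> j _; apply: (@meas_coords_sum _ _ _ (offType (joint_sample X Y) (inr j)) n
    (fun i w => a *: zeta (X i w))) => i _.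
  have mk := @measurable_off _ _ _ _ (joint_sample X Y) (inr j) (inl i) isT.
  exact: (meas_coords_comp (V := offType (joint_sample X Y) (inr j)) (U := borel T) mk mz).
have bI := iter_conv_bmf Q mt m bP.
under eq_Rintegral => w _ do rewrite -[\sum_(i < n) _]add0r.
rewrite (Rint_sum_conv (k := inl) (zeta := fun x => a *: zeta x)
  (V := fun w => 0) mZ XY_indep inl_inj lX mz bI); last by move=> *; exact: meas_coords_cst.
exact: Rint_cst.
Qed.

(** Each of the [n] replacements costs a multiple of [a ^+ 3] and each of the [m] others a multiple
    of [b ^+ 3]; with scales of order one over the root of the sample size the total vanishes. *)
Lemma lindeberg_bound Phi : bmf (Phi : B -> R) -> smooth3 Phi ->
  exists2 C, 0 <= C & forall a b n m, 0 <= a -> 0 <= b ->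
  `|\int[Pr]_w Phi (linear_statistic a b n m w) -
    gauss_op s1 (Num.sqrt n%:R * a) (gauss_op s2 (Num.sqrt m%:R * b) Phi) 0| <=
  C * (n%:R * a ^+ 3 + m%:R * b ^+ 3).
Proof.
move=> bP sP.
have [N1 hg1] := gauss_vec_moments s1; have [N2 hg2] := gauss_vec_moments s2.
have [K1 K10 st1] := lindeberg_step hz hg1 bP sP.
have [K2 K20 st2] := lindeberg_step ht hg2 bP sP.
exists (K1 + K2); first exact: addr_ge0.
move=> a b n m a0 b0; rewrite mean_linear_statistic//.
have mz : meas_coords (fun x => a *: zeta x).
  by apply: meas_coordsZ; [exact: measurable_cst|case: hz].
have mt : meas_coords (fun y => b *: theta y).
  by apply: meas_coordsZ; [exact: measurable_cst|case: ht].
set A := conv_op P _; set D := conv_op Q _.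
pose G1 := gauss_op s1 a; pose G2 := gauss_op s2 b.
have bG2 : bmf (iter m G2 Phi : B -> R) by exact: (iter_conv_bmf (gauss_vec s2) (meas_scale b) m bP).
have bD : bmf (iter m D Phi : B -> R) by exact: (iter_conv_bmf Q mt m bP).
have EG2 : iter m G2 Phi = gauss_op s2 (Num.sqrt m%:R * b) Phi.
  by apply/funext => x; exact: iter_gauss_op.
rewrite -EG2 -(iter_gauss_op s1 n 0 a0 bG2) -/G1.
have t1 : `|iter n A (iter m D Phi) 0 - iter n A (iter m G2 Phi) 0| <= m%:R * (K2 * b ^+ 3).
  rewrite -iter_convB//; apply: iter_conv_le => //; first exact: bmfB.
  move=> y; apply: iter_conv_dist => //; first exact: meas_scale.
  by move=> z; exact: st2.
have t2 : `|iter n A (iter m G2 Phi) 0 - iter n G1 (iter m G2 Phi) 0| <= n%:R * (K1 * a ^+ 3).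
  apply: iter_conv_dist => //; first exact: meas_scale.
  (* Smoothness is known for [Phi], not for its iterates, so [A] and [G1] are moved inside to act on
     [Phi] and the outer iterates only average the error. *)
  move=> y; rewrite -/A -[conv_op _ _]/G1.
  have c1 : A (iter m G2 Phi) y = iter m G2 (A Phi) y.
    exact: esym (iter_convC (gauss_vec s2) P (meas_scale b) mz m y bP).
  have c2 : G1 (iter m G2 Phi) y = iter m G2 (G1 Phi) y.
    exact: esym (iter_convC (gauss_vec s2) (gauss_vec s1) (meas_scale b) (meas_scale a) m y bP).
  rewrite c1 c2 -iter_convB; [|exact: meas_scale|exact: conv_op_bmf|exact: (conv_op_bmf _ (meas_scale a))].
  apply: iter_conv_le; [exact: meas_scale|by apply: bmfB; [exact: conv_op_bmf|exact: (conv_op_bmf _ (meas_scale a))]|].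
  by move=> z; exact: st1.
have := ler_normD (iter n A (iter m D Phi) 0 - iter n A (iter m G2 Phi) 0)
  (iter n A (iter m G2 Phi) 0 - iter n G1 (iter m G2 Phi) 0).
rewrite subrKA => t3; apply: le_trans t3 _; apply: le_trans (lerD t1 t2) _.
have x1 : 0 <= K1 * (m%:R * b ^+ 3) by rewrite !mulr_ge0// exprn_ge0.
have x2 : 0 <= K2 * (n%:R * a ^+ 3) by rewrite !mulr_ge0// exprn_ge0.
rewrite -subr_ge0 (_ : _ - _ = K1 * (m%:R * b ^+ 3) + K2 * (n%:R * a ^+ 3)); first exact: addr_ge0.
by ring.
Qed.

End two_sample_clt.

Lemma psd_second_moment (R : realType) d (U : measurableType d) (mu : probability U R)
    l (f : 'I_l -> U -> R) : (forall i, bmf (f i)) ->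
  psd (\matrix_(i < l, j < l) \int[mu]_x (f i x * f j x)).
Proof.
move=> bf; split.
  by apply/matrixP => i j; rewrite !mxE; apply: eq_Rintegral => x _; rewrite mulrC.
move=> u; rewrite [leRHS](_ : _ = \int[mu]_x ((\sum_i u 0 i * f i x) ^+ 2)).
  by apply: Rint_ge0 => x; exact: sqr_ge0.
have bM i j : bmf (fun x => f i x * f j x) by exact: bmfM.
have bZ r (g : U -> R) : bmf g -> bmf (fun x => r * g x) by move=> bg; apply: bmfM => //; exact: bmf_cst.
under [RHS]eq_Rintegral => x _ do rewrite expr2 mulr_suml.
rewrite Rint_sum; last by move=> i; apply: bmfM; [exact: bZ|apply: bmf_sum => j; exact: bZ].
rewrite mxE; under eq_bigr => j _ do rewrite !mxE mulr_suml.
rewrite exchange_big/=; apply: eq_bigr => i _.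
transitivity (\int[mu]_x (\sum_j u 0 i * u 0 j * (f i x * f j x))); last first.
  by apply: eq_Rintegral => x _; rewrite mulr_sumr; apply: eq_bigr => j _; ring.
rewrite Rint_sum; last by move=> j; exact: bZ.
by apply: eq_bigr => j _; rewrite mxE RintZl//; ring.
Qed.

Lemma gram_mx_cat (R : realType) l (s1 s2 : seq 'rV[R]_l) (a b : R) :
  gram_mx (map (fun v => a *: v) s1 ++ map (fun v => b *: v) s2) =
  a ^+ 2 *: gram_mx s1 + b ^+ 2 *: gram_mx s2.
Proof.
apply/matrixP => i j; rewrite gram_mxE big_cat !big_map mxE [in RHS]mxE [X in _ + X]mxE !gram_mxE !mulr_sumr.
by congr (_ + _); apply: eq_bigr => v _; rewrite !mxE; ring.
Qed.

Lemma cvg_invsqrt_nat (R : realType) : (fun k => (Num.sqrt (k%:R : R))^-1) @ \oo --> (0 : R).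
Proof.
apply/cvgrPdist_le => e e0; near=> k.
have h : e^-1 ^+ 2 <= k%:R by near: k; exact: nbhs_infty_ger.
have k0 : 0 < k%:R :> R by apply: lt_le_trans h; rewrite exprn_gt0// invr_gt0.
rewrite sub0r normrN ger0_norm ?invr_ge0 ?sqrtr_ge0//.
rewrite -[leRHS]invrK lef_pV2 ?posrE ?sqrtr_gt0 ?invr_gt0//.
by rewrite -[leLHS](ger0_norm (_ : 0 <= e^-1)) ?invr_ge0 ?(ltW e0)// -sqrtr_sqr ler_sqrt.
Unshelve. all: by end_near.
Qed.

(** * Linearization, Gaussian comparison and passage to the limit *)

Section assembly.
Context {R : realType} {T : ptopologicalType} d {S : measurableType d}.
Local Notation TT := (borel T * borel T)%type.
Variables (Pr : probability S R) (P Q : probability (borel T) R).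
Variables (X Y : nat -> S -> T).
Hypotheses (X_law : forall i, has_law Pr (X i) P) (Y_law : forall j, has_law Pr (Y j) Q).
Hypothesis XY_indep : mutually_independent Pr (joint_sample X Y).
Variables (c : T * T -> R).
Hypotheses (c_meas : measurable_fun [set: TT] c) (c_bnd : bounded_by_some c).
Variables (lambda : R) (l : nat) (t : 'I_l -> R).
Hypothesis lambda01 : 0 < lambda < 1.
Local Notation rV := 'rV[R]_l.
Local Notation B := (borel rV).

Definition pooled_rate (n m : nat) : R := Num.sqrt (n%:R * m%:R / (n + m)%:R).

Definition RCol_statistic (n m : nat) (w : S) : rV :=
  pooled_rate n m *:
    \row_(i < l) (RCol c (empirical n (X ^~ w)) (empirical m (Y ^~ w)) (t i) - RCol c P Q (t i)).

Lemma meas_coords_RCol_statistic n m : meas_coords (RCol_statistic n m).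
Proof.
(* With an empty sample the rate is 0, hence so is the statistic; this secures measurability for
   every index and not only eventually. *)
have [n0|n0] := posnP n.
  move=> i; rewrite (_ : (fun w => _) = fun=> 0); first exact: measurable_cst.
  by apply/funext => w; rewrite /RCol_statistic /pooled_rate mxE [X in Num.sqrt X](_ : _ = 0) ?sqrtr0 ?mul0r// n0 !mul0r.
have [m0|m0] := posnP m.
  move=> i; rewrite (_ : (fun w => _) = fun=> 0); first exact: measurable_cst.
  by apply/funext => w; rewrite /RCol_statistic /pooled_rate mxE [X in Num.sqrt X](_ : _ = 0) ?sqrtr0 ?mul0r// m0 mulr0 mul0r.
move=> i; rewrite /RCol_statistic; under eq_fun do rewrite !mxE.
apply: measurable_funM => //; apply: measurable_funB => //.
by apply: measurable_RCol => // j; [have [] := X_law j|have [] := Y_law j].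
Qed.

Variables (p q : 'I_l -> borel T -> R).
Hypotheses (bp : forall i, bmf (p i) /\ \int[P]_x p i x = 0) (bq : forall i, bmf (q i)).
Hypothesis pqE : forall i, (forall x, p i x + opQ c P Q (q i) x = eta_x c P Q (t i) x) /\
  (forall y, q i y + opP c P Q (p i) y = eta_y c P Q (t i) y).

(** Integrate the second equation of the system: [opP] preserves means and [p i] has mean zero. This
    is why centring [q i] alone centres the statistic. *)
Lemma RCol_mean i : RCol c P Q (t i) = \int[Q]_y q i y.
Proof.
have [k0 [k1 [bK k00 k01 K0 K1]]] := xi_bounds c_meas c_bnd P Q.
have mU := xi_Q c_meas c_bnd P Q; have mV := xi_P c_meas c_bnd P Q.
have [bpi p0] := bp i.
rewrite (RCol_xi c_meas c_bnd) Rint_prod21; last by apply: bmfM => //; exact: bmf_eta.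
have bA : bmf (kernel_op P (Defs.xi c P Q : TT -> R) (p i)) by exact: kernel_op_bmf.
transitivity (\int[Q]_y (q i y + kernel_op P (Defs.xi c P Q : TT -> R) (p i) y)).
  by apply: eq_Rintegral => y _; rewrite -[RHS]/(q i y + opP c P Q (p i) y) (pqE i).2.
by rewrite RintD// (kernel_op_mean (nu := Q) P bK mU bpi) p0 addr0.
Qed.

Definition x_influence (x : borel T) : rV := \row_i p i x.
Definition y_influence (y : borel T) : rV := \row_i (q i y - \int[Q]_y q i y).

Variables (s1 s2 : seq rV).
Hypotheses (gram1 : forall i j, gram_mx s1 i j = \int[P]_x (p i x * p j x))
  (gram2 : forall i j, gram_mx s2 i j =
    \int[Q]_y ((q i y - \int[Q]_y q i y) * (q j y - \int[Q]_y q j y))).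

Let limit_law := gauss_vec (map (fun v => Num.sqrt lambda *: v) s1 ++
  map (fun v => Num.sqrt (1 - lambda) *: v) s2).

Lemma x_influence_moments : exists M, has_moments P x_influence (gram_mx s1) M.
Proof.
apply: bounded_has_moments => [i|i|i j].
- by under eq_fun do rewrite mxE; exact: (bp i).1.
- by under eq_Rintegral => x _ do rewrite mxE; exact: (bp i).2.
- by under eq_Rintegral => x _ do rewrite !mxE; rewrite gram1.
Qed.

Lemma y_influence_moments : exists M, has_moments Q y_influence (gram_mx s2) M.
Proof.
apply: bounded_has_moments => [i|i|i j].
- by under eq_fun do rewrite mxE; apply: bmfB => //; exact: bmf_cst.
- by under eq_Rintegral => x _ do rewrite mxE; rewrite RintB//; [rewrite Rint_cst subrr|exact: bmf_cst].
- by under eq_Rintegral => x _ do rewrite !mxE; rewrite gram2.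
Qed.

(** The statistic is exactly the linear one plus the rate times the linearization errors, and [Phi]
    is Lipschitz, so a bound on the errors in mean is enough. *)
Lemma RCol_statistic_linear : exists2 C, 0 <= C & forall (Phi : rV -> R) L n m,
  bmf (Phi : B -> R) -> 0 <= L -> lip1 L Phi -> (0 < n)%N -> (0 < m)%N ->
  `|\int[Pr]_w Phi (RCol_statistic n m w) -
    \int[Pr]_w Phi (linear_statistic X Y x_influence y_influence
      (pooled_rate n m / n%:R) (pooled_rate n m / m%:R) n m w)|
  <= L * (C * (pooled_rate n m / n%:R + pooled_rate n m / m%:R)).
Proof.
have /boolp.choice[C CE] : forall i, exists C, 0 <= C /\ forall n m, (0 < n)%N -> (0 < m)%N ->
  bmf (fun w => RCol c (empirical n (X ^~ w)) (empirical m (Y ^~ w)) (t i)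
     - \int[empirical n (X ^~ w)]_x p i x - \int[empirical m (Y ^~ w)]_y q i y) /\
  \int[Pr]_w `|RCol c (empirical n (X ^~ w)) (empirical m (Y ^~ w)) (t i)
     - \int[empirical n (X ^~ w)]_x p i x - \int[empirical m (Y ^~ w)]_y q i y|
    <= C * (n%:R^-1 + m%:R^-1).
  move=> i; have [C C0 h] := mean_RCol_linearization X_law Y_law XY_indep c_meas c_bnd (bp i).1 (bq i) (pqE i).1 (pqE i).2.
  by exists C.
exists (\sum_i C i); first by apply: sumr_ge0 => i _; case: (CE i).
move=> Phi L n m bPhi L0 PL n0 m0; set r := pooled_rate n m.
have r0 : 0 <= r by exact: sqrtr_ge0.
pose E i w := RCol c (empirical n (X ^~ w)) (empirical m (Y ^~ w)) (t i)
     - \int[empirical n (X ^~ w)]_x p i x - \int[empirical m (Y ^~ w)]_y q i y.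
have bE i : bmf (E i) by exact: ((CE i).2 n m n0 m0).1.
pose lin w := linear_statistic X Y x_influence y_influence (r / n%:R) (r / m%:R) n m w.
have WE w : RCol_statistic n m w = lin w + r *: \row_i E i w.
  apply/rowP => i; rewrite !mxE !summxE -/r /E RCol_mean.
  rewrite (Rint_empirical (X ^~ w) n0 (bp i).1) (Rint_empirical (Y ^~ w) m0 (bq i)).
  have -> : \sum_(j < n) ((r / n%:R) *: x_influence (X j w)) 0 i = r / n%:R * \sum_(j < n) p i (X j w).
    by rewrite mulr_sumr; apply: eq_bigr => j _; rewrite !mxE.
  have -> : \sum_(j < m) ((r / m%:R) *: y_influence (Y j w)) 0 i =
      r / m%:R * (\sum_(j < m) q i (Y j w) - m%:R * \int[Q]_y q i y).
    have -> : m%:R * \int[Q]_y q i y = \sum_(j < m) \int[Q]_y q i y.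
      by rewrite sumr_const card_ord mulr_natl.
    rewrite -sumrB mulr_sumr.
    by apply: eq_bigr => j _; rewrite !mxE.
  by field; rewrite !pnatr_eq0 -!lt0n n0 m0.
have mlin : meas_coords lin.
  have mX i : measurable_fun setT (X i : S -> borel T) by have [] := X_law i.
  have mY i : measurable_fun setT (Y i : S -> borel T) by have [] := Y_law i.
  have [M1 [mx _ _ _]] := x_influence_moments; have [M2 [my _ _ _]] := y_influence_moments.
  apply: meas_coordsD.
    apply: (@meas_coords_sum _ _ _ S n (fun i w => (r / n%:R) *: x_influence (X i w))) => i _.
    by apply: meas_coordsZ; [exact: measurable_cst|exact: (meas_coords_comp (mX i) mx)].
  apply: (@meas_coords_sum _ _ _ S m (fun i w => (r / m%:R) *: y_influence (Y i w))) => i _.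
  by apply: meas_coordsZ; [exact: measurable_cst|exact: (meas_coords_comp (mY i) my)].
have b1 := bmf_rV_comp (@meas_coords_RCol_statistic n m) bPhi.
have b2 := bmf_rV_comp mlin bPhi.
rewrite -RintB//; apply: le_trans (norm_Rint Pr (bmfB b1 b2)) _.
have bS : bmf (fun w => \sum_i `|E i w|) by apply: bmf_sum => i; exact: bmf_norm.
have bLS : bmf (fun w => L * (r * \sum_i `|E i w|)).
  exact: (bmfM (bmf_cst L) (bmfM (bmf_cst r) bS)).
apply: (@le_trans _ _ (\int[Pr]_w (L * (r * \sum_i `|E i w|)))).
  apply: (le_Rint Pr (bmf_norm (bmfB b1 b2)) bLS) => w.
  rewrite WE; apply: le_trans (PL _ _) _; rewrite norm1Z (ger0_norm r0).
  by rewrite /norm1; under eq_bigr => i _ do rewrite mxE.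
rewrite (RintZl Pr L (bmfM (bmf_cst r) bS)) (RintZl Pr r bS) Rint_sum; last by move=> i; exact: bmf_norm.
rewrite ler_wpM2l//.
rewrite (_ : _ * (r / n%:R + r / m%:R) = r * \sum_i C i * (n%:R^-1 + m%:R^-1)); last first.
  by rewrite -mulr_suml; ring.
rewrite ler_wpM2l//; apply: ler_sum => i _.
exact: ((CE i).2 n m n0 m0).2.
Qed.

(** Collects three errors: linearization, replacement by Gaussians, and the exchange of the
    finite-sample proportions for [lambda] and [1 - lambda] in the scales of the Gaussian
    operators. *)
Lemma RCol_statistic_bound (Phi : rV -> R) : bmf (Phi : B -> R) -> smooth3 Phi ->
  exists2 C, 0 <= C & forall n m, (0 < n)%N -> (0 < m)%N ->
  `|\int[Pr]_w Phi (RCol_statistic n m w) - \int[limit_law]_v Phi v| <=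
  C * ((Num.sqrt n%:R)^-1 + (Num.sqrt m%:R)^-1) +
  C * (`|Num.sqrt (m%:R / (n + m)%:R) - Num.sqrt lambda| +
       `|Num.sqrt (1 - m%:R / (n + m)%:R) - Num.sqrt (1 - lambda)|).
Proof.
move=> bPhi sPhi; have [L L0 PL] := smooth3_lip1 sPhi.
have [C1 C10 h1] := RCol_statistic_linear.
have [M1 hz] := x_influence_moments; have [M2 ht] := y_influence_moments.
have [C2 C20 h2] := lindeberg_bound X_law Y_law XY_indep hz ht bPhi sPhi.
pose e1 := \int[gauss_vec s1]_v norm1 (v : rV); pose e2 := \int[gauss_vec s2]_v norm1 (v : rV).
have e10 : 0 <= e1 by apply: Rint_ge0 => v; exact: norm1_ge0.
have e20 : 0 <= e2 by apply: Rint_ge0 => v; exact: norm1_ge0.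
have LC0 : 0 <= L * C1 by exact: mulr_ge0.
have Le1 : 0 <= L * e1 by exact: mulr_ge0.
have Le2 : 0 <= L * e2 by exact: mulr_ge0.
exists (L * C1 + C2 + L * e1 + L * e2); first by rewrite !addr_ge0.
move=> n m n0 m0.
have n0' : 0 < n%:R :> R by rewrite ltr0n.
have m0' : 0 < m%:R :> R by rewrite ltr0n.
have nm0 : 0 < (n + m)%:R :> R by rewrite ltr0n addn_gt0 n0.
pose al := Num.sqrt (m%:R / (n + m)%:R : R); pose be := Num.sqrt (1 - m%:R / (n + m)%:R : R).
pose r := pooled_rate n m.
have nE : n%:R = Num.sqrt n%:R * Num.sqrt n%:R :> R by rewrite -expr2 sqr_sqrtr// ltW.
have mE : m%:R = Num.sqrt m%:R * Num.sqrt m%:R :> R by rewrite -expr2 sqr_sqrtr// ltW.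
have beE : be = Num.sqrt (n%:R / (n + m)%:R).
  by rewrite /be; congr Num.sqrt; rewrite natrD; field; rewrite -natrD gt_eqF.
have sn0 : 0 < Num.sqrt n%:R :> R by rewrite sqrtr_gt0.
have sm0 : 0 < Num.sqrt m%:R :> R by rewrite sqrtr_gt0.
(* The rate cancels the root of the first sample size up to the share of the second sample; hence
   [lambda], the limit of the share of [m], multiplies the variance of the [X] part. *)
have ra : r = Num.sqrt n%:R * al by rewrite /r /pooled_rate -mulrA sqrtrM ?ltW.
have rb : r = Num.sqrt m%:R * be by rewrite beE /r /pooled_rate [n%:R * _]mulrC -mulrA sqrtrM ?ltW.
have rn : r / n%:R = al / Num.sqrt n%:R by rewrite ra [X in _ / X = _]nE; field; rewrite gt_eqF.
have rm : r / m%:R = be / Num.sqrt m%:R by rewrite rb [X in _ / X = _]mE; field; rewrite gt_eqF.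
have al0 : 0 <= al by exact: sqrtr_ge0.
have be0 : 0 <= be by exact: sqrtr_ge0.
have al1 : al <= 1.
  by rewrite -sqrtr1 ler_sqrt ?ltr01// ler_pdivrMr// mul1r ler_nat leq_addl.
have be1 : be <= 1.
  by rewrite beE -[leRHS]sqrtr1 ler_sqrt ?ltr01// ler_pdivrMr// mul1r ler_nat leq_addr.
set a := r / n%:R in rn *; set b := r / m%:R in rm *.
have a0 : 0 <= a by rewrite rn divr_ge0// ltW.
have b0 : 0 <= b by rewrite rm divr_ge0// ltW.
have ale : a <= (Num.sqrt n%:R)^-1 by rewrite rn -[leRHS]mul1r ler_wpM2r// invr_ge0 ltW.
have ble : b <= (Num.sqrt m%:R)^-1 by rewrite rm -[leRHS]mul1r ler_wpM2r// invr_ge0 ltW.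
have sa : Num.sqrt n%:R * a = al by rewrite rn mulrC divfK// gt_eqF.
have sb : Num.sqrt m%:R * b = be by rewrite rm mulrC divfK// gt_eqF.
have na3 : n%:R * a ^+ 3 <= (Num.sqrt n%:R)^-1.
  have -> : n%:R * a ^+ 3 = (Num.sqrt n%:R * a) ^+ 2 * a by rewrite [(_ * a) ^+ 2]exprMn sqr_sqrtr ?ltW//; ring.
  rewrite sa -[leRHS]mul1r; apply: ler_pM => //; first exact: sqr_ge0.
  exact: exprn_ile1.
have mb3 : m%:R * b ^+ 3 <= (Num.sqrt m%:R)^-1.
  have -> : m%:R * b ^+ 3 = (Num.sqrt m%:R * b) ^+ 2 * b by rewrite [(_ * b) ^+ 2]exprMn sqr_sqrtr ?ltW//; ring.
  rewrite sb -[leRHS]mul1r; apply: ler_pM => //; first exact: sqr_ge0.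
  exact: exprn_ile1.
have t1 := h1 Phi L n m bPhi L0 PL n0 m0.
have t2 := h2 a b n m a0 b0.
rewrite sa sb in t2.
set G := fun s x F => gauss_op s x F : rV -> R.
have bG s x F : bmf (F : B -> R) -> bmf (gauss_op s x F : B -> R) by exact: gauss_op_bmf.
have t3 : `|gauss_op s1 al (gauss_op s2 be Phi) 0 - gauss_op s1 (Num.sqrt lambda) (gauss_op s2 be Phi) 0| <=
    L * e1 * `|al - Num.sqrt lambda|.
  apply: gauss_op_scale_dist => //; first exact: bG.
  by apply: conv_op_lip1 => //; exact: meas_scale.
have t4 : `|gauss_op s1 (Num.sqrt lambda) (gauss_op s2 be Phi) 0 -
    gauss_op s1 (Num.sqrt lambda) (gauss_op s2 (Num.sqrt (1 - lambda)) Phi) 0| <=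
    L * e2 * `|be - Num.sqrt (1 - lambda)|.
  have mS := @meas_scale R l (Num.sqrt lambda).
  rewrite /(gauss_op s1) -(conv_opB _ mS); [|exact: bG|exact: bG].
  apply: (conv_op_le _ mS); first by apply: bmfB; exact: bG.
  by move=> y; exact: gauss_op_scale_dist.
rewrite /limit_law gauss_vec_cat//.
set W := \int[Pr]_w Phi (RCol_statistic n m w) in t1 *.
set Ln := \int[Pr]_w Phi _ in t1 t2.
move: t1 t2 t3 t4; rewrite -/al -/be.
set g1 := gauss_op s1 al _ 0; set g2 := gauss_op s1 _ (gauss_op s2 be Phi) 0.
set g3 := gauss_op s1 _ (gauss_op s2 _ Phi) 0 => t1 t2 t3 t4.
have u1 := ler_normD (W - Ln) (Ln - g1); rewrite subrKA in u1.
have u2 := ler_normD (W - g1) (g1 - g2); rewrite subrKA in u2.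
have u3 := ler_normD (W - g2) (g2 - g3); rewrite subrKA in u3.
set ia := (Num.sqrt n%:R)^-1 in ale na3 *; set ib := (Num.sqrt m%:R)^-1 in ble mb3 *.
set da := `|al - _| in t3 *; set db := `|be - _| in t4 *.
have v1 : L * (C1 * (a + b)) <= L * C1 * (ia + ib) by rewrite mulrA ler_wpM2l// lerD.
have v2 : C2 * (n%:R * a ^+ 3 + m%:R * b ^+ 3) <= C2 * (ia + ib) by rewrite ler_wpM2l// lerD.
have da0 : 0 <= da by exact: normr_ge0.
have db0 : 0 <= db by exact: normr_ge0.
have ia0 : 0 <= ia by exact: le_trans a0 ale.
have ib0 : 0 <= ib by exact: le_trans b0 ble.
have w1 : 0 <= (L * e1 + L * e2) * (ia + ib) by rewrite mulr_ge0 ?addr_ge0.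
have w2 : 0 <= (L * C1 + C2) * (da + db) by rewrite mulr_ge0 ?addr_ge0.
have w3 : 0 <= L * e1 * db by rewrite mulr_ge0.
have w4 : 0 <= L * e2 * da by rewrite mulr_ge0.
have b1 := le_trans t1 v1; have b2 := le_trans t2 v2.
have bound : `|W - g3| <= L * C1 * (ia + ib) + C2 * (ia + ib) + L * e1 * da + L * e2 * db.
  apply: le_trans u3 _; apply: lerD t4.
  apply: le_trans u2 _; apply: lerD t3.
  by apply: le_trans u1 _; exact: lerD.
apply: le_trans bound _; rewrite -subr_ge0.
rewrite (_ : _ - _ = (L * e1 + L * e2) * (ia + ib) + (L * C1 + C2) * (da + db) + L * e1 * db + L * e2 * da).
  by rewrite !addr_ge0.
by ring.
Qed.

Lemma RCol_statistic_cvg (n m : nat -> nat) (n_oo : n @ \oo --> \oo) (m_oo : m @ \oo --> \oo)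
    (nm_ratio : (fun k => (m k)%:R / (n k + m k)%:R : R) @ \oo --> lambda) :
  cvg_in_law Pr (fun k => RCol_statistic (n k) (m k)) limit_law.
Proof.
apply: cvg_in_law_smooth => [k|Phi bPhi sPhi]; first exact: meas_coords_RCol_statistic.
have [C C0 bound] := RCol_statistic_bound bPhi sPhi.
pose v k := C * ((Num.sqrt (n k)%:R)^-1 + (Num.sqrt (m k)%:R)^-1) +
  C * (`|Num.sqrt ((m k)%:R / (n k + m k)%:R) - Num.sqrt lambda| +
       `|Num.sqrt (1 - (m k)%:R / (n k + m k)%:R) - Num.sqrt (1 - lambda)|).
have sq (u : nat -> R) (x : R) : u @ \oo --> x -> (fun k => `|Num.sqrt (u k) - Num.sqrt x|) @ \oo --> (0 : R).
  move=> ux; rewrite -[X in _ --> X](normr0 R) -(subrr (Num.sqrt x)); apply: cvg_norm.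
  apply: cvgB; last exact: cvg_cst.
  exact: (continuous_cvg _ (@sqrt_continuous R x) ux).
have v0 : v @ \oo --> C * (0 + 0) + C * (0 + 0).
  apply: cvgD; apply: cvgM; try exact: cvg_cst.
    apply: cvgD.
      exact: (cvg_comp _ _ n_oo (@cvg_invsqrt_nat R)).
    exact: (cvg_comp _ _ m_oo (@cvg_invsqrt_nat R)).
  apply: cvgD; first exact: sq.
  by apply: sq; apply: cvgB nm_ratio; exact: cvg_cst.
apply/cvgrPdist_le => e e0; move: v0; rewrite !addr0 mulr0 addr0.
move=> /cvgrPdist_le/(_ e e0) v0.
have n0' : \forall k \near \oo, (0 < n k)%N := n_oo _ (nbhs_infty_gt 0).
have m0' : \forall k \near \oo, (0 < m k)%N := m_oo _ (nbhs_infty_gt 0).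
near=> k.
have n0 : (0 < n k)%N by near: k; exact: n0'.
have m0 : (0 < m k)%N by near: k; exact: m0'.
have vk : `|0 - v k| <= e by near: k; exact: v0.
rewrite distrC; apply: le_trans (bound _ _ n0 m0) _.
by apply: le_trans vk; rewrite sub0r normrN; exact: ler_norm.
Unshelve. all: by end_near.
Qed.

End assembly.

Theorem corollary4p5
  (R : realType) (T : ptopologicalType) (T_polish : polish R T)
  (c : T * T -> R)
  (c_meas : measurable_fun [set: (borel T * borel T)%type] c)
  (c_bnd : bounded_by_some c)
  (P Q : probability (borel T) R)
  (d : measure_display) (S : measurableType d) (Pr : probability S R)
  (X Y : nat -> S -> T)
  (X_law : forall i, has_law Pr (X i) P)
  (Y_law : forall j, has_law Pr (Y j) Q)
  (XY_indep : mutually_independent Pr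
    (fun k : nat + nat => match k with inl i => X i | inr j => Y j end))
  (lambda : R) (lambda01 : 0 < lambda < 1)
  (n m : nat -> nat)
  (n_oo : n @ \oo --> \oo) (m_oo : m @ \oo --> \oo)
  (nm_ratio : (fun k => (m k)%:R / (n k + m k)%:R : R) @ \oo --> lambda)
  (l : nat) (t : 'I_l -> R) :
  exists N : probability (borel 'rV[R]_l) R,
    is_centered_normal (Sigma c P Q lambda t) N /\
    cvg_in_law Pr
      (fun k w =>
        Num.sqrt ((n k)%:R * (m k)%:R / (n k + m k)%:R) *:
          \row_(i < l)
            (RCol c (empirical (n k) (X ^~ w)) (empirical (m k) (Y ^~ w)) (t i)
             - RCol c P Q (t i)))
      N.
Proof.
have [p [q [bp bq pqE SE]]] := SigmaE c_meas c_bnd P Q t lambda01.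
have bq0 i : bmf (fun y => q i y - \int[Q]_y q i y) by apply: bmfB => //; exact: bmf_cst.
(* The two samples are factored separately; rescaled by the roots of [lambda] and [1 - lambda],
   their generators together have [Sigma] as Gram matrix. *)
have [s1 g1] := psd_gram (psd_second_moment P (fun i => (bp i).1)).
have [s2 g2] := psd_gram (psd_second_moment Q bq0).
have gram1 i j : gram_mx s1 i j = \int[P]_x (p i x * p j x) by rewrite -g1 mxE.
have gram2 i j : gram_mx s2 i j =
    \int[Q]_y ((q i y - \int[Q]_y q i y) * (q j y - \int[Q]_y q j y)) by rewrite -g2 mxE.
exists (gauss_vec (map (fun v => Num.sqrt lambda *: v) s1 ++
  map (fun v => Num.sqrt (1 - lambda) *: v) s2)); split.
  have -> : Sigma c P Q lambda t = gram_mx (map (fun v => Num.sqrt lambda *: v) s1 ++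
      map (fun v => Num.sqrt (1 - lambda) *: v) s2).
    have /andP[l0 l1] := lambda01.
    rewrite gram_mx_cat !sqr_sqrtr ?subr_ge0 ?ltW//.
    by apply/matrixP => i j; rewrite SE -gram1 -gram2 [RHS]mxE [X in _ = X + _]mxE [X in _ = _ + X]mxE.
  exact: gauss_vec_normal.
exact: (RCol_statistic_cvg X_law Y_law XY_indep c_meas c_bnd bp bq pqE gram1 gram2 n_oo m_oo nm_ratio).
Qed.
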